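(* Let $\mathfrak{E}_2$ denote the collection of open ellipses in $\mathbb{R}^2$. Then: (i) $$\sup\{H(\Omega):\Omega\in\mathfrak{E}_2\}=H(B_1),$$ and the supremum in the left-hand side is achieved if and only if $\Omega$ is a ball. (ii) $$\sup\{H(\Omega):\Omega\subset\mathbb{R}^2 \text{ non-empty, open, bounded and convex}\}\le 8H(B_1).$$ (iii) If $b_1\ge b_2$ (with $b_2>0$), then $$H(E(b_1,b_2))\le 2^{-1/2}H(B_1)\bigg(1+\frac{b_2}{b_1}\bigg).$$
   Context: For a non-empty open set $\Omega\subset\mathbb{R}^2$ with finite Lebesgue measure $|\Omega|$, the torsion function $u_\Omega$ is the solution of $-\Delta u=1$, $u\in H_0^1(\Omega)$, and the torsional rigidity is $T(\Omega)=\|u_\Omega\|_{L^1}$. For compact $K\subset\mathbb{R}^2$, $\mathrm{cap}(K)$ denotes the logarithmic capacity: $\mathrm{cap}(K)=e^{-V(K)}$ with $V(K)=\inf\{I(\mu):\mu \text{ a probability measure on } K\}$ and $I(\mu)=\iint_{K\times K}\log\big(\tfrac{1}{|x-y|}\big)\mu(dx)\mu(dy)$. The functional $H$ is $$H(\Omega)=\frac{T(\Omega)^{1/2}\,\mathrm{cap}(\overline{\Omega})}{|\Omega|^{3/2}};$$ it is invariant under scaling. $B_1$ is a disc (ball in $\mathbb{R}^2$) of radius $1$, and $E(b_1,b_2)=\{x\in\mathbb{R}^2: x_1^2/b_1^2+x_2^2/b_2^2<1\}$ for $b_1,b_2>0$. *)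

(* Defs.v *)
(* MathComp-Analysis, over an arbitrary [R : realType]; the plane is [R * R]. *)
From HB Require Import structures.
From mathcomp Require Export all_boot all_order all_algebra.
From mathcomp Require Export all_classical all_reals all_analysis.
Export Order.TTheory GRing.Theory Num.Theory.
Export numFieldNormedType.Exports.

Set Implicit Arguments.
Unset Strict Implicit.
Unset Printing Implicit Defensive.

Local Open Scope classical_set_scope.
Local Open Scope ring_scope.

(* [measurableTypeR R] is [R] with its Borel sets, the domain of the library's
   Lebesgue measure; [plane R] is convertible to [R * R]. *)
Notation plane R := (measurableTypeR R * measurableTypeR R)%type.

Definition leb2 {R : realType} : {measure set (plane R) -> \bar R} :=
  (@lebesgue_measure R \x @lebesgue_measure R)%E.

(* The library norm of [R * R] is the sup norm; it gives the usual topology and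
   bounded sets, but distances have to be Euclidean. *)
Definition edist {R : realType} (x y : R * R) : R :=
  Num.sqrt ((x.1 - y.1) ^+ 2 + (x.2 - y.2) ^+ 2).

Section Sobolev.
Context {R : realType}.
Implicit Types (Omega : set (R * R)) (u v phi : R * R -> R)
  (g : 'I_2 -> R * R -> R).

Definition axis (i : 'I_2) : R * R := if i == ord0 then (1, 0) else (0, 1).

Definition partial (i : 'I_2) (f : R * R -> R) : R * R -> R :=
  fun x => 'D_(axis i) f x.

Definition smooth (f : R * R -> R) : Prop :=
  forall s : seq 'I_2,
    continuous (foldr partial f s) /\
    forall i x, derivable (foldr partial f s) x (axis i).

(* phi \in C_c^oo(Omega), extended by 0 to the plane *)
Definition test_function Omega phi : Prop :=
  [/\ smooth phi, compact (closure [set x | phi x != 0]) &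
      closure [set x | phi x != 0] `<=` Omega].

Definition L2 Omega u : Prop := u \_ Omega \in Lfun leb2 2%:E.

Definition weak_partial Omega (i : 'I_2) u v : Prop :=
  forall phi, test_function Omega phi ->
    \int[leb2]_(x in Omega) (u x * partial i phi x) =
    - \int[leb2]_(x in Omega) (v x * phi x).

(* u \in H^1(Omega) with weak gradient g; only the values on Omega matter
   ([u \_ Omega] is the extension of u by [point = 0 : R] outside Omega). *)
Definition in_H1 Omega u g : Prop :=
  L2 Omega u /\ forall i, L2 Omega (g i) /\ weak_partial Omega i u (g i).

(* The H^1(Omega)-norm of a function u with gradient g. *)
Definition H1norm Omega u g : \bar R :=
  poweR ('N[leb2]_2%:E [EFin \o (u \_ Omega)] ^+ 2 +
         \sum_(i < 2) 'N[leb2]_2%:E [EFin \o (g i \_ Omega)] ^+ 2)%E 2^-1.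

(* H_0^1(Omega) is the closure of C_c^oo(Omega) in H^1(Omega). *)
Definition in_H10 Omega u g : Prop :=
  in_H1 Omega u g /\
  exists phi : nat -> R * R -> R,
    (forall n, test_function Omega (phi n)) /\
    H1norm Omega (phi n \- u) (fun i => partial i (phi n) \- g i)
      @[n --> \oo] --> 0%E.

Definition is_torsion_function Omega u : Prop :=
  exists2 g, in_H10 Omega u g &
    forall phi, test_function Omega phi ->
      \int[leb2]_(x in Omega) (\sum_(i < 2) g i x * partial i phi x) =
      \int[leb2]_(x in Omega) phi x.

(* For Omega open of finite measure a torsion function exists and is unique up
   to a null subset of Omega: the default value of [xget] is not used and the
   norm below does not depend on the choice. *)
Definition torsion_function Omega : R * R -> R :=
  xget (cst 0) [set u | is_torsion_function Omega u].

Definition torsional_rigidity Omega : \bar R :=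
  'N[leb2]_1%:E [EFin \o (torsion_function Omega \_ Omega)]%E.

End Sobolev.

Section Capacity.
Context {R : realType}.
Local Open Scope ereal_scope.

(* The kernel is +oo on the diagonal: 0^-1 = +oo and [lne +oo = +oo] in \bar R. *)
Definition log_energy (K : set (R * R)) (mu : probability (plane R) R)
    : \bar R :=
  \int[mu \x mu]_(z in K `*` K) lne ((edist z.1 z.2)%:E^-1).

(* Probability measures on K, as Borel probabilities on the plane carried by K. *)
Definition robin_constant (K : set (R * R)) : \bar R :=
  ereal_inf [set log_energy K mu |
    mu in [set mu : probability (plane R) R | mu K = 1]].

Definition log_capacity (K : set (R * R)) : \bar R :=
  expeR (- robin_constant K).

Definition H_functional (Omega : set (R * R)) : \bar R :=
  poweR (torsional_rigidity Omega) 2^-1 * log_capacity (closure Omega) /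
  poweR (leb2 Omega) (3 / 2).

End Capacity.

Section Shapes.
Context {R : realType}.

Definition disc (c : R * R) (r : R) : set (R * R) :=
  [set x | edist c x < r].

Definition is_disc (Omega : set (R * R)) : Prop :=
  exists c r, 0 < r /\ Omega = disc c r.

Definition std_ellipse (b1 b2 : R) : set (R * R) :=
  [set x | x.1 ^+ 2 / b1 ^+ 2 + x.2 ^+ 2 / b2 ^+ 2 < 1].

Definition rotation (t : R) (x : R * R) : R * R :=
  (cos t * x.1 - sin t * x.2, sin t * x.1 + cos t * x.2).

(* Open ellipses with arbitrary centre and orientation, discs included. *)
Definition is_ellipse (Omega : set (R * R)) : Prop :=
  exists (c : R * R) (t b1 b2 : R), [/\ 0 < b1, 0 < b2 &
    Omega = (fun x => c + rotation t x) @` std_ellipse b1 b2].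

End Shapes.

(* Main.v *)
From HB Require Import structures.
Require Import Defs.
From mathcomp Require Import perm complex measurable_realfun ring lra zify.
Set Implicit Arguments.
Unset Strict Implicit.
Unset Printing Implicit Defensive.
Local Open Scope classical_set_scope.
Local Open Scope ring_scope.

(** For an ellipse E with semi-axes b1 and b2, two of the three ingredients of
    the functional are computed and the third one is estimated:
    - the torsion function is U = (1 - q) / (2 (b1^-2 + b2^-2)), where q < 1 is
      the equation of E, so that the torsional rigidity is proportional to
      b1^3 b2^3 / (b1^2 + b2^2);
    - the area is a multiple of b1 b2;
    - the capacity of the closure is at most (b1 + b2) / 2, with equality for a
      disc.
    Hence the value at E is at most (b1 + b2) / sqrt (2 (b1^2 + b2^2)) times the
    value at a disc (H_functional_ellipse_le, H_functional_disc). This factor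
    is less than 1 unless b1 = b2, and at most 2^(-1/2) (1 + b2 / b1); the
    first and the third claims follow. For a convex set Omega, the area is at
    least a quarter of the area of some ellipse containing it
    (convex_in_ellipse). Torsional rigidity and capacity are bounded by those
    of the ellipse, and the loss of area costs the factor 4^(3/2) = 8.

    Torsion. The torsional rigidity of any measurable Omega contained in E is
    at most the integral of U over E (torsional_rigidity_le), with equality for
    Omega = E (torsional_rigidity_quad). The inequality rests on Picone's
    identity: for a test function phi supported in E,
      2 int |phi| <= int |grad phi|^2 + int_E U,
    by integrating the divergence of phi^2 / U grad U (picone).
    Applied to test functions close to a torsion function u of Omega, it gives
    the bound, because int |grad u|^2 = int u by the weak equation
    (torsion_norm1_le). For the equality, U is approximated in H^1 by the
    smooth functions U exp (- 1 / (n U - 1)), extended by 0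
    (quad_in_H10), and two torsion functions have the same integral by symmetry
    of the weak form.

    Capacity. A point of the closed ellipse, seen as a complex number, is u + v
    with u v = (b1^2 - b2^2) / 4 and |u|, |v| <= a = (b1 + b2) / 2. The Faber
    polynomials, monic with value u^j + v^j at u + v, are then at most 2 a^j,
    and a Vandermonde determinant bounds the product of all distances of n
    points by n! 2^n a^(n (n - 1) / 2) (prod_diff_le). On the other hand, for
    every probability measure there are n points whose energy is at most the
    mean (exists_pair_energy_le), and n tending to infinity gives
    - ln a <= I(mu) (log_energy_ge). For a disc, the uniform measure on the
    circle has the right energy by the log-sine integral (log_capacity_ge). *)

(** * Areas under affine maps *)
Definition image_measure d d' (T1 : measurableType d) (T2 : measurableType d')
    (R : realType) (m : {measure set T1 -> \bar R}) (f : T1 -> T2)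
    (mf : measurable_fun setT f) : {measure set T2 -> \bar R} :=
  @measure_function_pushforward__canonical__measure_function_Measure
    d d' T1 T2 R m f mf.

Section PlaneBorel.
Context {R : realType}.

Lemma open_measurable_plane (A : set (R * R)) :
  open A -> measurable (A : set (plane R)).
Proof.
move=> oA.
pose box (i : rat * rat * nat) : set (R * R) :=
  ball (ratr i.1.1 : R, ratr i.1.2 : R) (i.2.+1%:R^-1).
have -> : A = \bigcup_(i in [set i | box i `<=` A]) box i.
  apply/seteqP; split => [x Ax|x [i /= iA /iA]//].
  have [e /= e0 xeA] : exists2 e : R, 0 < e & ball x e `<=` A.
    by have /nbhs_ballP[e /= e0 ?] := oA _ Ax; exists e.
  have [n [d [dE d0 ne]]] : exists n (d : R), [/\ d = n.+1%:R^-1, 0 < d & d < e / 2].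
    have e2 : 0 < e / 2 by rewrite divr_gt0.
    have [n _ /(_ _ (leqnn n)) ?] := near_infty_natSinv_lt (PosNum e2).
    by exists n, n.+1%:R^-1; split=> //; rewrite invr_gt0.
  have rt (y : R) : exists q : rat, `|y - ratr q| < d.
    have /rat_in_itvoo[q] : y - d < y + d by lra.
    by rewrite in_itv/= => /andP[? ?]; exists q; rewrite ltr_norml; apply/andP; split; lra.
  have [[q1 h1] [q2 h2]] := (rt x.1, rt x.2).
  exists (q1, q2, n); last first.
    by rewrite /box/= -dE; split; rewrite /ball/= /ball_ distrC.
  move=> y []; rewrite -dE /ball/= /ball_ => y1 y2; apply: xeA; split => /=;
    rewrite /ball/= /ball_.
    by rewrite -(subrKA (ratr q1)) (le_lt_trans (ler_normD _ _))//; lra.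
  by rewrite -(subrKA (ratr q2)) (le_lt_trans (ler_normD _ _))//; lra.
rewrite bigcup_mkcond; apply: countable_bigcupT_measurable => // i.
case: ifPn => // _.
have -> : box i = ball (ratr i.1.1 : R) (i.2.+1%:R^-1) `*` ball (ratr i.1.2 : R) (i.2.+1%:R^-1).
  by apply/seteqP; split => -[x y].
by apply: measurableX; exact: measurable_ball.
Qed.

Lemma closed_measurable_plane (A : set (R * R)) :
  closed A -> measurable (A : set (plane R)).
Proof.
by move=> /closed_openC/open_measurable_plane/measurableC; rewrite setCK.
Qed.

Lemma continuous_measurable_plane (f : R * R -> R) :
  continuous f -> measurable_fun setT (f : plane R -> R).
Proof.
move=> /continuousP cf; apply: (measurability _ (RGenOpens.measurableE R)).
move=> _ [_ [a [b ->] <-]]; rewrite setTI; apply: open_measurable_plane.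
exact/cf/interval_open.
Qed.

End PlaneBorel.

Section Area.
Context {R : realType}.
Implicit Types (A B : set (plane R)) (phi psi : plane R -> plane R).

(** The convention is on preimages: for affine phi, k is the inverse of the
    absolute value of its determinant. *)
Definition scales_area (k : R) phi : Prop :=
  measurable_fun setT phi /\
  forall A, measurable A -> leb2 (phi @^-1` A) = (k%:E * leb2 A)%E.

Lemma scales_area_comp k l phi psi : 
  scales_area k phi -> scales_area l psi -> scales_area (k * l) (psi \o phi).
Proof.
move=> [mphi kphi] [mpsi lpsi]; split; first exact: measurableT_comp.
move=> A mA; rewrite comp_preimage kphi ?lpsi ?EFinM ?muleA//.
by rewrite -(setTI (_ @^-1` _)); exact: mpsi.
Qed.

(** By uniqueness of Lebesgue measure: the pushforward, rescaled, has the right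
    value on half-open intervals. *)
Lemma lebesgue_affine (a b : R) (A : set R) : 0 < a -> measurable A ->
  lebesgue_measure ((fun x : measurableTypeR R => a * x + b : measurableTypeR R) @^-1` A) =
  (a^-1%:E * lebesgue_measure A)%E.
Proof.
move=> a0 mA.
pose f : measurableTypeR R -> measurableTypeR R := fun x => a * x + b.
have mf : measurable_fun setT f.
  by apply: measurable_funD => //; exact: measurable_funM.
pose m := mscale (NngNum (ltW a0)) (image_measure lebesgue_measure mf).
have mE (B : set R) : m B = (a%:E * lebesgue_measure (f @^-1` B))%E by [].
have -> : lebesgue_measure A = m A.
  apply: lebesgue_measure_unique => // _ [[u v] _ <-].
  rewrite [RHS]mE.
  have -> : f @^-1` [set` Interval (BRight u) (BRight v)] =
            `](u - b) / a, (v - b) / a]%classic.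
    apply/seteqP; split => x /=; rewrite !in_itv/= /f;
      by rewrite ltr_pdivrMr// ler_pdivlMr// ltrBlDr lerBrDr mulrC.
  rewrite !lebesgue_measure_itv/= !lte_fin ltr_pM2r ?invr_gt0// ltrD2r.
  case: ifPn => _; last by rewrite mule0.
  rewrite -EFinD -EFinM; congr EFin; field; exact: lt0r_neq0.
by rewrite mE muleA -EFinM mulVf ?gt_eqF// mul1e.
Qed.

Lemma leb2_rect (X Y : set (measurableTypeR R)) : measurable X -> measurable Y ->
  leb2 (X `*` Y) = (lebesgue_measure X * lebesgue_measure Y)%E.
Proof. exact: product_measure1E. Qed.

Lemma measurable_pair_plane d (T : measurableType d) (f g : T -> R) :
  measurable_fun setT f -> measurable_fun setT g ->
  measurable_fun setT (fun x => (f x, g x) : plane R).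
Proof. by move=> mf mg; exact: measurable_fun_pair. Qed.

Lemma scales_area_box (a b p q : R) : 0 < a -> 0 < b ->
  scales_area (a * b) (fun x => ((x.1 - p) / a, (x.2 - q) / b)).
Proof.
move=> a0 b0; pose f : plane R -> plane R := fun x => ((x.1 - p) / a, (x.2 - q) / b).
have mf : measurable_fun setT f.
  by apply: measurable_pair_plane; apply: measurable_funM => //; apply: measurable_funB.
split => // A mA.
have ab0 : 0 < (a * b)^-1 by rewrite invr_gt0 mulr_gt0.
pose m := mscale (NngNum (ltW ab0)) (image_measure leb2 mf).
have mE B : m B = ((a * b)^-1%:E * leb2 (f @^-1` B))%E by [].
have -> : leb2 A = m A.
  apply: product_measure_unique => // X Y mX mY.
  rewrite [LHS]mE.
  have -> : f @^-1` (X `*` Y) = 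
     ((fun x : measurableTypeR R => a^-1 * x + (- p / a) : measurableTypeR R) @^-1` X) `*`
     ((fun x : measurableTypeR R => b^-1 * x + (- q / b) : measurableTypeR R) @^-1` Y).
    by apply/seteqP; split => -[x y]; rewrite /= /f/= !mulrBl !mulNr ![a^-1 * _]mulrC ![b^-1 * _]mulrC.
  have mp (c d : R) (Z : set R) : measurable Z ->
     measurable ((fun x : measurableTypeR R => c * x + d : measurableTypeR R) @^-1` Z).
    move=> mZ; rewrite -(setTI (_ @^-1` _)).
    have : measurable_fun setT (fun x : measurableTypeR R => c * x + d : measurableTypeR R).
      by apply: measurable_funD => //; exact: measurable_funM.
    by apply.
  rewrite leb2_rect; [|exact: mp|exact: mp].
  rewrite !lebesgue_affine ?invr_gt0// !invrK muleACA -EFinM !muleA -EFinM.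
  by rewrite mulVf ?mul1e// mulf_neq0// gt_eqF.
rewrite mE muleA -EFinM mulfV ?mul1e//.
by rewrite mulf_neq0// gt_eqF.
Qed.

Definition swap (x : plane R) : plane R := (x.2, x.1).

Lemma scales_area_swap : scales_area 1 swap.
Proof.
have mf : measurable_fun setT swap.
  by apply: measurable_pair_plane; [exact: measurable_snd|exact: measurable_fst].
split => // A mA.
have -> : leb2 A = image_measure leb2 mf A.
  apply: product_measure_unique => // X Y mX mY.
  rewrite [LHS](_ : _ = leb2 (swap @^-1` (X `*` Y)))// (_ : swap @^-1` _ = Y `*` X); last first.
    by apply/seteqP; split => -[x y] /= [].
  by rewrite leb2_rect// muleC.
by rewrite mul1e.
Qed.

Lemma scales_area_shear2 (a : R) :
  scales_area 1 (fun x => (x.1, x.2 + a * x.1)).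
Proof.
pose f : plane R -> plane R := fun x => (x.1, x.2 + a * x.1).
have mf : measurable_fun setT f.
  apply: measurable_pair_plane => //.
  by apply: measurable_funD => //; exact: measurable_funM.
split => // A mA; rewrite mul1e /leb2 /= /product_measure1.
apply: eq_integral => x _ /=.
have -> : xsection (f @^-1` A) x =
  (fun y : measurableTypeR R => 1 * y + a * x : measurableTypeR R) @^-1` xsection A x.
  by apply/seteqP; split => y /=; rewrite /xsection/= !inE /f/= mul1r.
rewrite lebesgue_affine// ?invr1 ?mul1e//; exact: measurable_xsection.
Qed.

Lemma scales_area_ext k phi psi : phi =1 psi -> scales_area k phi -> scales_area k psi.
Proof. by move=> /funext ->. Qed.

Lemma scales_area_shear1 (a : R) :
  scales_area 1 (fun x => (x.1 + a * x.2, x.2)).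
Proof.
have := scales_area_comp (scales_area_comp scales_area_swap (scales_area_shear2 a)) scales_area_swap.
by rewrite !mul1r; apply: scales_area_ext => -[].
Qed.

(** A rotation is a product of three shears, provided that its sine s is not
    zero; the rotation by a half turn is a quarter turn taken twice. *)
Lemma scales_area_rot (c s : R) : c ^+ 2 + s ^+ 2 = 1 ->
  scales_area 1 (fun x => (c * x.1 + s * x.2, c * x.2 - s * x.1)).
Proof.
have gen (u v : R) : u ^+ 2 + v ^+ 2 = 1 -> v != 0 ->
    scales_area 1 (fun x => (u * x.1 + v * x.2, u * x.2 - v * x.1)).
  move=> uv v0; pose al := (1 - u) / v.
  have := scales_area_comp (scales_area_comp (scales_area_shear1 al) 
            (scales_area_shear2 (- v))) (scales_area_shear1 al).
  rewrite !mul1r; apply: scales_area_ext => -[x y] /=; congr pair.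
    have : v * al = 1 - u by rewrite /al mulrC divfK.
    rewrite mulrDr => e.
    have e2 : al * v * al = (1 - u) * al by rewrite (mulrC al) e.
    have e3 : v - (1 + u) * al = 0.
      by apply/eqP; rewrite -(mulrI_eq0 _ (mulfI v0)) mulrBr mulrCA e; apply/eqP; nra.
    apply/eqP; rewrite -subr_eq0.
    rewrite [X in X == 0](_ : _ = x * (1 - u - v * al)
      + y * ((1 - u) * al - al * v * al) - y * (v - (1 + u) * al)); last by ring.
    by rewrite e e2 e3 !subrr !mulr0 subr0 addr0.
  rewrite /al; field; exact: v0.
move=> cs; have [s0|s0] := eqVneq s 0; last exact: gen.
have [g1|g1] : c = 1 \/ c = -1.
- by move: cs; rewrite s0 expr0n addr0 => /eqP; rewrite sqrf_eq1 => /orP[]/eqP; tauto.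
- have [mi ki] : scales_area 1 (id : plane R -> plane R).
    by split => // A mA; rewrite mul1e preimage_id.
  apply: scales_area_ext _ (conj mi ki) => -[x y] /=.
  by rewrite g1 s0 !mul0r subr0 addr0 !mul1r.
have j : (0:R) ^+ 2 + 1 ^+ 2 = 1 by rewrite expr0n add0r expr1n.
have := scales_area_comp (gen 0 1 j (oner_neq0 _)) (gen 0 1 j (oner_neq0 _)).
rewrite mul1r; apply: scales_area_ext => -[x y] /=; rewrite g1 s0; congr pair; ring.
Qed.

Lemma integral_scales_area (k : R) phi (D : set (plane R)) (f : plane R -> \bar R) :
  0 <= k -> scales_area k phi ->
  measurable D -> measurable_fun D f -> (forall x, D x -> 0 <= f x)%E ->
  (\int[leb2]_(x in phi @^-1` D) f (phi x) = k%:E * \int[leb2]_(x in D) f x)%E.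
Proof.
move=> k0 [mphi kphi] mD mf f0.
rewrite -(@ge0_integral_pushforward _ _ _ _ _ _ mphi leb2 D f) //; last by move=> y /[!inE]; exact: f0.
rewrite -(@ge0_integral_mscale _ _ _ leb2 D mD (NngNum k0) f) //.
apply: (@eq_measure_integral _ _ _ D (mscale (NngNum k0) leb2) (image_measure leb2 mphi)).
by move=> A mA _; exact: kphi.
Qed.

End Area.

(** * Products of distances between points of an ellipse *)
Section VandermondeBound.
Context {C : numFieldType}.

(** Evaluating monic polynomials of degrees 0, ..., n - 1 instead of monomials
    multiplies the Vandermonde matrix by a unitriangular one. *)
Lemma det_monic_eval n (p : nat -> {poly C}) (z : 'rV[C]_n) :
  (forall j, p j \is monic) -> (forall j, size (p j) = j.+1) ->
  \det (\matrix_(i < n, j < n) (p i).[z 0 j]) =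
  \prod_(i < n) \prod_(j < n | (i < j)%N) (z 0 j - z 0 i).
Proof.
move=> pm ps; rewrite -det_Vandermonde.
pose L : 'M[C]_n := \matrix_(i < n, k < n) (p i)`_k.
have -> : \matrix_(i < n, j < n) (p i).[z 0 j] = L *m Vandermonde n z.
  apply/matrixP => i j; rewrite !mxE horner_coef ps.
  rewrite -(big_mkord xpredT (fun k => (p i)`_k * z 0 j ^+ k)).
  rewrite (big_nat_widen _ _ n) ?ltn_ord//= big_mkord big_mkcond/=.
  apply: eq_bigr => k _; rewrite !mxE; case: ifPn => //.
  by rewrite -leqNgt => ki; rewrite nth_default ?mul0r// ps.
rewrite det_mulmx det_trig ?big1 ?mul1r// => [i _|].
  by rewrite mxE; have /monicP := pm i; rewrite lead_coefE ps.
by apply/is_trig_mxP => i j ij; rewrite mxE nth_default// ps.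
Qed.

Lemma norm_det_le n (A : 'M[C]_n) (B : 'I_n -> C) :
  (forall i j, `|A i j| <= B i) -> `|\det A| <= n`!%:R * \prod_(i < n) B i.
Proof.
move=> AB; rewrite /determinant (le_trans (ler_norm_sum _ _ _))//.
have : \sum_(s : 'S_n) `|(-1) ^+ s * \prod_i A i (s i)| <= \sum_(s : 'S_n) \prod_(i < n) B i.
  apply: ler_sum => s _; rewrite normrM normrX normrN1 expr1n mul1r normr_prod.
  by apply: ler_prod => i _; rewrite normr_ge0 AB.
by rewrite sumr_const card_Sn mulr_natl.
Qed.

(** Rescaled Chebyshev polynomials, which are the Faber polynomials of the
    ellipses with foci at distance 2 sqrt |k| from the centre: the value at
    u + v is u^j + v^j as soon as u v = k. Consecutive indices are computed
    together because the recursion has two terms. *)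
Fixpoint faber_pair (k : C) (j : nat) : {poly C} * {poly C} :=
  if j is j'.+1 then
    let: (p, q) := faber_pair k j' in (q, 'X * q - k *: p)
  else (2%:P, 'X).

Definition faber (k : C) (j : nat) : {poly C} :=
  if j is 0%N then 1 else (faber_pair k j).1.

Lemma faber_pairE k j u v : u * v = k ->
  (faber_pair k j).1.[u + v] = u ^+ j + v ^+ j /\
  (faber_pair k j).2.[u + v] = u ^+ j.+1 + v ^+ j.+1.
Proof.
move=> uv; elim: j => [|j]; first by rewrite /= !hornerE !expr0 !expr1.
rewrite /=; case: (faber_pair k j) => p q /= [pj qj]; split=> //.
by rewrite !hornerE pj qj -uv !exprS; ring.
Qed.

Lemma faber_pair_monic k j :
  [/\ (faber_pair k j).2 \is monic, size (faber_pair k j).2 = j.+2 &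
      (size (faber_pair k j).1 <= j.+1)%N].
Proof.
elim: j => [|j]; first by rewrite /= monicX size_polyX size_polyC; split=> //; case: (_ != _).
rewrite /=; case: (faber_pair k j) => p q /= [mq sq sp].
have q0 : q != 0 by rewrite monic_neq0.
have sXq : size ('X * q) = j.+3 by rewrite mulrC size_mulX// sq.
have lt : (size (- (k *: p))%R < size ('X * q)%R)%N.
  by rewrite sXq size_polyN (leq_ltn_trans (size_scale_leq _ _))// ltnW.
split; last by rewrite sq.
  by rewrite monicE lead_coefDl// lead_coefM lead_coefX mul1r -monicE.
by rewrite size_polyDl.
Qed.

Lemma faber_monic k j : faber k j \is monic /\ size (faber k j) = j.+1.
Proof.
case: j => [|j]; first by rewrite monic1 size_poly1.
have [] := faber_pair_monic k j; rewrite /faber /=.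
by case: (faber_pair k j).
Qed.

Lemma norm_faber_le k (a : C) j u v : u * v = k -> `|u| <= a -> `|v| <= a ->
  `|(faber k j).[u + v]| <= 2 * a ^+ j.
Proof.
move=> uv ua va; case: j => [|j].
  by rewrite /faber hornerE normr1 expr0 mulr1 ler1n.
have [e _] := faber_pairE j.+1 uv.
rewrite /faber e (le_trans (ler_normD _ _))// !normrX mulr_natl mulr2n.
have a0 : 0 <= a by rewrite (le_trans _ ua).
by apply: lerD; apply: lerXn2r; rewrite ?nnegrE.
Qed.

(** The Vandermonde determinant is evaluated on the polynomials faber, which are
    small on the ellipse, and bounded by its Leibniz expansion. *)
Lemma prod_diff_le n k (a : C) (u v z : 'I_n -> C) : 
  (forall i, [/\ z i = u i + v i, u i * v i = k, `|u i| <= a & `|v i| <= a]) ->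
  \prod_(i < n) \prod_(j < n | (i < j)%N) `|z j - z i| <=
  n`!%:R * 2 ^+ n * a ^+ 'C(n, 2).
Proof.
move=> h; pose zr : 'rV[C]_n := \row_i z i.
have := @norm_det_le n (\matrix_(i < n, j < n) (faber k i).[zr 0 j]) (fun i => 2 * a ^+ i) _.
rewrite (@det_monic_eval n (faber k)); [|by move=> j; case: (faber_monic k j)..].
rewrite big_split /= prodr_const card_ord -expr_sum -mulrA.
have -> : (\sum_(i < n) i = 'C(n, 2))%N.
  by rewrite -(big_mkord xpredT id) -bin2_sum.
move=> H; rewrite mulrA; rewrite mulrA in H; apply: le_trans (H _).
  rewrite normr_prod le_eqVlt; apply/orP; left; apply/eqP; apply: eq_bigr => i _.
  by rewrite normr_prod; apply: eq_bigr => j _; rewrite !mxE.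
move=> i j; rewrite !mxE; have [-> uv ua va] := h j; exact: norm_faber_le.
Qed.

End VandermondeBound.

Section EllipseDecomposition.
Context {R : realType}.
Implicit Types x y : R * R.

Definition cplx x : R[i] := (x.1 +i* x.2)%C.

Lemma normc_cplx x y : `|cplx x - cplx y| = ((edist x y)%:C)%C.
Proof. by rewrite normc_def. Qed.

(** Real form of the statement that the Joukowski map w + k / w sends the
    outside of the disc of radius a to the outside of the ellipse with
    semi-axes a + k / a and a - k / a. Here w = p + i q and
    w' = p' + i q' is k / w. *)
Lemma ellipse_preimage_bound (a k p q p' q' : R) : 0 < a -> `|k| < a ^+ 2 ->
  p * p' - q * q' = k -> p * q' + q * p' = 0 ->
  (p + p') ^+ 2 / (a + k / a) ^+ 2 + (q + q') ^+ 2 / (a - k / a) ^+ 2 <= 1 ->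
  p ^+ 2 + q ^+ 2 <= a ^+ 2.
Proof.
move=> a0 ka e1 e2; apply: contraTT; rewrite -!ltNge => aN.
set N := p ^+ 2 + q ^+ 2 in aN *.
have N0 : 0 < N by rewrite (lt_trans _ aN)// exprn_gt0.
have Nn0 := lt0r_neq0 N0; have an0 := lt0r_neq0 a0.
have p'E : p' = k * p / N.
  apply: (mulIf Nn0); rewrite divfK// /N -e1.
  by rewrite -[RHS]addr0 -(mulr0 q) -e2; ring.
have q'E : q' = - (k * q / N).
  apply: (mulIf Nn0); rewrite mulNr divfK// /N -e1.
  by rewrite -[RHS]addr0 -(mulr0 p) -e2; ring.
have a2 : 0 < a ^+ 2 by rewrite exprn_gt0.
have [k1 k2] : k < a ^+ 2 /\ - a ^+ 2 < k by move: ka; rewrite ltr_norml => /andP[].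
have kN : 0 < (N - a ^+ 2) * ((N - k) * a ^+ 2 + k * (a ^+ 2 - k)) / (N * a ^+ 2).
  rewrite divr_gt0 ?mulr_gt0// ?subr_gt0//.
  have : k ^+ 2 < a ^+ 2 * a ^+ 2.
    by rewrite -real_normK ?num_real// -expr2 ltrXn2r.
  nra.
have pos s : s ^+ 2 = 1 -> 0 < (a + s * k / a) ^+ 2 /\ (a + s * k / a) ^+ 2 < (N + s * k) ^+ 2 / N.
  move=> s2; split.
    rewrite exprn_even_gt0//=; apply: contraTneq ka => e.
    have : s * k = - a ^+ 2.
      by apply/eqP; rewrite -subr_eq0 opprK -(mulfK an0 (s * k)) mulrAC expr2 -mulrDl addrC e mul0r.
    have s1 : `|s| = 1.
      by move/eqP: s2; rewrite sqrf_eq1 => /orP[]/eqP ->; rewrite ?normrN normr1.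
    by move=> ske; rewrite -[`|k|]mul1r -s1 -normrM ske normrN (ger0_norm (ltW a2)) ltxx.
  rewrite -subr_gt0; apply: lt_le_trans kN _; rewrite le_eqVlt; apply/orP; left; apply/eqP.
  have -> : (N + s * k) ^+ 2 = N ^+ 2 + 2 * s * k * N + s ^+ 2 * k ^+ 2 by ring.
  have -> : (a + s * k / a) ^+ 2 = a ^+ 2 + 2 * s * k + s ^+ 2 * k ^+ 2 / a ^+ 2 by field.
  by rewrite s2; field; rewrite an0.
have [A0 A1] := pos 1 (expr1n _ _); rewrite !mul1r in A0 A1.
have [B0 B1] : 0 < (a - k / a) ^+ 2 /\ (a - k / a) ^+ 2 < (N - k) ^+ 2 / N.
  by have := pos (-1); rewrite !mulN1r !mulNr; apply; rewrite sqrrN expr1n.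
have -> : p + p' = p * (N + k) / N by rewrite p'E; field.
have -> : q + q' = q * (N - k) / N by rewrite q'E; field.
have rA : 1 < (N + k) ^+ 2 / N / (a + k / a) ^+ 2 by rewrite ltr_pdivlMr// mul1r.
have rB : 1 < (N - k) ^+ 2 / N / (a - k / a) ^+ 2 by rewrite ltr_pdivlMr// mul1r.
set u := (X in _ < X / _ + _ / _); set v := (X in _ < _ / _ + X / _).
have -> : u = p ^+ 2 / N * ((N + k) ^+ 2 / N) by rewrite /u; field.
have -> : v = q ^+ 2 / N * ((N - k) ^+ 2 / N) by rewrite /v; field.
rewrite -!(mulrA (_ / N)).
set A := (X in _ < p ^+ 2 / N * X + _); set B := (X in _ < _ + q ^+ 2 / N * X).
have al : 0 <= p ^+ 2 / N by rewrite divr_ge0 ?sqr_ge0 ?ltW.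
have be : 0 <= q ^+ 2 / N by rewrite divr_ge0 ?sqr_ge0 ?ltW.
have albe : p ^+ 2 / N + q ^+ 2 / N = 1 by rewrite -mulrDl divff.
have [m [m1 mA mB]] : exists m, [/\ 1 < m, m <= A & m <= B].
  by exists (Num.min A B); split; rewrite ?lt_min ?rA ?rB// ge_min lexx ?orbT.
by apply: lt_le_trans m1 _; rewrite -[X in X <= _]mul1r -albe mulrDl lerD// ler_wpM2l.
Qed.

(** Writing a point of the ellipse as u + v with u v fixed amounts to solving a
    quadratic equation; both roots satisfy the bound by the preceding lemma. *)
Lemma ellipse_split (b1 b2 : R) x : 0 < b1 -> 0 < b2 ->
  x.1 ^+ 2 / b1 ^+ 2 + x.2 ^+ 2 / b2 ^+ 2 <= 1 ->
  exists u v : R[i], [/\ cplx x = u + v, u * v = (((b1 ^+ 2 - b2 ^+ 2) / 4)%:C)%C,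
    `|u| <= (((b1 + b2) / 2)%:C)%C & `|v| <= (((b1 + b2) / 2)%:C)%C].
Proof.
move=> b10 b20 xE; pose k : R := (b1 ^+ 2 - b2 ^+ 2) / 4; pose a : R := (b1 + b2) / 2.
have a0 : 0 < a by rewrite divr_gt0 ?addr_gt0.
have an0 := lt0r_neq0 a0.
have ka : `|k| < a ^+ 2.
  by rewrite /k /a ltr_norml; apply/andP; split; nra.
have e1 : a + k / a = b1.
  by rewrite /k /a; field; rewrite gt_eqF ?addr_gt0.
have e2 : a - k / a = b2.
  by rewrite /k /a; field; rewrite gt_eqF ?addr_gt0.
have bd (w w' : R[i]) : w * w' = (k%:C)%C -> cplx x = w + w' -> `|w| <= (a%:C)%C.
  case: w w' => [p q] [p' q'] /eqP; rewrite eq_complex /= => /andP[/eqP m1 /eqP m2] /eqP.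
  rewrite eq_complex /= => /andP[/eqP s1 /eqP s2].
  rewrite normc_def lecR /= -(ger0_norm (ltW a0)) -sqrtr_sqr ler_wsqrtr//.
  by apply: (@ellipse_preimage_bound a k p q p' q') => //; rewrite e1 e2 -s1 -s2.
pose s := sqrtc (cplx x ^+ 2 - 4 * (k%:C)%C).
have s2 : s ^+ 2 = cplx x ^+ 2 - 4 * (k%:C)%C by exact: sqr_sqrtc.
pose u := (cplx x + s) / 2; pose v := (cplx x - s) / 2.
have uv : u * v = (k%:C)%C.
  rewrite /u /v (_ : _ * _ = (cplx x ^+ 2 - s ^+ 2) / 4); last by field.
  by rewrite s2; field.
have zuv : cplx x = u + v by rewrite /u /v; field.
by exists u, v; split => //; [exact: (bd u v)|apply: (bd v u); rewrite 1?mulrC 1?addrC].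
Qed.

End EllipseDecomposition.

(** * Points of at most average energy *)
Section Selection.
Local Open Scope ereal_scope.
Context d (T : measurableType d) (R : realType) (P : probability T R).

(** A function cannot exceed its mean almost everywhere. *)
Lemma exists_le_integral (K : set T) (f : T -> \bar R) :
  measurable K -> P K = 1 -> measurable_fun setT f -> (forall x, 0 <= f x) ->
  exists2 z, K z & f z <= \int[P]_x f x.
Proof.
move=> mK PK mf f0; apply/not_exists2P => H.
have {}H z : K z -> \int[P]_x f x < f z.
  by move=> Kz; rewrite ltNge; apply/negP => fz; case: (H z).
set c := \int[P]_x f x in H.
have c0 : 0 <= c by exact: integral_ge0.
have [c_fin|] := boolP (c \is a fin_num); last first.
  rewrite ge0_fin_numE// -leNgt leye_eq => /eqP cy.
  have [z Kz] : K !=set0.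
    by apply/set0P/negP => /eqP K0; move: PK; rewrite K0 measure0 => /esym/eqP; rewrite onee_eq0.
  by have := H z Kz; rewrite cy ltNge leey.
pose g x := f x - c.
have mg : measurable_fun K g.
  by apply: emeasurable_funB => //; exact: measurable_funTS.
have g0 x : K x -> 0 <= g x by move=> /H/ltW; rewrite sube_ge0 ?c_fin.
have fE : \int[P]_(x in K) f x = \int[P]_(x in K) g x + c.
  rewrite (eq_integral (fun x => g x + c)); last first.
    by move=> x _; rewrite /g subeK.
  rewrite ge0_integralD//.
  have -> : \int[P]_(_ in K) c = c by rewrite integral_cst// [X in c * X]PK mule1.
  by [].
have /eqP g00 : \int[P]_(x in K) `|g x| == 0.
  rewrite eq_le integral_ge0// andbT.
  rewrite (eq_integral g); last by move=> x /[!inE] /g0 ?; rewrite gee0_abs.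
  rewrite -(@leeD2rE _ c)// add0e -fE /c.
  by apply: ge0_subset_integral.
have /(ae_eq_integral_abs P mK mg) [N [mN PN Ng]] := g00.
have KN : K `<=` N.
  move=> x Kx; apply: Ng => /(_ Kx) /= gx0; have := H x Kx.
  by rewrite -sube_gt0 -/(g x) gx0 ltxx.
have : P K <= P N by apply: le_measure; rewrite ?inE.
by rewrite PK PN lee_fin ler10.
Qed.

Variable k : T * T -> \bar R.

Fixpoint pair_energy (s : seq T) : \bar R :=
  if s is z :: s' then \sum_(x <- s') k (x, z) + pair_energy s' else 0.

Hypotheses (mk : measurable_fun setT k) (k0 : forall z, 0 <= k z).

Lemma pair_energy_ge0 s : 0 <= pair_energy s.
Proof. by elim: s => //= z s IH; rewrite adde_ge0// sume_ge0. Qed.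

(** The mean of the energy of n independent points is the number of pairs times
    the energy of P. *)
Lemma exists_pair_energy_le (K : set T) n :
  measurable K -> P K = 1 ->
  exists s : seq T, [/\ size s = n, forall x, x \in s -> K x &
    pair_energy s <= 'C(n, 2)%:R%:E * \int[P \x P]_z k z].
Proof.
move=> mK PK; set E := \int[P \x P]_z k z.
pose p x := \int[P]_y k (x, y).
have p0 x : 0 <= p x by exact: integral_ge0.
have mp : measurable_fun setT p by exact: measurable_fun_fubini_tonelli_F.
have E0 : 0 <= E by exact: integral_ge0.
have intp : \int[P]_x p x = E by rewrite /E fubini_tonelli1.
have mkx x : measurable_fun setT (fun y => k (x, y)).
  by apply: measurableT_comp => //; exact: pair1_measurable.
have intcst (c : \bar R) : 0 <= c -> \int[P]_x c = c.
  by move=> c0; rewrite integral_cst// [X in c * X]probability_setT mule1.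
(* The points are chosen one by one: with s already chosen and m points still
   to choose, the bound below is the conditional expectation of the final
   energy. *)
suff H m : forall s, (forall x, x \in s -> K x) ->
    exists s', [/\ size s' = (m + size s)%N, forall x, x \in s' -> K x &
      pair_energy s' <= pair_energy s + m%:R%:E * (\sum_(x <- s) p x) + 'C(m, 2)%:R%:E * E].
  have [|s [ss Ks le]] := H n [::]; first by move=> x; rewrite in_nil.
  by exists s; split=> //; [rewrite ss addn0|move: le; rewrite big_nil mule0 !add0e].
elim: m => [|m IH] s Ks.
  by exists s; split => //; rewrite !mul0e !adde0.
pose f z := pair_energy (z :: s) + m%:R%:E * (\sum_(x <- z :: s) p x) + 'C(m, 2)%:R%:E * E.
have sp0 s' : 0 <= \sum_(x <- s') p x by exact: sume_ge0.
have sk0 z : 0 <= \sum_(x <- s) k (x, z) by exact: sume_ge0.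
have CE0 j : 0 <= j%:R%:E * E by rewrite mule_ge0// lee_fin.
have msk : measurable_fun setT (fun z => \sum_(x <- s) k (x, z)).
  exact: emeasurable_sum.
have mps : measurable_fun setT (fun z => \sum_(x <- z :: s) p x).
  by under eq_fun do rewrite big_cons; apply: emeasurable_funD.
have f0 z : 0 <= f z.
  by rewrite /f !adde_ge0 ?pair_energy_ge0// mule_ge0// lee_fin.
have mf : measurable_fun setT f.
  apply: emeasurable_funD => //; apply: emeasurable_funD.
    by apply: emeasurable_funD.
  by apply: measurable_funeM.
have [z Kz fz] := exists_le_integral mK PK mf f0.
have [|s' [ss' Ks' le]] := IH (z :: s).
  by move=> x; rewrite inE => /predU1P[->//|/Ks].
exists s'; split => //; first by rewrite ss' /= addnS.
apply: le_trans le _; apply: le_trans fz _; rewrite le_eqVlt; apply/orP; left; apply/eqP.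
have ID (g h : T -> \bar R) : measurable_fun setT g -> measurable_fun setT h ->
    (forall x, 0 <= g x) -> (forall x, 0 <= h x) ->
    \int[P]_x (g x + h x) = \int[P]_x g x + \int[P]_x h x.
  by move=> mg mh g0 h0; rewrite ge0_integralD.
have n0 (j : nat) : 0 <= j%:R%:E :> \bar R by rewrite lee_fin.
have mA : measurable_fun setT (fun z => pair_energy (z :: s)) by exact: emeasurable_funD.
have mB : measurable_fun setT (fun z => m%:R%:E * \sum_(x <- z :: s) p x).
  exact: measurable_funeM.
have B0 z' : 0 <= m%:R%:E * \sum_(x <- z' :: s) p x by rewrite mule_ge0.
have A0 z' : 0 <= pair_energy (z' :: s) by exact: pair_energy_ge0.
rewrite /f ID//; [|exact: emeasurable_funD|by move=> x; rewrite adde_ge0].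
rewrite intcst// ID// /= ID//; last by move=> _; exact: pair_energy_ge0.
rewrite intcst ?pair_energy_ge0// ge0_integralZl//.
under [in X in _ + m%:R%:E * X]eq_integral do rewrite big_cons.
rewrite ID// intcst// intp ge0_integral_sum//.
under eq_bigr do rewrite -/(p _).
rewrite binS bin1 natrD EFinD -[m.+1%:R%R]natr1 EFinD.
rewrite ge0_muleDr// !ge0_muleDl// mul1e.
set S := \sum_(x <- s) p x; set mS := _ * S; set mE := m%:R%:E * E.
by rewrite [LHS](AC (2*2*1) ((2*(4*1))*(5*3))).
Qed.

End Selection.

(** * Upper bound of the logarithmic capacity of an ellipse *)
Section LogKernel.
Context {R : realType}.
Implicit Types (x y : R * R) (z : (R * R) * (R * R)) (K : set (R * R)).

Lemma edist_ge0 x y : 0 <= edist x y.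
Proof. exact: sqrtr_ge0. Qed.

Definition log_kernel z : \bar R := lne ((edist z.1 z.2)%:E^-1)%E.

Lemma log_kernelE z : log_kernel z =
  if edist z.1 z.2 == 0 then +oo%E else (- ln (edist z.1 z.2))%:E.
Proof.
rewrite /log_kernel; case: eqP => [->|/eqP d0]; first by rewrite inve0.
have d1 : 0 < edist z.1 z.2 by rewrite lt_neqAle eq_sym d0 edist_ge0.
by rewrite inver (negbTE d0) lne_EFin ?invr_gt0// lnV// posrE.
Qed.

Lemma measurable_edist :
  measurable_fun setT (fun z : plane R * plane R => edist z.1 z.2).
Proof.
have m1 : measurable_fun setT (fun z : plane R * plane R => z.1.1 : R).
  exact: (measurableT_comp measurable_fst measurable_fst).
have m2 : measurable_fun setT (fun z : plane R * plane R => z.1.2 : R).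
  exact: (measurableT_comp measurable_snd measurable_fst).
have m3 : measurable_fun setT (fun z : plane R * plane R => z.2.1 : R).
  exact: (measurableT_comp measurable_fst measurable_snd).
have m4 : measurable_fun setT (fun z : plane R * plane R => z.2.2 : R).
  exact: (measurableT_comp measurable_snd measurable_snd).
apply: (measurableT_comp (continuous_measurable_fun (@sqrt_continuous R))).
apply: measurable_funD; apply: measurable_funX; exact: measurable_funB.
Qed.

Lemma measurable_log_kernel :
  measurable_fun setT (log_kernel : plane R * plane R -> \bar R).
Proof.
rewrite (_ : log_kernel = fun z => if edist z.1 z.2 == 0 then +oo%E else (- ln (edist z.1 z.2))%:E);
  last by apply/funext => z; rewrite log_kernelE.
apply: measurable_fun_ifT => //.
  exact: (measurable_fun_eqr measurable_edist).
apply/measurable_EFinP; apply: measurableT_comp => //.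
exact: (measurableT_comp (@measurable_ln R) measurable_edist).
Qed.

Section BoundedSet.
Variables (K : set (R * R)) (D : R).
Hypotheses (mK : measurable (K : set (plane R))) (D1 : 1 <= D).
Hypothesis KD : forall x y, K x -> K y -> edist x y <= D.

(** Distances in K being at most D, the shift by ln D makes the kernel
    nonnegative, so that Tonelli's theorem applies to it. *)
Definition shifted_kernel : plane R * plane R -> \bar R :=
  (fun z => (log_kernel z + (ln D)%:E)%E) \_ (K `*` K).

Local Open Scope ereal_scope.

Lemma ge_log_kernel z : K z.1 -> K z.2 -> (- ln D)%:E <= log_kernel z.
Proof.
move=> K1 K2; rewrite log_kernelE; case: eqP => [_|/eqP d0]; first exact: leey.
have d1 : (0 < edist z.1 z.2)%R by rewrite lt_neqAle eq_sym d0 edist_ge0.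
by rewrite lee_fin lerN2 ler_ln ?posrE ?KD// (lt_le_trans ltr01).
Qed.

Lemma shifted_kernel_ge0 z : 0 <= shifted_kernel z.
Proof.
rewrite /shifted_kernel patchE; case: ifPn => // /[!inE] -[K1 K2].
by rewrite -leeBlDr// sub0e -EFinN ge_log_kernel.
Qed.

Lemma measurable_shifted_kernel : measurable_fun setT shifted_kernel.
Proof.
apply/(measurable_restrictT _ (measurableX mK mK)).
apply: measurable_funTS; apply: emeasurable_funD => //.
exact: measurable_log_kernel.
Qed.

(** The kernel takes both signs, hence the integral of log_energy is a
    difference, whose negative part is at most ln D and therefore finite. *)
Lemma log_energyE (mu : probability (plane R) R) : mu K = 1 ->
  log_energy K mu = \int[mu \x mu]_z shifted_kernel z - (ln D)%:E.
Proof.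
move=> muK; rewrite /log_energy.
have mKK : measurable (K `*` K : set (plane R * plane R)) by exact: measurableX.
have mL : measurable_fun (K `*` K) (log_kernel : plane R * plane R -> \bar R).
  by apply: measurable_funTS; exact: measurable_log_kernel.
have lD0 : (0 <= ln D)%R by rewrite ln_ge0.
have muKK : (mu \x mu) (K `*` K) = 1 by rewrite product_measure1E// [X in X * _]muK mul1e [LHS]muK.
have intc (c : R) : \int[mu \x mu]_(z in K `*` K) c%:E = c%:E.
  by rewrite integral_cst// [X in _ * X]muKK mule1.
rewrite -[\int[_]_(_ in _) _]/(\int[mu \x mu]_(z in K `*` K) log_kernel z).
rewrite integralE.
set Ip := \int[_]_(_ in _) (_^\+ _); set In := \int[_]_(_ in _) (_^\- _).
have In0 : 0 <= In by exact: integral_ge0.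
have InD : In <= (ln D)%:E.
  rewrite -(intc (ln D)); apply: ge0_le_integral => //.
  - apply: measurable_funeneg.
    by apply: measurable_funTS; exact: measurable_log_kernel.
  - move=> z [K1 K2]; rewrite funenegE ge_max lee_fin lD0 andbT.
    by rewrite leeNl; exact: ge_log_kernel.
have Infin : In \is a fin_num by rewrite ge0_fin_numE// (le_lt_trans InD)// ltry.
have -> : \int[mu \x mu]_z shifted_kernel z =
    \int[mu \x mu]_(z in K `*` K) (log_kernel z + (ln D)%:E).
  by rewrite [RHS]integral_mkcond.
have mLp := measurable_funepos mL; have mLn := measurable_funeneg mL.
have L0 z : (K `*` K) z -> 0 <= log_kernel z + (ln D)%:E.
  by move=> [K1 K2]; rewrite -leeBlDr// sub0e -EFinN ge_log_kernel.
have mLD : measurable_fun (K `*` K) (fun z : plane R * plane R => log_kernel z + (ln D)%:E).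
  exact: emeasurable_funD.
have eqI : \int[mu \x mu]_(z in K `*` K) (log_kernel z + (ln D)%:E) + In = Ip + (ln D)%:E.
  rewrite -{2}(intc (ln D)) /In /Ip -!ge0_integralD//.
  apply: eq_integral => z _.
  rewrite funeposE funenegE log_kernelE; case: ifP => _.
    by rewrite maxye maxNye addye// adde0 addye.
  by rewrite -!EFinN -!EFin_max -!EFinD; congr EFin; rewrite opprK /Num.max /Order.max; case: ifP; case: ifP; lra.
rewrite -[X in _ = X - _](@addeK _ In)// eqI.
by rewrite [RHS]addeAC addeK.
Qed.

Local Open Scope ring_scope.

(** The exponential of minus pair_energy for the unshifted kernel. *)
Fixpoint dist_prod (s : seq (R * R)) : R :=
  if s is z :: s' then (\prod_(x <- s') edist x z) * dist_prod s' else 1.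

Lemma expeR_shifted_kernel x y : K x -> K y ->
  expeR (- shifted_kernel (x, y))%E = (edist x y / D)%:E.
Proof.
move=> Kx Ky; have D0 : 0 < D by exact: lt_le_trans ltr01 D1.
rewrite /shifted_kernel patchE mem_set // log_kernelE /=.
case: eqP => [->|/eqP d0]; first by rewrite addye//= mul0r.
have d1 : 0 < edist x y by rewrite lt_neqAle eq_sym d0 edist_ge0.
by rewrite -EFinD -EFinN /= opprD opprK expRD expRN !lnK.
Qed.

Lemma expeRD_ge0 (x y : \bar R) : (0 <= x -> 0 <= y ->
  expeR (- (x + y)) = expeR (- x) * expeR (- y))%E.
Proof. by move=> x0 y0; rewrite oppeD ?expeRD// ge0_adde_def. Qed.

Lemma expeR_pair_energy (s : seq (R * R)) : (forall x, x \in s -> K x) ->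
  expeR (- pair_energy shifted_kernel s)%E = (dist_prod s / D ^+ 'C(size s, 2))%:E.
Proof.
have D0 : 0 < D by exact: lt_le_trans ltr01 D1.
have k0 := shifted_kernel_ge0.
elim: s => [|z s IH] Ks.
  by rewrite (_ : pair_energy _ _ = 0%E)// oppe0 expeR0 divr1.
have Kz : K z by apply: Ks; rewrite mem_head.
have {}Ks x : x \in s -> K x by move=> xs; apply: Ks; rewrite in_cons xs orbT.
have sum0 (s' : seq (plane R)) : (0 <= \sum_(x <- s') shifted_kernel (x, z))%E.
  by apply: sume_ge0 => x _; exact: shifted_kernel_ge0.
rewrite [pair_energy _ _]/= expeRD_ge0 ?sum0//; last exact: pair_energy_ge0.
rewrite IH//.
have -> : expeR (- (\sum_(x <- s) shifted_kernel (x, z)))%E =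
    ((\prod_(x <- s) edist x z) / D ^+ size s)%:E.
  elim: s Ks {IH} => [|y s IH] Ks.
    by rewrite !big_nil oppe0 expeR0 divr1.
  rewrite !big_cons expeRD_ge0 ?sum0 ?k0// IH; last first.
    by move=> x xs; apply: Ks; rewrite in_cons xs orbT.
  rewrite expeR_shifted_kernel//; last by apply: Ks; rewrite mem_head.
  by rewrite -EFinM; congr EFin; rewrite /= exprS; field; rewrite ?expf_neq0// gt_eqF.
rewrite -EFinM; congr EFin; rewrite /= binS bin1 exprD; field.
by rewrite !expf_neq0// gt_eqF.
Qed.

Lemma dist_prodE x0 (s : seq (R * R)) :
  dist_prod s = \prod_(i < size s) \prod_(j < size s | (i < j)%N)
    edist (nth x0 s j) (nth x0 s i).
Proof.
elim: s => [|z s IH]; first by rewrite big_ord0.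
rewrite /= big_ord_recl; congr (_ * _).
  rewrite [RHS]big_mkcond big_ord_recl /= mul1r (big_nth x0) big_mkord.
  by apply: eq_bigr => i _.
rewrite IH; apply: eq_bigr => i _.
rewrite [RHS]big_mkcond big_ord_recl /= mul1r -big_mkcond /=.
by apply: eq_bigl => j.
Qed.

(** The comparison of the discrete and the continuous energy. Among any number
    n of points chosen with at most the mean energy, the product of the
    distances is at least exp (- I) raised to the number of pairs; against the
    upper bound a ^ C(n, 2), the factor n! 2^n is of lower exponential order
    and disappears as n grows. *)
Lemma log_energy_ge (a : R) (mu : probability (plane R) R) : 0 < a -> mu K = 1%E ->
  (forall s, (forall x, x \in s -> K x) ->
     dist_prod s <= (size s)`!%:R * 2 ^+ size s * a ^+ 'C(size s, 2)) ->
  ((- ln a)%:E <= log_energy K mu)%E.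
Proof.
move=> a0 muK Hs; have D0 : 0 < D by exact: lt_le_trans ltr01 D1.
rewrite log_energyE//; set E := (\int[_]_z _)%E.
have E0 : (0 <= E)%E by apply: integral_ge0 => z _; exact: shifted_kernel_ge0.
have bound (n : nat) : (expeR (- ('C(n, 2)%:R%:E * E)) <= (n`!%:R * 2 ^+ n * (a / D) ^+ 'C(n, 2))%:E)%E.
  have [s [ss Ks le]] := exists_pair_energy_le measurable_shifted_kernel shifted_kernel_ge0 n mK muK.
  apply: (@le_trans _ _ (expeR (- pair_energy shifted_kernel s)%E)).
    by rewrite lee_expeR leeN2.
  rewrite expeR_pair_energy// lee_fin ss exprMn exprVn mulrA ler_pM2r ?invr_gt0 ?exprn_gt0//.
  by rewrite -ss; exact: Hs.
case: E E0 bound => [e| |] e0 bound; [|by rewrite leey|by []].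
rewrite -EFinB lee_fin.
rewrite -subr_ge0 opprK; set del := e - ln D + ln a.
have fact_le (n : nat) : (n`! <= n ^ n)%N.
  elim: n => // n IH; rewrite factS expnS leq_mul2l /= (leq_trans IH)//.
  by case: n {IH} => // n; rewrite leq_exp2r.
have {}bound (n : nat) : (0 < n)%N -> - del * 'C(n, 2)%:R <= n%:R * ln (2 * n%:R).
  move=> n0; have := bound n; rewrite -EFinM -EFinN /= lee_fin.
  have nR : (0 : R) < n%:R by rewrite ltr0n.
  have f0 : (0 : R) < n`!%:R * 2 ^+ n by rewrite mulr_gt0 ?exprn_gt0// ltr0n fact_gt0.
  have g0 : (0 : R) < (a / D) ^+ 'C(n, 2) by rewrite exprn_gt0// divr_gt0.
  rewrite -ler_ln ?posrE ?expR_gt0 ?mulr_gt0// expRK lnM ?posrE// lnXn ?divr_gt0//.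
  rewrite ln_div ?posrE// -[X in _ <= _ + X]mulr_natr => h.
  have : ln (n`!%:R * 2 ^+ n) <= n%:R * ln (2 * n%:R) :> R.
    rewrite [leRHS]mulr_natl -lnXn ?mulr_gt0// ler_ln ?posrE ?exprn_gt0 ?mulr_gt0//.
    by rewrite exprMn mulrC ler_pM2l ?exprn_gt0// -natrX ler_nat.
  by rewrite /del; lra.
rewrite leNgt; apply/negP => del0.
(* A negative del makes the left-hand side of bound quadratic in n, the right
   one being of order n ln n; n = 2 m^2 with m > 8 / - del is a contradiction
   already, and makes the logarithm ln (2 m)^2 easy to bound. *)
pose m := (Num.truncn (8 / - del)).+1.
have m8 : 8 < m%:R * - del.
  rewrite -ltr_pdivrMr ?oppr_gt0//; exact: truncnS_gt.
have mR : (1 : R) <= m%:R by rewrite ler1n.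
have := bound (2 * m ^ 2)%N _; rewrite muln_gt0 expn_gt0 /= => /(_ isT).
have -> : 2 * (2 * m ^ 2)%:R = (2 * m%:R) ^+ 2 :> R by rewrite !natrM; ring.
rewrite lnXn ?mulr_gt0 ?ltr0n//.
have : ln (2 * m%:R) <= 2 * m%:R :> R.
  by rewrite (le_trans (ltW (ln_sublinear _)))// mulr_gt0 ?ltr0n.
have -> : 'C(2 * m ^ 2, 2)%:R = m%:R ^+ 2 * (2 * m%:R ^+ 2 - 1) :> R.
  rewrite bin2 -mulnA mul2n doubleK -subn1 natrM natrX natrB ?mul2n; last first.
    by rewrite double_gt0 expn_gt0.
  by rewrite -mul2n natrM natrX.
rewrite natrM natrX -[m]/(m) => lnb h.
have h2 : (2 * m%:R ^+ 2 : R) * (ln (2 * m%:R) *+ 2) <= 2 * m%:R ^+ 2 * (4 * m%:R).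
  by rewrite ler_pM2l ?mulr_gt0 ?exprn_gt0 ?ltr0n// mulr2n; lra.
have {h2}h := le_trans h h2.
have {}h : - del * (2 * m%:R ^+ 2 - 1) <= 8 * m%:R :> R.
  have m2 : (0 : R) < m%:R ^+ 2 by rewrite exprn_gt0 ?ltr0n.
  by rewrite -(ler_pM2l m2); lra.
have : m%:R * 8 < - del * (2 * m%:R ^+ 2 - 1) :> R; last by lra.
have : 8 * m%:R < (m%:R * - del) * m%:R :> R by rewrite ltr_pM2r ?ltr0n.
have : 0 <= - del * (m%:R ^+ 2 - 1) :> R.
  by rewrite mulr_ge0 ?oppr_ge0 ?(ltW del0)// subr_ge0 expr_ge1.
lra.
Qed.

End BoundedSet.

End LogKernel.

Lemma normr_le_sqr (R : realType) (a b : R) : 0 <= b -> a ^+ 2 <= b ^+ 2 -> `|a| <= b.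
Proof. by move=> b0; rewrite -(real_normK (num_real a)) ler_sqr. Qed.

Section EllipseCapacity.
Context {R : realType}.
Implicit Types (x y : R * R) (K : set (R * R)).

Lemma ler_edist x y (A B : R) : `|x.1 - y.1| <= A -> `|x.2 - y.2| <= B ->
  edist x y <= A + B.
Proof.
move=> hA hB; have A0 : 0 <= A by rewrite (le_trans _ hA).
have B0 : 0 <= B by rewrite (le_trans _ hB).
rewrite -[leRHS]ger0_norm ?addr_ge0// -sqrtr_sqr ler_wsqrtr//.
rewrite -(real_normK (num_real (x.1 - y.1))) -(real_normK (num_real (x.2 - y.2))).
have : `|x.1 - y.1| ^+ 2 <= A ^+ 2 by rewrite lerXn2r ?nnegrE.
have : `|x.2 - y.2| ^+ 2 <= B ^+ 2 by rewrite lerXn2r ?nnegrE.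
by have := mulr_ge0 A0 B0; rewrite sqrrD; lra.
Qed.

(** The isometry psi brings the ellipse into standard position. *)
Lemma log_capacity_ellipse_le K (b1 b2 : R) (psi : R * R -> R * R) :
  0 < b1 -> 0 < b2 -> measurable (K : set (plane R)) ->
  (forall x y, edist (psi x) (psi y) = edist x y) ->
  (forall x, K x -> (psi x).1 ^+ 2 / b1 ^+ 2 + (psi x).2 ^+ 2 / b2 ^+ 2 <= 1) ->
  (log_capacity K <= ((b1 + b2) / 2)%:E)%E.
Proof.
move=> b10 b20 mK psiI Kpsi; set a := (b1 + b2) / 2.
have a0 : 0 < a by rewrite divr_gt0 ?addr_gt0.
(* The summand 1 only makes the logarithm of the bound nonnegative. *)
have KD x y : K x -> K y -> edist x y <= 1 + (2 * b1 + 2 * b2).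
  move=> /Kpsi Kx /Kpsi Ky.
  have bd (u v c : R) : 0 < c -> u ^+ 2 / c ^+ 2 <= 1 -> v ^+ 2 / c ^+ 2 <= 1 ->
      `|u - v| <= 2 * c.
    move=> c0; rewrite !ler_pdivrMr ?exprn_gt0// !mul1r => u1 v1.
    have uc : `|u| <= c by apply: normr_le_sqr => //; exact: ltW.
    have vc : `|v| <= c by apply: normr_le_sqr => //; exact: ltW.
    by rewrite (le_trans (ler_normB _ _))//; lra.
  have p (u c : R) : 0 <= u ^+ 2 / c ^+ 2 by rewrite divr_ge0 ?sqr_ge0.
  rewrite -psiI ler_wpDl// ler_edist// bd//.
  - by have := p (psi x).2 b2; lra.
  - by have := p (psi y).2 b2; lra.
  - by have := p (psi x).1 b1; lra.
  - by have := p (psi y).1 b1; lra.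
have D1 : 1 <= 1 + (2 * b1 + 2 * b2) by rewrite lerDl addr_ge0// mulr_ge0// ltW.
suff H (mu : probability (plane R) R) : mu K = 1%E -> ((- ln a)%:E <= log_energy K mu)%E.
  have rob : ((- ln a)%:E <= robin_constant K)%E.
    by apply: le_ereal_inf_tmp => _ [mu /= muK <-]; exact: H.
  rewrite /log_capacity -[leRHS](_ : expeR (ln a)%:E = _) ?lee_expeR.
    by rewrite leeNl -EFinN.
  by rewrite /= lnK.
move=> muK; apply: (log_energy_ge mK D1 KD a0 muK) => s Ks.
pose z i := cplx (psi (nth (0, 0) s i)).
pose k : R := (b1 ^+ 2 - b2 ^+ 2) / 4.
have /choice[uv huv] (i : 'I_(size s)) : exists uv : R[i] * R[i],
   [/\ z i = uv.1 + uv.2, uv.1 * uv.2 = (k%:C)%C, `|uv.1| <= (a%:C)%C & `|uv.2| <= (a%:C)%C].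
  have [|u [v huv]] := @ellipse_split R b1 b2 (psi (nth (0, 0) s i)) b10 b20.
    by apply: Kpsi; apply: Ks; exact: mem_nth.
  by exists (u, v).
have rE (c : R) n : ((n`!%:R * 2 ^+ n * c ^+ 'C(n, 2))%:C)%C =
    n`!%:R * 2 ^+ n * (c%:C)%C ^+ 'C(n, 2).
  by rewrite !rmorphM !rmorphXn /= !rmorph_nat.
have dE : ((dist_prod s)%:C)%C =
    \prod_(i < size s) \prod_(j < size s | (i < j)%N) `|z j - z i|.
  rewrite (dist_prodE (0, 0)) rmorph_prod; apply: eq_bigr => i _.
  by rewrite rmorph_prod; apply: eq_bigr => j _; rewrite normc_cplx psiI.
rewrite -lecR rE dE.
exact: (@prod_diff_le R[i] (size s) (k%:C)%C (a%:C)%C (fun i => (uv i).1) (fun i => (uv i).2) z huv).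
Qed.

End EllipseCapacity.

(** * Lower bound of the capacity of sets that contain a circle *)
Section LogSine.
Context {R : realType}.
Local Notation mu := (@lebesgue_measure R).
Implicit Types (s t u : R) (f : R -> \bar R).

Lemma integral_affine (a b : R) (D : set (measurableTypeR R)) (f : measurableTypeR R -> \bar R) :
  0 < a -> measurable D -> measurable_fun D f -> (forall x, D x -> (0 <= f x)%E) ->
  (\int[mu]_(x in (fun x : measurableTypeR R => (a * x + b)%R : measurableTypeR R) @^-1` D) f (a * x + b)%R = a^-1%:E * \int[mu]_(x in D) f x)%E.
Proof.
move=> a0 mD mf f0.
have mphi : measurable_fun setT (fun x : measurableTypeR R => a * x + b : measurableTypeR R).
  by apply: measurable_funD => //; exact: measurable_funM.
rewrite -(@ge0_integral_pushforward _ _ _ _ _ _ mphi mu D f)//; last by move=> y /[!inE]; exact: f0.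
have ai0 : 0 <= a^-1 by rewrite invr_ge0 ltW.
rewrite -(@ge0_integral_mscale _ _ _ mu D mD (NngNum ai0) f) //.
apply: (@eq_measure_integral _ _ _ D (mscale (NngNum ai0) mu) (image_measure mu mphi)).
by move=> A mA _; exact: lebesgue_affine.
Qed.

Lemma integral_affine_itv (a b u v : R) f : 0 < a -> u <= v ->
  measurable_fun setT f -> (forall x, (0 <= f x)%E) ->
  (\int[mu]_(x in `[u, v[) f (a * x + b)%R =
   a^-1%:E * \int[mu]_(x in `[(a * u + b)%R, (a * v + b)%R[) f x)%E.
Proof.
move=> a0 uv mf f0; rewrite -(@integral_affine a b)//; last exact: measurable_funTS.
congr integral; apply/seteqP; split=> x /=; rewrite !in_itv/=;
  by rewrite lerD2r ltrD2r ler_pM2l// ltr_pM2l.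
Qed.

Lemma integral_itv_split (a b c : R) f : a <= b -> b <= c ->
  measurable_fun setT f -> (forall x, (0 <= f x)%E) ->
  (\int[mu]_(x in `[a, c[) f x =
   \int[mu]_(x in `[a, b[) f x + \int[mu]_(x in `[b, c[) f x)%E.
Proof.
move=> ab bc mf f0; rewrite -ge0_integral_setU//.
- by rewrite -itv_bndbnd_setU// bnd_simp.
- exact: measurable_funTS.
- rewrite disj_set2E; apply/eqP/seteqP; split=> // x /= [].
  by rewrite !in_itv/= => /andP[_ xb] /andP[]; rewrite leNgt xb.
Qed.

Lemma integral_periodic f s : measurable_fun setT f -> (forall x, (0 <= f x)%E) ->
  (forall x, f (x + 1) = f x) -> 0 <= s <= 1 ->
  (\int[mu]_(x in `[0%R, 1%R[) f (x - s)%R = \int[mu]_(x in `[0%R, 1%R[) f x)%E.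
Proof.
move=> mf f0 f1 /andP[s0 s1].
have -> : (\int[mu]_(x in `[0%R, 1%R[) f (x - s)%R = \int[mu]_(x in `[(- s)%R, (1 - s)%R[) f x)%E.
  have := @integral_affine_itv 1 (- s) 0 1 f ltr01 ler01 mf f0.
  rewrite invr1 mul1e mulr0 add0r mulr1 => <-.
  by apply: eq_integral => x _; rewrite mul1r.
rewrite (@integral_itv_split _ 0)//; [|by rewrite oppr_le0|by rewrite subr_ge0].
rewrite [RHS](@integral_itv_split _ (1 - s))//; [|by rewrite subr_ge0|by rewrite gerBl].
rewrite addeC; congr (_ + _)%E.
have := @integral_affine_itv 1 1 (- s) 0 f ltr01 _ mf f0.
rewrite invr1 mul1e mulrN mulr0 add0r !mul1r [- s + 1]addrC oppr_le0 => <-//.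
by apply: eq_integral => x _; rewrite mul1r f1.
Qed.

(** The logarithmic kernel along a circle of diameter 1 parametrised by [0, 1):
    chords have length |sin (pi t)|. *)
Definition log_sine t : \bar R :=
  if sin (pi * t) == 0 then +oo%E else (- ln `|sin (pi * t)|)%:E.

Lemma log_sine_ge0 t : (0 <= log_sine t)%E.
Proof.
rewrite /log_sine; case: eqP => // _; rewrite lee_fin oppr_ge0.
exact: ln_le0 (sin_max _).
Qed.

Lemma measurable_log_sine : measurable_fun setT log_sine.
Proof.
have ms : measurable_fun setT (fun t : R => sin (pi * t)).
  apply: (measurableT_comp (continuous_measurable_fun (@continuous_sin R))).
  exact: measurable_funM.
apply: measurable_fun_ifT => //; first exact: measurable_fun_eqr.
apply/measurable_EFinP; apply: measurableT_comp => //.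
apply: (measurableT_comp (@measurable_ln R)); exact: measurableT_comp.
Qed.

Lemma log_sineD1 t : log_sine (t + 1) = log_sine t.
Proof. by rewrite /log_sine mulrDr mulr1 sinDpi normrN oppr_eq0. Qed.

Lemma log_sine_half t :
  log_sine (t + 2^-1) = if cos (pi * t) == 0 then +oo%E else (- ln `|cos (pi * t)|)%:E.
Proof. by rewrite /log_sine mulrDr sinDpihalf. Qed.

Lemma log_sine_double t :
  (log_sine (2 * t) + (ln 2)%:E = log_sine t + log_sine (t + 2^-1))%E.
Proof.
rewrite log_sine_half /log_sine.
have -> : sin (pi * (2 * t)) = 2 * (sin (pi * t) * cos (pi * t)).
  have -> : pi * (2 * t) = (pi * t) *+ 2 by rewrite mulr2n; ring.
  by rewrite sin_mulr2n; ring.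
have [->|s0] := eqVneq (sin (pi * t)) 0; first by rewrite mul0r mulr0 eqxx addye//; case: ifP.
have [->|c0] := eqVneq (cos (pi * t)) 0; first by rewrite !mulr0 eqxx addey.
rewrite !mulf_eq0 (negbTE s0) (negbTE c0) pnatr_eq0/=.
rewrite -!EFinD; congr EFin; rewrite !normrM !lnM ?posrE ?normr_gt0 ?mulf_neq0//.
  by rewrite normr_nat; ring.
by rewrite mulr_gt0 ?normr_gt0.
Qed.

Local Open Scope ereal_scope.

(** Sine and cosine are not both small. *)
Lemma log_sine_small t : log_sine t <= (ln 2)%:E \/ log_sine (t + 2^-1)%R <= (ln 2)%:E.
Proof.
have small (w : R) : (2^-1 <= `|w|)%R -> (if w == 0%R then +oo else (- ln `|w|)%:E) <= (ln 2)%:E.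
  move=> w2; have w0 : (0 < `|w|)%R by rewrite (lt_le_trans _ w2).
  rewrite -normr_eq0 gt_eqF// lee_fin lerNl -lnV ?posrE// ler_ln ?posrE//.
rewrite log_sine_half /log_sine.
have [h|h] := leP 2^-1%R `|sin (pi * t)|%R; first by left; exact: small.
right; apply: small; rewrite -ler_sqr ?nnegrE// real_normK ?num_real// cos2sin2.
rewrite -(real_normK (num_real (sin _))).
have : (`|sin (pi * t)| ^+ 2 <= 2^-1 ^+ 2)%R by rewrite lerXn2r ?nnegrE// ltW.
lra.
Qed.

(** A truncated form of the duplication formula: at most one of the two terms on
    the left is really truncated, and the other one is at most ln 2. *)
Lemma log_sine_trunc (N : R) t : (0 <= N)%R ->
  mine (log_sine t) N%:E + mine (log_sine (t + 2^-1)%R) N%:E <=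
  mine (log_sine (2 * t)%R) N%:E + (2 * ln 2)%:E.
Proof.
move=> N0; have l2 : (0 <= ln 2 :> R)%R by rewrite ln_ge0// ler1n.
have main (x y z : \bar R) : 0 <= y -> z + (ln 2)%:E = x + y -> y <= (ln 2)%:E ->
    mine x N%:E + mine y N%:E <= mine z N%:E + (2 * ln 2)%:E.
  move=> y0 e yl; rewrite mulr2n mulrDl mul1r EFinD addeA; apply: leeD; last first.
    by rewrite (le_trans _ yl)// ge_min lexx.
  have [zN|zN] := leP z N%:E.
    by rewrite (le_trans (_ : _ <= x)) ?ge_min ?lexx// e leeDl.
  by rewrite ge_min leeDl ?orbT// lee_fin.
have d := log_sine_double t.
have [h|h] := log_sine_small t; last first.
  by apply: main => //; exact: log_sine_ge0.
rewrite addeC; apply: main; [exact: log_sine_ge0|by rewrite d addeC|by []].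
Qed.

Lemma integral_periodic_double f : measurable_fun setT f -> (forall x, 0 <= f x) ->
  (forall x, f (x + 1)%R = f x) ->
  \int[mu]_(x in `[0%R, 1%R[) f (2 * x)%R = \int[mu]_(x in `[0%R, 1%R[) f x /\
  \int[mu]_(x in `[0%R, 1%R[) f (x + 2^-1)%R = \int[mu]_(x in `[0%R, 1%R[) f x.
Proof.
move=> mf f0 f1; split.
  have := @integral_affine_itv 2 0 0 1 f (ltr0n _ 2) ler01 mf f0.
  under eq_integral do rewrite addr0; move=> ->.
  rewrite mulr0 mulr1 !addr0 (@integral_itv_split 0 1)//; last by rewrite ler1n.
  have := @integral_affine_itv 1 1 0 1 f ltr01 ler01 mf f0.
  rewrite invr1 mul1e mulr0 add0r mulr1 -[(1 + 1)%R]/2%R => <-.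
  under [X in _ * (_ + X)]eq_integral do rewrite mul1r f1.
  set I := \int[_]_(_ in _) _.
  have I0 : 0 <= I by exact: integral_ge0.
  by rewrite -[X in _ * (X + X)]mul1e -ge0_muleDl// muleA -EFinD -EFinM mulVf ?mul1e.
rewrite -[RHS](@integral_periodic f 2^-1)//; last by rewrite invr_ge0 ler0n invf_le1// ler1n.
apply: eq_integral => x _; rewrite -[RHS]f1; congr f; rewrite -addrA; congr (_ + _)%R; lra.
Qed.

Lemma le_of_leD2 (x y : \bar R) : x \is a fin_num -> x + x <= x + y -> x <= y.
Proof. by move=> xf; rewrite leeD2lE. Qed.

(** First a crude bound, uniform in the truncation: after integration over a
    period the three terms of the truncated duplication formula coincide, and
    they are finite. It serves to show that the integral without truncation is
    finite. *)
Lemma integral_log_sine_trunc_le (n : nat) :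
  \int[mu]_(t in `[0%R, 1%R[) mine (log_sine t) n%:R%:E <= (2 * ln 2)%:E.
Proof.
pose f : R -> \bar R := fun t => mine (log_sine t) n%:R%:E.
have f0 x : 0 <= f x by rewrite le_min log_sine_ge0 lee_fin ler0n.
have mf : measurable_fun setT f.
  by apply: measurable_mine => //; exact: measurable_log_sine.
have f1 x : f (x + 1)%R = f x by rewrite /f log_sineD1.
have mI : measurable (`[0%R, 1%R[%classic : set R) by exact: measurable_itv.
have muI : mu `[0%R, 1%R[%classic = 1 by rewrite lebesgue_measure_itv/= lte_fin ltr01 sube0.
have l2 : (0 <= 2 * ln 2 :> R)%R by rewrite mulr_ge0// ln_ge0// ler1n.
rewrite -[leLHS]/(\int[mu]_(t in `[0%R, 1%R[) f t).
set L := \int[_]_(_ in _) _.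
have L0 : 0 <= L by exact: integral_ge0.
have Lfin : L \is a fin_num.
  rewrite ge0_fin_numE//.
  apply: (@le_lt_trans _ _ (\int[mu]_(t in `[0%R, 1%R[) n%:R%:E)).
    apply: ge0_le_integral => //.
      exact: (measurable_funS measurableT (@subsetT _ _) mf).
    by move=> x _; rewrite ge_min lexx orbT.
  by rewrite integral_cst// [X in _ * X]muI mule1 ltry.
have [] := integral_periodic_double mf f0 f1; rewrite -/L => d2 dh.
apply: (le_of_leD2 Lfin); rewrite -{2}dh -{2}d2.
have mc (a b : R) : measurable_fun setT (fun t => f (a * t + b)%R).
  by apply: (measurableT_comp mf); apply: measurable_funD => //; exact: measurable_funM.
have mh : measurable_fun setT (fun t => f (t + 2^-1)%R).
  by have := mc 1%R 2^-1%R; under eq_fun do rewrite mul1r.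
have m2 : measurable_fun setT (fun t => f (2 * t)%R).
  by have := mc 2%R 0%R; under eq_fun do rewrite addr0.
have intc (c : R) : \int[mu]_(t in `[0%R, 1%R[) c%:E = c%:E.
  by rewrite integral_cst// [X in _ * X]muI mule1.
rewrite -(intc (2 * ln 2)%R) /L addeC -!ge0_integralD//; [|exact: measurable_funTS..].
apply: ge0_le_integral => //.
- by move=> x _; rewrite adde_ge0 ?f0//.
- by apply: emeasurable_funD; apply: measurable_funTS.
- by apply: emeasurable_funD; apply: measurable_funTS.
- by move=> x _; rewrite addeC; apply: log_sine_trunc; rewrite ler0n.
Qed.

(** Euler's evaluation of the log-sine integral: the duplication formula
    integrates to L + ln 2 = L + L, and L is finite. *)
Lemma integral_log_sine_le : \int[mu]_(t in `[0%R, 1%R[) log_sine t <= (ln 2)%:E.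
Proof.
have mf := measurable_log_sine; have f0 := log_sine_ge0; have f1 := log_sineD1.
have mI : measurable (`[0%R, 1%R[%classic : set R) by exact: measurable_itv.
have muI : mu `[0%R, 1%R[%classic = 1 by rewrite lebesgue_measure_itv/= lte_fin ltr01 sube0.
have l2 : (0 <= ln 2 :> R)%R by rewrite ln_ge0// ler1n.
set L := \int[_]_(_ in _) _.
have Lle : L <= (2 * ln 2)%:E.
  pose I : set (measurableTypeR R) := `[0%R, 1%R[%classic.
  pose g (n : nat) : measurableTypeR R -> \bar R := fun t => mine (log_sine t) n%:R%:E.
  have mg n : measurable_fun I (g n).
    by apply: measurable_funTS; apply: measurable_mine.
  have g0 n x : I x -> 0 <= g n x.
    by rewrite le_min log_sine_ge0 lee_fin ler0n.
  have ndg x : I x -> nondecreasing_seq (g ^~ x).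
    by move=> _ m n mn; rewrite le_min ge_min lexx/= ge_min lee_fin ler_nat mn orbT.
  have -> : L = \int[mu]_(x in I) limn (g ^~ x).
    apply: eq_integral => x _; apply/esym/cvg_lim => //.
    rewrite /g; case: (log_sine x) (log_sine_ge0 x) => [r| |] // r0.
      apply: cvg_near_cst; near=> n; apply/min_idPl; rewrite lee_fin.
      by near: n; exact: nbhs_infty_ger.
    under eq_fun do rewrite minye.
    by apply/cvgeryP; exact: cvgr_idn.
  have cv := @cvg_monotone_convergence _ _ _ mu I mI g mg g0 ndg.
  have /cvg_lim <-// := cv.
  apply: lime_le; last by apply: nearW => n; exact: integral_log_sine_trunc_le.
  by apply/cvg_ex; eexists; exact: cv.
have L0 : 0 <= L by exact: integral_ge0.
have Lfin : L \is a fin_num by rewrite ge0_fin_numE// (le_lt_trans Lle)// ltry.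
have [] := integral_periodic_double mf f0 f1; rewrite -/L => d2 dh.
apply: (le_of_leD2 Lfin); rewrite -{2}dh -{2}d2.
have intc (c : R) : \int[mu]_(t in `[0%R, 1%R[) c%:E = c%:E.
  by rewrite integral_cst// [X in _ * X]muI mule1.
have mc (a b : R) : measurable_fun setT (fun t => log_sine (a * t + b)%R).
  by apply: (measurableT_comp mf); apply: measurable_funD => //; exact: measurable_funM.
have mh : measurable_fun setT (fun t => log_sine (t + 2^-1)%R).
  by have := mc 1%R 2^-1%R; under eq_fun do rewrite mul1r.
have m2 : measurable_fun setT (fun t => log_sine (2 * t)%R).
  by have := mc 2%R 0%R; under eq_fun do rewrite addr0.
rewrite -(intc (ln 2)) /L -!ge0_integralD//; [|exact: measurable_funTS..].
rewrite le_eqVlt; apply/orP; left; apply/eqP; apply: eq_integral => x _.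
by rewrite log_sine_double.
Unshelve. all: by end_near. Qed.

End LogSine.

Section CircleMeasure.
Context {R : realType}.
Variables (c : R * R) (r : R).
Hypothesis r0 : 0 < r.

Definition circle_point (t : measurableTypeR R) : plane R :=
  (c.1 + r * cos (2 * (pi * t)), c.2 + r * sin (2 * (pi * t))).

Lemma measurable_circle_point : measurable_fun setT circle_point.
Proof.
have m : measurable_fun setT (fun t : measurableTypeR R => 2 * (pi * t)).
  by apply: measurable_funM => //; exact: measurable_funM.
apply: measurable_pair_plane; apply: measurable_funD => //; apply: measurable_funM => //.
  exact: (measurableT_comp (continuous_measurable_fun (@continuous_cos R)) m).
exact: (measurableT_comp (continuous_measurable_fun (@continuous_sin R)) m).
Qed.

HB.instance Definition _ :=
  isMeasurableFun.Build _ _ _ _ circle_point measurable_circle_point.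

Definition circle_measure : probability (plane R) R :=
  distribution (uniform_prob (@ltr01 R)) circle_point.

Lemma edist_circle_point s t :
  edist (circle_point s) (circle_point t) = 2 * r * `|sin (pi * (t - s))|.
Proof.
have nn : 0 <= 2 * r * `|sin (pi * (t - s))| by rewrite mulr_ge0// mulr_ge0// ltW.
rewrite -[RHS](ger0_norm nn) -sqrtr_sqr /edist; congr (Num.sqrt _).
rewrite !exprMn real_normK ?num_real// /circle_point /=.
have e (u : R) : sin (u / 2) ^+ 2 = (1 - cos u) / 2.
  have -> : cos u = 1 - sin (u / 2) ^+ 2 *+ 2.
    have {1}-> : u = (u / 2) *+ 2 by rewrite -mulr_natr; field.
    by rewrite cos_mulr2n cos2sin2; rewrite mulr2n; ring.
  by rewrite mulr2n; field.
have -> : pi * (t - s) = (2 * (pi * t) - 2 * (pi * s)) / 2 by field.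
rewrite e cosB.
set a := 2 * (pi * t); set b := 2 * (pi * s).
have := cos2Dsin2 a; have := cos2Dsin2 b.
move=> hb ha.
rewrite [LHS](_ : _ = r ^+ 2 * ((cos a ^+ 2 + sin a ^+ 2) + (cos b ^+ 2 + sin b ^+ 2)
   - 2 * (cos a * cos b + sin a * sin b))); last by ring.
by rewrite ha hb; field.
Qed.

Lemma ge0_integral_circle_measure (f : plane R -> \bar R) :
  measurable_fun setT f -> (forall x, 0 <= f x)%E ->
  (\int[circle_measure]_x f x =
   \int[lebesgue_measure]_(t in `[0%R, 1%R[) f (circle_point t))%E.
Proof.
move=> mf f0.
have mfc : measurable_fun setT (f \o circle_point).
  exact: (measurableT_comp mf measurable_circle_point).
rewrite ge0_integral_distribution// integral_uniform//; last by move=> x; exact: f0.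
rewrite subr0 invr1 mul1e -integral_itv_bndo_bndc//.
exact: (measurable_funS measurableT (@subsetT _ _) mfc).
Qed.

Section Bounded.
Variables (K : set (R * R)) (D : R).
Hypotheses (mK : measurable (K : set (plane R))) (D1 : 1 <= D) (rD : 2 * r <= D).
Hypothesis KD : forall x y, K x -> K y -> edist x y <= D.
Hypothesis circleK : forall x, edist c x = r -> K x.

Lemma circle_pointK t : K (circle_point t).
Proof.
apply: circleK; rewrite /edist /circle_point /=.
rewrite -[RHS]ger0_norm ?ltW// -sqrtr_sqr; congr (Num.sqrt _).
have := cos2Dsin2 (2 * (pi * t)); set a := 2 * _ => h.
rewrite [LHS](_ : _ = r ^+ 2 * (cos a ^+ 2 + sin a ^+ 2)); last by ring.
by rewrite h mulr1.
Qed.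

Lemma circle_measureK : circle_measure K = 1%E.
Proof.
rewrite /circle_measure /distribution /= /pushforward.
rewrite (_ : _ @^-1` _ = setT) ?probability_setT//.
by apply/seteqP; split => // t _; exact: circle_pointK.
Qed.

(** The uniform measure on the circle has constant potential - ln r on the
    circle. *)
Lemma log_capacity_ge : (r%:E <= log_capacity K)%E.
Proof.
have D0 : 0 < D by exact: lt_le_trans ltr01 D1.
pose k := shifted_kernel K D.
have k0 : forall z, (0 <= k z)%E by move=> z; exact: shifted_kernel_ge0.
have mk : measurable_fun setT k by exact: measurable_shifted_kernel.
have kE s t : k (circle_point s, circle_point t) = (log_sine (t - s) + (ln (D / (2 * r)))%:E)%E.
  rewrite /k /shifted_kernel patchE mem_set; last by split; exact: circle_pointK.
  rewrite log_kernelE /= edist_circle_point /log_sine mulf_eq0 normr_eq0 gt_eqF ?mulr_gt0//=.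
  case: eqP => [_|/eqP s0]; first by rewrite !addye.
  rewrite -!EFinD; congr EFin.
  rewrite lnM ?posrE ?mulr_gt0 ?normr_gt0// ln_div ?posrE ?mulr_gt0//; lra.
have int : (\int[circle_measure \x circle_measure]_z k z <= (ln D - ln r)%:E)%E.
  have F0 x : (0 <= \int[circle_measure]_y k (x, y))%E by exact: integral_ge0.
  have inner s : 0 <= s <= 1 -> (\int[circle_measure]_y k (circle_point s, y) <= (ln D - ln r)%:E)%E.
    move=> s01; rewrite ge0_integral_circle_measure//; last first.
      by apply: measurableT_comp => //; exact: pair1_measurable.
    under eq_integral do rewrite kE.
    have lD : (0 <= (ln (D / (2 * r)))%:E)%E.
      by rewrite lee_fin ln_ge0// ler_pdivlMr ?mulr_gt0// mul1r.
    have ml : measurable_fun setT (fun t : measurableTypeR R => log_sine (t - s)).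
      by apply: (measurableT_comp measurable_log_sine); exact: measurable_funB.
    rewrite ge0_integralD//; first last.
      - exact: (measurable_funS measurableT (@subsetT _ _) ml).
      - by move=> x _; exact: log_sine_ge0.
    rewrite integral_periodic//; [|exact: measurable_log_sine|exact: log_sine_ge0|exact: log_sineD1].
    have -> : ln D - ln r = ln 2 + ln (D / (2 * r)).
      by rewrite ln_div ?posrE ?mulr_gt0// lnM ?posrE//; lra.
    rewrite EFinD; apply: leeD; first exact: integral_log_sine_le.
    rewrite integral_cst//= lebesgue_measure_itv /= lte_fin ltr01 sube0 mule1//.
  have mF : measurable_fun setT (fubini_F circle_measure k).
    exact: measurable_fun_fubini_tonelli_F.
  rewrite fubini_tonelli1// ge0_integral_circle_measure//.
  apply: (@le_trans _ _ (\int[lebesgue_measure]_(t in `[0%R, 1%R[) (ln D - ln r)%:E)%E).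
    apply: ge0_le_integral => //.
    - by move=> s _; exact: F0.
    - exact: (measurable_funS measurableT (@subsetT _ _) (measurableT_comp mF measurable_circle_point)).
    - move=> s; rewrite /= in_itv/= => /andP[s0 s1]; apply: inner; rewrite s0 ltW//.
  by rewrite integral_cst//= lebesgue_measure_itv /= lte_fin ltr01 sube0 mule1.
have en : (log_energy K circle_measure <= (- ln r)%:E)%E.
  rewrite (log_energyE mK D1 KD circle_measureK) leeBlDr// -EFinD addrC.
  exact: int.
have rob : (robin_constant K <= (- ln r)%:E)%E.
  apply: le_trans en; apply: ereal_inf_lbound.
  by exists circle_measure => //; exact: circle_measureK.
rewrite /log_capacity -[leLHS](_ : expeR (ln r)%:E = _) ?lee_expeR.
  by rewrite leeNr -EFinN.
by rewrite /= lnK.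
Qed.

End Bounded.

End CircleMeasure.

(** * Integration by parts on the plane *)
Section BoxSupport.
Context {R : realType}.
Implicit Types (f g : R * R -> R) (x : R * R).

Definition off_box (M : R) x : Prop := M < `|x.1| \/ M < `|x.2|.

Definition vanishes_off_box f : Prop := exists2 M : R, 0 < M & forall x, off_box M x -> f x = 0.

Definition box (M : R) : set (R * R) := `[- M, M]%classic `*` `[- M, M]%classic.

Lemma boxP M x : ~ box M x -> off_box M x.
Proof.
move=> nb; apply: contrapT => /not_orP[]; rewrite /off_box => /negP h1 /negP h2.
by apply: nb; split; rewrite /= in_itv/= -ler_norml leNgt.
Qed.

Lemma compact_box M : compact (box M).
Proof. by apply: compact_setX; exact: segment_compact. Qed.

Lemma measurable_box M : measurable (box M : set (plane R)).
Proof. by apply: measurableX; exact: measurable_itv. Qed.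

Lemma leb2_box_lty M : (leb2 (box M : set (plane R)) < +oo)%E.
Proof.
rewrite leb2_rect; [|exact: measurable_itv..].
by rewrite !lebesgue_measure_itv /=; case: ifPn => _; rewrite ?mule0// -EFinD -EFinM ltry.
Qed.

Lemma integrable_bounded_box (f : plane R -> R) (A : set (plane R)) (M C : R) :
  measurable A -> A `<=` box M -> measurable_fun setT f ->
  (forall x, A x -> `|f x| <= C) -> leb2.-integrable A (EFin \o f).
Proof.
move=> mA AM mf fC; apply: measurable_bounded_integrable => //.
- by apply: le_lt_trans (leb2_box_lty M); apply: le_measure; rewrite ?inE//; exact: measurable_box.
- exact: measurable_funTS.
- exists C; split; first exact: num_real.
  by move=> D CD x Ax /=; rewrite (le_trans (fC _ Ax))// ltW.
Qed.

Lemma continuous_bounded_box f M : continuous f -> exists C : R, forall x, box M x -> `|f x| <= C.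
Proof.
move=> cf; have : compact (f @` box M).
  by apply: (@continuous_compact _ _ f (box M)); [exact: continuous_subspaceT|exact: compact_box].
move=> /compact_bounded[C [_ hC]]; exists (C + 1) => x Mx.
by apply: (hC (C + 1)); [rewrite ltrDl|exists x].
Qed.

Lemma integrable_box f M (A : set (plane R)) : continuous f -> measurable A -> A `<=` box M ->
  leb2.-integrable A (EFin \o (f : plane R -> R)).
Proof.
move=> cf mA AM; have [C hC] := continuous_bounded_box M cf.
apply: (integrable_bounded_box mA AM (continuous_measurable_plane cf)) => x /AM.
exact: hC.
Qed.

Lemma integrable_off_box f : continuous f -> vanishes_off_box f ->
  leb2.-integrable setT (EFin \o (f : plane R -> R)).
Proof.
move=> cf [M M0 fM].
have := integrable_box cf (measurable_box M) (@subset_refl _ _).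
move/(integrable_mkcond _ (measurable_box M)).
rewrite (_ : (EFin \o f) \_ (box M) = EFin \o f)//.
apply/funext => x; rewrite patchE; case: ifPn => // /negP xM /=.
by rewrite fM//; apply: boxP => bx; apply: xM; rewrite inE.
Qed.

Lemma off_boxW f g : (forall x, f x = 0 -> g x = 0) ->
  vanishes_off_box f -> vanishes_off_box g.
Proof. by move=> fg [M M0 fM]; exists M => // x /fM /fg. Qed.

Lemma partial_locally0 f i x : (\forall y \near x, f y = 0) -> is_derive x (axis i) f 0.
Proof.
move=> f0; apply: (@near_eq_is_derive _ _ _ (cst 0)).
by apply: filterS f0 => y ->.
Qed.

Lemma open_off_box M : open [set x : R * R | off_box M x].
Proof.
rewrite (_ : [set _ | _] = (fun x => `|x.1|) @^-1` `]M, +oo[ `|` (fun x => `|x.2|) @^-1` `]M, +oo[).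
  apply: openU; apply: open_comp; try exact: interval_open.
    by move=> x _; apply: continuous_comp; [exact: cvg_fst|exact: norm_continuous].
  by move=> x _; apply: continuous_comp; [exact: cvg_snd|exact: norm_continuous].
by apply/seteqP; split => x /=; rewrite /off_box !in_itv/= !andbT.
Qed.

Lemma vanishes_partial f i : vanishes_off_box f -> vanishes_off_box (partial i f).
Proof.
move=> [M M0 fM]; exists M => // x xM.
have nf : \forall y \near x, f y = 0.
  have : nbhs x [set y | off_box M y].
    by apply: open_nbhs_nbhs; split => //; exact: open_off_box.
  by apply: filterS => y; exact: fM.
by have [_] := partial_locally0 i nf.
Qed.

Lemma axis0_shift (h : R) x : h *: axis ord0 + x = (h + x.1, x.2).
Proof.
rewrite /axis eqxx; apply: injective_projections => /=; first by rewrite [h%:A]mulr1.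
by rewrite scaler0 add0r.
Qed.

Lemma axis1_shift (h : R) x : h *: axis ord_max + x = (x.1, h + x.2).
Proof.
rewrite /axis; apply: injective_projections => /=; last by rewrite [h%:A]mulr1.
by rewrite scaler0 add0r.
Qed.

Lemma partial0_line f (y t : R) : partial ord0 f (t, y) = derive1 (fun s : R => f (s, y)) t /\
  (derivable f (t, y) (axis ord0) -> derivable (fun s : R => f (s, y)) t 1).
Proof.
rewrite /partial derive1E /derive /derivable; set F := fun h => _; set G := fun h => _; suff -> : F = G by [].
by apply/funext => h; rewrite /F /G /= axis0_shift [h%:A]mulr1.
Qed.

Lemma partial1_line f (x t : R) : partial ord_max f (x, t) = derive1 (fun s : R => f (x, s)) t /\
  (derivable f (x, t) (axis ord_max) -> derivable (fun s : R => f (x, s)) t 1).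
Proof.
rewrite /partial derive1E /derive /derivable; set F := fun h => _; set G := fun h => _; suff -> : F = G by [].
by apply/funext => h; rewrite /F /G /= axis1_shift [h%:A]mulr1.
Qed.

Lemma integral_derive1_vanishing (g : R -> R) (M : R) : 0 < M ->
  (forall t, derivable g t 1) -> continuous (derive1 g) ->
  (forall t, M < `|t| -> g t = 0) ->
  (\int[lebesgue_measure]_t (derive1 g t)%:E = 0)%E.
Proof.
move=> M0 dg cg gM.
have cg' : continuous g.
  by move=> t; apply: differentiable_continuous; apply/derivable1_diffP.
have g'M t : M < `|t| -> derive1 g t = 0.
  move=> Mt; have nf : \forall s \near t, cst 0 s = g s.
    have h : \forall s \near t, M < `|s| by exact: (cvgr_gt _ (@norm_continuous R R t) _ Mt).
    by apply: filterS h => s /gM ->.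
  rewrite derive1E -(near_eq_derive _ nf); exact: derive_cst.
pose N := M + 1.
have MN : M < N by rewrite ltrDl.
have NN : - N < N by lra.
have -> : (\int[lebesgue_measure]_t (derive1 g t)%:E =
    \int[lebesgue_measure]_(t in `[(- N)%R, N]) (derive1 g t)%:E)%E.
  rewrite [RHS]integral_mkcond; apply: eq_integral => t _.
  rewrite patchE; case: ifPn => //; rewrite notin_setE /= in_itv/= -ler_norml => /negP.
  by rewrite -ltNge => /(lt_trans MN)/g'M ->.
rewrite (@continuous_FTC2 _ (derive1 g) g (- N) N NN).
- by rewrite !gM ?normrN ?gtr0_norm ?subee// (lt_trans M0 MN).
- exact: continuous_subspaceT.
- split => //.
  + by apply: cvg_at_right_filter; exact: cg'.
  + by apply: cvg_at_left_filter; exact: cg'.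
- by [].
Qed.

Lemma continuous_line0 (y : R) f : continuous f -> continuous (fun s : R => f (s, y)).
Proof.
move=> cf t; apply: (@continuous_comp _ _ _ (fun s : R => (s, y)) f); last exact: cf.
by apply: (@cvg_pair _ _ _ (nbhs t) (nbhs t) (nbhs y)); [exact: cvg_id|exact: cvg_cst].
Qed.

Lemma continuous_line1 (x : R) f : continuous f -> continuous (fun s : R => f (x, s)).
Proof.
move=> cf t; apply: (@continuous_comp _ _ _ (fun s : R => (x, s)) f); last exact: cf.
by apply: (@cvg_pair _ _ _ (nbhs t) (nbhs x) (nbhs t)); [exact: cvg_cst|exact: cvg_id].
Qed.

(** Fubini reduces this to the fundamental theorem of calculus on lines. *)
Lemma integral_partial0 f i : (forall x, derivable f x (axis i)) ->
  continuous (partial i f) -> vanishes_off_box f ->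
  (\int[leb2]_x (partial i f x)%:E = 0)%E.
Proof.
move=> df cf vf; have ip := integrable_off_box cf (vanishes_partial i vf).
have [M M0 fM] := vf.
have [i0|i0] : i = ord0 \/ i = ord_max.
  by case: i {df cf ip} => -[|[|]]// ?; [left|right]; apply/val_inj.
all: rewrite {}i0 in df cf ip *.
- have -> : (\int[leb2]_x (partial ord0 f x)%:E =
      \int[lebesgue_measure]_y fubini_G lebesgue_measure (EFin \o (partial ord0 f : plane R -> R)) y)%E.
    by rewrite (@integral21_prod_meas1 _ _ _ _ _ _ _ _ ip).
  apply: integral0_eq => y _; rewrite /fubini_G /=.
  under eq_integral do rewrite (proj1 (partial0_line _ _ _)).
  apply: (integral_derive1_vanishing M0).
  + by move=> t; apply: (proj2 (partial0_line _ _ _)).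
  + rewrite (_ : derive1 _ = (fun t => partial ord0 f (t, y))).
      by have := @continuous_line0 y (partial ord0 f) cf.
    by apply/funext => t; rewrite (proj1 (partial0_line _ _ _)).
  + by move=> t Mt; apply: fM; left.
- have -> : (\int[leb2]_x (partial ord_max f x)%:E =
      \int[lebesgue_measure]_x fubini_F lebesgue_measure (EFin \o (partial ord_max f : plane R -> R)) x)%E.
    by rewrite (@integral12_prod_meas1 _ _ _ _ _ _ _ _ ip).
  apply: integral0_eq => x _; rewrite /fubini_F /=.
  under eq_integral do rewrite (proj1 (partial1_line _ _ _)).
  apply: (integral_derive1_vanishing M0).
  + by move=> t; apply: (proj2 (partial1_line _ _ _)).
  + rewrite (_ : derive1 _ = (fun t => partial ord_max f (x, t))).
      by have := @continuous_line1 x (partial ord_max f) cf.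
    by apply/funext => t; rewrite (proj1 (partial1_line _ _ _)).
  + by move=> t Mt; apply: fM; right.
Qed.

End BoxSupport.

(** * A Picone inequality for quadratic polynomials *)
Section DirectionalCalculus.
Context {R : realType}.
Implicit Types (f g : R * R -> R) (x v : R * R).

(** Reduces directional derivatives to derivatives on the line, to which the
    chain rule of one variable applies. *)
Lemma is_derive_line f x v d :
  is_derive x v f d <-> is_derive (0 : R) 1 (fun h : R => f (h *: v + x)) d.
Proof.
have e : (fun h : R => h^-1 *: ((f \o shift x) (h *: v) - f x)) =
   (fun h : R => h^-1 *: (((fun h : R => f (h *: v + x)) \o shift 0) (h *: 1) - f (0 *: v + x))).
  by apply/funext => h /=; rewrite addr0 scale0r add0r [h%:A]mulr1.
by split=> -[dx vx]; split; move: dx vx; rewrite /derivable /derive e.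
Qed.

Lemma is_deriveDx f g x v df dg : is_derive x v f df -> is_derive x v g dg ->
  is_derive x v (fun y => f y + g y) (df + dg).
Proof. exact: is_deriveD. Qed.

Lemma is_deriveMx f g x v df dg : is_derive x v f df -> is_derive x v g dg ->
  is_derive x v (fun y => f y * g y) (df * g x + f x * dg).
Proof.
move=> hf hg; have h := is_deriveM hf hg.
by apply: (is_derive_eq h); rewrite /GRing.scale/= addrC [g x * _]mulrC.
Qed.

Lemma is_derive_compx (h : R -> R) f x v dh df : is_derive x v f df ->
  is_derive (f x) 1 h dh -> is_derive x v (fun y => h (f y)) (dh * df).
Proof.
move=> /is_derive_line hf hh; apply/is_derive_line.
have : is_derive (f (0 *: v + x)) 1 h dh by rewrite scale0r add0r.
move=> hh'; exact: (is_derive1_comp hh' hf).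
Qed.

Lemma is_derive_inv (t : R) : t != 0 -> is_derive t 1 (fun s : R => s^-1) (- t ^- 2).
Proof.
move=> t0; have h := @is_deriveV R id t 1 1 t0 (is_derive_id t 1).
by apply: (is_derive_eq h); rewrite /GRing.scale/= mulr1.
Qed.

Lemma is_derive_affine (a b : R) : is_derive (0 : R) 1 (fun h : R => h * a + b) a.
Proof.
have h := is_deriveD (is_deriveM (is_derive_id (0 : R) 1) (is_derive_cst a (0 : R) 1))
  (is_derive_cst b (0 : R) 1).
by apply: (is_derive_eq h); rewrite /GRing.scale/= mul0r add0r mulr1 addr0.
Qed.

Lemma is_derive_fst x v : is_derive x v fst v.1.
Proof. by apply/is_derive_line; exact: is_derive_affine. Qed.

Lemma is_derive_snd x v : is_derive x v snd v.2.
Proof. by apply/is_derive_line; exact: is_derive_affine. Qed.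

End DirectionalCalculus.

Section ContinuityPlane.
Context {R : realType}.
Implicit Types (f g : R * R -> R) (x : R * R).

Lemma fst_continuous : continuous (fst : R * R -> R).
Proof. by move=> x; exact: cvg_fst. Qed.

Lemma snd_continuous : continuous (snd : R * R -> R).
Proof. by move=> x; exact: cvg_snd. Qed.

Lemma continuousDx f g x : {for x, continuous f} -> {for x, continuous g} ->
  {for x, continuous (fun y => f y + g y)}.
Proof. exact: continuousD. Qed.

Lemma continuousMx f g x : {for x, continuous f} -> {for x, continuous g} ->
  {for x, continuous (fun y => f y * g y)}.
Proof. exact: continuousM. Qed.

Lemma continuous_cstx (k : R) x : {for x, continuous (fun _ : R * R => k)}.
Proof. exact: cst_continuous. Qed.

Lemma continuousVx f x : f x != 0 -> {for x, continuous f} ->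
  {for x, continuous (fun y => (f y)^-1)}.
Proof. exact: continuousV. Qed.

End ContinuityPlane.

Section RealIntegrable.
Context {R : realType} d (T : measurableType d) (mu : {measure set T -> \bar R}).
Implicit Types f g : T -> R.

Lemma intgD f g : mu.-integrable setT (EFin \o f) -> mu.-integrable setT (EFin \o g) ->
  mu.-integrable setT (EFin \o (fun x => f x + g x)).
Proof. by move=> hf hg; exact: (integrableD measurableT hf hg). Qed.

Lemma intgZ (k : R) f : mu.-integrable setT (EFin \o f) ->
  mu.-integrable setT (EFin \o (fun x => k * f x)).
Proof. by move=> hf; exact: (integrableZl measurableT k hf). Qed.

Lemma RintgD f g : mu.-integrable setT (EFin \o f) -> mu.-integrable setT (EFin \o g) ->
  \int[mu]_x (f x + g x) = \int[mu]_x f x + \int[mu]_x g x.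
Proof. exact: RintegralD. Qed.

Lemma RintgZ (k : R) f : mu.-integrable setT (EFin \o f) ->
  \int[mu]_x (k * f x) = k * \int[mu]_x f x.
Proof. by move=> hf; rewrite RintegralZl. Qed.

End RealIntegrable.

Section QuadraticTorsion.
Context {R : realType}.
Variables (a0 a1 a2 a11 a12 a22 : R).

(** The torsion function of an ellipse is the positive part of such a
    polynomial, with the coefficients normalised by the hypothesis laplacian
    below. *)
Definition quad (x : R * R) : R :=
  a0 + a1 * x.1 + a2 * x.2 + a11 * (x.1 * x.1) + a12 * (x.1 * x.2) + a22 * (x.2 * x.2).

Definition dquad (i : 'I_2) (x : R * R) : R :=
  if i == ord0 then a1 + 2 * a11 * x.1 + a12 * x.2
  else a2 + a12 * x.1 + 2 * a22 * x.2.

Lemma dquad0 : dquad ord0 = fun x => a1 + 2 * a11 * x.1 + a12 * x.2.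
Proof. by []. Qed.

Lemma dquad1 i : i != ord0 -> dquad i = fun x => a2 + a12 * x.1 + 2 * a22 * x.2.
Proof. by move=> /negbTE i0; apply/funext => x; rewrite /dquad i0. Qed.

Definition ddquad (i : 'I_2) : R := if i == ord0 then 2 * a11 else 2 * a22.

Hypothesis laplacian : 2 * a11 + 2 * a22 = -1.

Lemma is_derive_quad i x : is_derive x (axis i) quad (dquad i x).
Proof.
have d1 := is_derive_fst x (axis i); have d2 := is_derive_snd x (axis i).
have c k := is_derive_cst (k : R) x (axis i).
have h := is_deriveDx (is_deriveDx (is_deriveDx (is_deriveDx (is_deriveDx (c a0)
  (is_deriveMx (c a1) d1)) (is_deriveMx (c a2) d2)) (is_deriveMx (c a11) (is_deriveMx d1 d1)))
  (is_deriveMx (c a12) (is_deriveMx d1 d2))) (is_deriveMx (c a22) (is_deriveMx d2 d2)).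
apply: (is_derive_eq h); rewrite /dquad /axis; case: ifP => _ /=; ring.
Qed.

Lemma is_derive_dquad i x : is_derive x (axis i) (dquad i) (ddquad i).
Proof.
have c v k := is_derive_cst (k : R) x (v : R * R).
have [->|i0] := eqVneq i ord0.
  have d1 := is_derive_fst x (axis ord0); have d2 := is_derive_snd x (axis ord0).
  have h := is_deriveDx (is_deriveDx (c _ a1) (is_deriveMx (c _ (2 * a11)) d1)) (is_deriveMx (c _ a12) d2).
  rewrite dquad0; apply: (is_derive_eq h); rewrite /ddquad /axis eqxx/=; ring.
have d1 := is_derive_fst x (axis i); have d2 := is_derive_snd x (axis i).
have h := is_deriveDx (is_deriveDx (c _ a2) (is_deriveMx (c _ a12) d1)) (is_deriveMx (c _ (2 * a22)) d2).
rewrite dquad1//; apply: (is_derive_eq h); rewrite /ddquad /axis (negbTE i0)/=; ring.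
Qed.

Lemma continuous_quad : continuous quad.
Proof.
move=> x; have d1 := @fst_continuous R x; have d2 := @snd_continuous R x.
have c k := @continuous_cstx R k x.
exact: (continuousDx (continuousDx (continuousDx (continuousDx (continuousDx (c a0)
  (continuousMx (c a1) d1)) (continuousMx (c a2) d2)) (continuousMx (c a11) (continuousMx d1 d1)))
  (continuousMx (c a12) (continuousMx d1 d2))) (continuousMx (c a22) (continuousMx d2 d2))).
Qed.

Lemma continuous_dquad i : continuous (dquad i).
Proof.
move=> x; have d1 := @fst_continuous R x; have d2 := @snd_continuous R x.
have c k := @continuous_cstx R k x.
have [->|i0] := eqVneq i ord0.
  rewrite dquad0.
  exact: (continuousDx (continuousDx (c a1) (continuousMx (c (2 * a11)) d1)) (continuousMx (c a12) d2)).
rewrite dquad1//.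
exact: (continuousDx (continuousDx (c a2) (continuousMx (c a12) d1)) (continuousMx (c (2 * a22)) d2)).
Qed.

Definition positivity_set : set (R * R) := [set x | 0 < quad x].

Lemma open_positivity_set : open positivity_set.
Proof.
rewrite (_ : positivity_set = quad @^-1` `]0, +oo[%classic).
  by apply: open_comp; [move=> x _; exact: continuous_quad|exact: interval_open].
by apply/seteqP; split => x; rewrite /positivity_set /= in_itv/= andbT.
Qed.

Section Picone.
Variables (phi : R * R -> R) (S : set (R * R)).
Hypotheses (cphi : continuous phi) (dphi : forall i x, derivable phi x (axis i))
  (cdphi : forall i, continuous (partial i phi)).
Hypotheses (cS : closed S) (SE : S `<=` positivity_set) (phiS : forall x, ~ S x -> phi x = 0).

Let dphiS i x : ~ S x -> partial i phi x = 0.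
Proof.
move=> Sx; have : \forall y \near x, phi y = 0.
  have : nbhs x (~` S) by apply: open_nbhs_nbhs; split => //; exact: closed_openC.
  by apply: filterS => y; exact: phiS.
by move=> /(partial_locally0 i)[].
Qed.

Let near_off x : ~ positivity_set x -> \forall y \near x, ~ S y.
Proof.
move=> Ex; have : nbhs x (~` S).
  by apply: open_nbhs_nbhs; split; [exact: closed_openC|move=> /SE].
exact.
Qed.

(** The vector field phi^2 / U grad U of Picone's identity, and the derivative
    of its i-th component along the i-th axis. It vanishes near the boundary of
    the positivity set, like phi. *)
Definition flux i x := phi x * phi x / quad x * dquad i x.

Definition dflux i x := 2 * phi x * partial i phi x * dquad i x * (quad x)^-1
  + (-1) * ((phi x * phi x) * (dquad i x * dquad i x) * ((quad x)^-1 * (quad x)^-1))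
  + (phi x * phi x) * ddquad i * (quad x)^-1.

Lemma is_derive_flux i x : is_derive x (axis i) (flux i) (dflux i x).
Proof.
have [Ex|Ex] := pselect (positivity_set x); last first.
  have n0 := near_off Ex.
  have p0 : phi x = 0 by apply: phiS => /SE.
  have -> : dflux i x = 0 by rewrite /dflux p0 !(mul0r, mulr0) !addr0.
  apply: partial_locally0; apply: filterS n0 => y Sy.
  by rewrite /flux phiS// !mul0r.
have q0 : quad x != 0 by rewrite gt_eqF.
have dp : is_derive x (axis i) phi (partial i phi x) by exact: derivableP.
have h := is_deriveMx (is_deriveMx (is_deriveMx dp dp)
  (is_derive_compx (is_derive_quad i x) (is_derive_inv q0))) (is_derive_dquad i x).
by apply: (is_derive_eq h); rewrite /dflux; field.
Qed.

Lemma continuous_dflux i : continuous (dflux i).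
Proof.
move=> x; have [Ex|Ex] := pselect (positivity_set x); last first.
  have n0 := near_off Ex.
  have d0 y : ~ S y -> dflux i y = 0.
    by move=> Sy; rewrite /dflux phiS// !(mul0r, mulr0) !addr0.
  rewrite /continuous_at d0; last by move=> /SE.
  by apply: cvg_near_cst; apply: filterS n0.
have q0 : quad x != 0 by rewrite gt_eqF.
have cq := @continuous_quad x; have cdq := @continuous_dquad i x.
have cp : {for x, continuous phi} by exact: cphi.
have cdp : {for x, continuous (partial i phi)} by exact: cdphi.
have c k := @continuous_cstx R k x; have cv := continuousVx q0 cq.
have cpp := continuousMx cp cp.
exact: (continuousDx (continuousDx (continuousMx (continuousMx (continuousMx (continuousMx (c 2) cp) cdp) cdq) cv)
  (continuousMx (c (-1)) (continuousMx (continuousMx cpp (continuousMx cdq cdq)) (continuousMx cv cv))))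
  (continuousMx (continuousMx cpp (c (ddquad i))) cv)).
Qed.

(** Two squares are completed: |grad phi - (phi / U) grad U|^2, which is Picone's
    identity for the superharmonic function U, and (|phi| - U)^2 / U. *)
Lemma picone_pointwise x : 2 * `|phi x| + (dflux ord0 x + dflux ord_max x) <=
  (partial ord0 phi x ^+ 2 + partial ord_max phi x ^+ 2) + (quad \_ positivity_set) x.
Proof.
have [Ex|Ex] := pselect (positivity_set x); last first.
  have p0 : phi x = 0 by apply: phiS => /SE.
  rewrite patchE memNset// addr0 /dflux p0 normr0 !(mul0r, mulr0) !addr0.
  by rewrite addr_ge0 ?sqr_ge0.
rewrite patchE mem_set//; have q0 : 0 < quad x := Ex.
have -> : dflux ord0 x + dflux ord_max x =
   partial ord0 phi x ^+ 2 + partial ord_max phi x ^+ 2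
   - (partial ord0 phi x - phi x / quad x * dquad ord0 x) ^+ 2
   - (partial ord_max phi x - phi x / quad x * dquad ord_max x) ^+ 2
   - phi x ^+ 2 / quad x.
  rewrite /dflux.
  have -> : ddquad ord_max = -1 - ddquad ord0.
    by rewrite /ddquad eqxx/= -laplacian; ring.
  by field; rewrite gt_eqF.
have s0 := sqr_ge0 (partial ord0 phi x - phi x / quad x * dquad ord0 x).
have s1 := sqr_ge0 (partial ord_max phi x - phi x / quad x * dquad ord_max x).
have : 2 * `|phi x| <= phi x ^+ 2 / quad x + quad x.
  rewrite -subr_ge0 -(real_normK (num_real (phi x))).
  rewrite (_ : _ - _ = (`|phi x| - quad x) ^+ 2 / quad x); last by field; rewrite gt_eqF.
  by rewrite divr_ge0 ?sqr_ge0 ?ltW.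
lra.
Qed.

Variable M : R.
Hypotheses (M0 : 0 < M) (bE : positivity_set `<=` box M).

Lemma off_box_notS x : off_box M x -> ~ S x.
Proof.
move=> xM /SE/bE[]; rewrite /= !in_itv/= -!ler_norml => h1 h2.
by move: xM; rewrite /off_box !ltNge h1 h2 => -[].
Qed.

Lemma integrable_positivity : leb2.-integrable setT (EFin \o (quad \_ positivity_set : plane R -> R)).
Proof.
have mE := open_measurable_plane open_positivity_set.
rewrite -restrict_EFin; apply/(integrable_mkcond _ mE).
exact: integrable_box continuous_quad mE bE.
Qed.

Lemma picone : 2 * \int[leb2]_x `|phi x| <=
  (\int[leb2]_x (partial ord0 phi x ^+ 2) + \int[leb2]_x (partial ord_max phi x ^+ 2))
  + \int[leb2]_(x in positivity_set) quad x.
Proof.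
have vsub (f : R * R -> R) : (forall x, ~ S x -> f x = 0) -> vanishes_off_box f.
  by move=> fS; exists M => // x /off_box_notS/fS.
have iabs : leb2.-integrable setT (EFin \o (fun x : plane R => `|phi x|)).
  apply: (@integrable_off_box _ (fun x => `|phi x|)).
    by move=> x; apply: continuous_comp; [exact: cphi|exact: norm_continuous].
  by apply: vsub => x /phiS ->; rewrite normr0.
have isq i : leb2.-integrable setT (EFin \o (fun x : plane R => partial i phi x ^+ 2)).
  apply: (@integrable_off_box _ (fun x => partial i phi x ^+ 2)).
    move=> x; have cd : {for x, continuous (partial i phi)} by exact: cdphi.
    exact: (continuousMx cd cd).
  by apply: vsub => x /(dphiS i) ->; rewrite expr0n.
have iflux i : leb2.-integrable setT (EFin \o (dflux i : plane R -> R)).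
  apply: (@integrable_off_box _ (dflux i)); first exact: continuous_dflux.
  by apply: vsub => x Sx; rewrite /dflux phiS// !(mul0r, mulr0) !addr0.
have flux0 i : \int[leb2]_x dflux i x = 0.
  have e : partial i (flux i) = dflux i.
    by apply/funext => x; have [] := is_derive_flux i x.
  rewrite /Rintegral -e (@integral_partial0 _ (flux i) i)//.
  - by move=> x; have [] := is_derive_flux i x.
  - by rewrite e; exact: continuous_dflux.
  - by apply: vsub => x Sx; rewrite /flux phiS// !mul0r.
rewrite [X in _ <= _ + X]Rintegral_mkcond.
have iL := intgD (intgZ 2 iabs) (intgD (iflux ord0) (iflux ord_max)).
have iR := intgD (intgD (isq ord0) (isq ord_max)) integrable_positivity.
have := le_Rintegral measurableT iL iR (fun x _ => picone_pointwise x).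
rewrite (RintgD (intgZ 2 iabs) (intgD (iflux ord0) (iflux ord_max))) RintgZ//.
rewrite (RintgD (iflux ord0) (iflux ord_max)) !flux0 !addr0.
by rewrite (RintgD (intgD (isq ord0) (isq ord_max)) integrable_positivity) RintgD.
Qed.

End Picone.

End QuadraticTorsion.

(** * Test functions and square integrable functions *)
Section SquareIntegrable.
Context {R : realType} d (T : measurableType d) (mu : {measure set T -> \bar R}).
Implicit Types f g : T -> R.

Definition norm2 f : R := fine 'N[mu]_2%:E[EFin \o f]%E.

Local Notation Ltwo := (Lfun mu 2%:E).

Lemma norm2_ge0 f : 0 <= norm2 f.
Proof. by apply: fine_ge0; exact: Lnorm_ge0. Qed.

Lemma Ltwo_fin f : f \in Ltwo -> ('N[mu]_2%:E[EFin \o f] = (norm2 f)%:E)%E.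
Proof.
rewrite inE => /andP[_]; rewrite inE /= /finite_norm => h.
by rewrite fineK// ge0_fin_numE// Lnorm_ge0.
Qed.

Lemma Ltwo_measurable f : f \in Ltwo -> measurable_fun setT f.
Proof. by rewrite inE => /andP[+ _]; rewrite inE. Qed.

Lemma LtwoP f : measurable_fun setT f ->
  mu.-integrable setT (EFin \o (fun x => f x ^+ 2)) -> f \in Ltwo.
Proof.
move=> mf /integrableP[_ fi]; rewrite inE; apply/andP; split; rewrite inE//=.
rewrite /finite_norm unlock poweR_lty//; apply: le_lt_trans fi.
apply: ge0_le_integral => //.
- by move=> x _; rewrite poweR_ge0.
- apply/measurable_EFinP => /=; apply: (measurableT_comp (measurable_powR 2)).
  exact: measurableT_comp.
- apply: measurableT_comp => //; apply/measurable_EFinP.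
  exact: measurable_funX.
- by move=> x _ /=; rewrite powR_mulrn// -normrX.
Qed.

Lemma Ltwo_mul f g : f \in Ltwo -> g \in Ltwo ->
  mu.-integrable setT (EFin \o (fun x => f x * g x)).
Proof. by move=> hf hg; apply/Lfun1_integrable; exact: Lfun2_mul_Lfun1. Qed.

Lemma cauchy_schwarz f g : f \in Ltwo -> g \in Ltwo ->
  `|\int[mu]_x (f x * g x)| <= norm2 f * norm2 g.
Proof.
move=> hf hg; have ifg := Ltwo_mul hf hg.
apply: (le_trans (le_normr_Rintegral measurableT ifg)).
have h := @hoelder _ _ _ mu f g 2 2 (Ltwo_measurable hf) (Ltwo_measurable hg) (ltr0n _ 2) (ltr0n _ 2).
have e : 2^-1 + 2^-1 = 1 :> R by field.
move: (h e); rewrite (Ltwo_fin hf) (Ltwo_fin hg) -EFinM Lnorm1.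
rewrite -lee_fin /Rintegral fineK//; apply: integrable_fin_num => //.
exact: integrable_norm.
Qed.

Lemma Ltwo_sub f g : f \in Ltwo -> g \in Ltwo -> (fun x => f x - g x) \in Ltwo.
Proof.
move=> hf hg; apply: (Lfun_addr_closed mu (lee1n 2)).2 => //.
by have := @rpredN _ (Lfun mu 2%:E) g; rewrite hg.
Qed.

Lemma norm2_normr f : norm2 (fun x => `|f x|) = norm2 f.
Proof. by rewrite /norm2 -[in RHS]Lnorm_abse. Qed.

Lemma Ltwo_normr f : f \in Ltwo -> (fun x => `|f x|) \in Ltwo.
Proof.
move=> hf; apply: LtwoP; first by apply: measurableT_comp => //; exact: Ltwo_measurable.
have := Ltwo_mul hf hf; apply: eq_integrable => // x _ /=.
by rewrite real_normK ?num_real// expr2.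
Qed.

End SquareIntegrable.

Section TestFunctions.
Context {R : realType}.
Implicit Types (Omega : set (R * R)) (phi : R * R -> R).

Lemma test_continuous Omega phi : test_function Omega phi -> continuous phi.
Proof. by move=> [sm _ _]; have [] := sm [::]. Qed.

Lemma test_derivable Omega phi : test_function Omega phi -> forall i x, derivable phi x (axis i).
Proof. by move=> [sm _ _]; have [] := sm [::]. Qed.

Lemma test_partial_continuous Omega phi : test_function Omega phi ->
  forall i, continuous (partial i phi).
Proof. by move=> [sm _ _] i; have [] := sm [:: i]. Qed.

Lemma test_off Omega phi x : test_function Omega phi -> ~ Omega x ->
  \forall y \near x, phi y = 0.
Proof.
move=> [_ _ k] Ox; have : nbhs x (~` closure [set x | phi x != 0]).
  apply: open_nbhs_nbhs; split; last by move=> /k.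
  exact/closed_openC/closed_closure.
apply: filterS => y yn; apply/eqP/negPn/negP => y0; apply: yn.
exact: subset_closure.
Qed.

Lemma test_vanishes Omega phi : test_function Omega phi -> vanishes_off_box phi.
Proof.
move=> [_ /compact_bounded[C [_ hC]] _]; pose M := `|C| + 1.
have M0 : 0 < M by rewrite ltr_wpDl.
exists M => // x xM; apply/eqP/negPn/negP => x0.
have : `|x| <= M.
  by apply: hC; [rewrite ltr_pwDr// ler_norm|exact: subset_closure].
rewrite prod_normE /= ge_max => /andP[x1 x2].
by move: xM; rewrite /off_box !ltNge x1 x2 => -[].
Qed.

Lemma test_out Omega phi x : test_function Omega phi -> ~ Omega x -> phi x = 0.
Proof. by move=> t /(test_off t)/nbhs_singleton. Qed.

Lemma test_partial_out Omega phi i x : test_function Omega phi -> ~ Omega x -> partial i phi x = 0.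
Proof. by move=> t /(test_off t)/(partial_locally0 i)[]. Qed.

Lemma continuous_vanishing_Ltwo (f : R * R -> R) : continuous f -> vanishes_off_box f ->
  (f : plane R -> R) \in Lfun leb2 2%:E.
Proof.
move=> cf vf; apply: LtwoP; first exact: continuous_measurable_plane.
have := @integrable_off_box _ (fun x => f x * f x).
have cff : continuous (fun x => f x * f x).
  by move=> x; apply: continuousMx; exact: cf.
move=> /(_ cff); have vff : vanishes_off_box (fun x => f x * f x).
  by apply: off_boxW vf => x ->; rewrite mul0r.
by move=> /(_ vff); under eq_fun do rewrite -expr2.
Qed.

Lemma test_Ltwo Omega phi : test_function Omega phi -> (phi : plane R -> R) \in Lfun leb2 2%:E.
Proof.
by move=> t; apply: continuous_vanishing_Ltwo; [exact: test_continuous t|exact: test_vanishes t].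
Qed.

Lemma test_partial_Ltwo Omega phi i : test_function Omega phi ->
  (partial i phi : plane R -> R) \in Lfun leb2 2%:E.
Proof.
move=> t; apply: continuous_vanishing_Ltwo; first exact: test_partial_continuous t i.
exact/vanishes_partial/(test_vanishes t).
Qed.

Lemma test_restrict Omega phi : test_function Omega phi -> phi \_ Omega = phi.
Proof.
move=> t; apply/funext => x; rewrite patchE; case: ifPn => //.
by rewrite notin_setE => /(test_out t) ->.
Qed.

Lemma test_partial_restrict Omega phi i : test_function Omega phi ->
  (partial i phi) \_ Omega = partial i phi.
Proof.
move=> t; apply/funext => x; rewrite patchE; case: ifPn => //.
by rewrite notin_setE => /(test_partial_out i t) ->.
Qed.

Lemma H1norm_lt Omega (u : R * R -> R) (g : 'I_2 -> R * R -> R) (e : R) :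
  (H1norm Omega u g < e%:E)%E ->
  ('N[leb2]_2%:E[EFin \o (u \_ Omega : plane R -> R)] <= e%:E)%E /\
  forall i, ('N[leb2]_2%:E[EFin \o (g i \_ Omega : plane R -> R)] <= e%:E)%E.
Proof.
rewrite /H1norm poweR12_sqrt; last first.
  by rewrite adde_ge0 ?expe_ge0 ?Lnorm_ge0// sume_ge0// => i _; rewrite expe_ge0 ?Lnorm_ge0.
set N := ('N[leb2]_2%:E[_])%E; set Ni := fun i => ('N[leb2]_2%:E[EFin \o (g i \_ Omega : plane R -> R)])%E.
rewrite -[X in (sqrte (_ + X))]/(\sum_(i < 2) (Ni i) ^+ 2)%E => h.
have N0 : (0 <= N)%E by exact: Lnorm_ge0.
have Ni0 i : (0 <= Ni i)%E by exact: Lnorm_ge0.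
have S0 : (0 <= \sum_(i < 2) (Ni i) ^+ 2)%E by apply: sume_ge0 => i _; rewrite expe_ge0.
split.
  apply: le_trans (ltW h); rewrite -[leLHS](gee0_abs N0) -sqrte_sqr lee_sqrt ?leeDl//.
  by rewrite adde_ge0 ?expe_ge0.
move=> i; apply: le_trans (ltW h); rewrite -[leLHS]/(Ni i) -[leLHS](gee0_abs (Ni0 i)) -sqrte_sqr.
rewrite lee_sqrt; last by rewrite adde_ge0 ?expe_ge0.
have le1 : ((Ni i) ^+ 2 <= \sum_(j < 2) (Ni j) ^+ 2)%E.
  by rewrite (bigD1 i)// leeDl// sume_ge0// => j _; rewrite expe_ge0.
by apply: le_trans le1 _; rewrite leeDr// expe_ge0.
Qed.

Lemma H10_approx Omega u g (e : R) : in_H10 Omega u g -> 0 < e ->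
  exists2 phi, test_function Omega phi &
    [/\ norm2 leb2 (fun x : plane R => phi x - (u \_ Omega) x) <= e &
        forall i, norm2 leb2 (fun x : plane R => partial i phi x - (g i \_ Omega) x) <= e].
Proof.
move=> [_ [phi [tphi cv]]] e0.
have : \forall n \near \oo, (H1norm Omega (phi n \- u)%R (fun i => partial i (phi n) \- g i)%R < e%:E)%E.
  have nb : nbhs (0 : \bar R)%E [set y | (y < e%:E)%E].
    by apply: (@open_ereal_lt' _ 0%E); rewrite lte_fin.
  exact: cv _ nb.
move=> [n _ /(_ n (leqnn n)) /= /H1norm_lt[h1 h2]].
exists (phi n); first exact: tphi.
have fle (f : plane R -> R) : ('N[leb2]_2%:E[EFin \o f] <= e%:E)%E -> norm2 leb2 f <= e.
  move=> h; rewrite -lee_fin /norm2 fineK// ge0_fin_numE ?Lnorm_ge0//.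
  exact: (le_lt_trans h (ltry _)).
split.
  apply: fle; move: h1; congr (Lnorm _ _ (EFin \o _) <= _)%E; apply/funext => x.
  rewrite patchE -{2}(test_restrict (tphi n)) !patchE; case: ifPn => //.
  by rewrite subrr.
move=> i; apply: fle; move: (h2 i); congr (Lnorm _ _ (EFin \o _) <= _)%E; apply/funext => x.
rewrite patchE -{2}(test_partial_restrict i (tphi n)) !patchE; case: ifPn => //.
by rewrite subrr.
Qed.

End TestFunctions.

(** * Norm of the torsion function inside an ellipse *)
Lemma le0_small (R : realType) (x K : R) : 0 <= K ->
  (forall e, 0 < e -> x <= e * K) -> x <= 0.
Proof.
move=> K0 H; rewrite leNgt; apply/negP => x0.
have K1 : 0 < 2 * (K + 1) by rewrite mulr_gt0// ltr_wpDl.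
have := H (x / (2 * (K + 1))) (divr_gt0 x0 K1).
rewrite mulrAC ler_pdivlMr// ler_pM2l//; lra.
Qed.

Lemma sum_ord2 (R : realType) (F : 'I_2 -> R) : \sum_(i < 2) F i = F ord0 + F ord_max.
Proof.
rewrite big_ord_recl big_ord1; congr (_ + F _); exact/val_inj.
Qed.

Lemma norm_sub_le (R : realType) (x y w d0 d1 e c k0 k1 : R) :
  y + w = x + (d0 + d1) -> `|d0| <= k0 * e -> `|d1| <= k1 * e -> `|w| <= e * c ->
  `|x - y| <= e * (c + (k0 + k1)).
Proof.
rewrite !ler_norml => eq /andP[? ?] /andP[? ?] /andP[? ?]; apply/andP; split; lra.
Qed.

(** The final linear arithmetic of the comparison below: X is the norm of the
    solution, A that of a test function close to it, and the g, d, q are the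
    three parts of the energy of this test function, namely its pairing with
    the gradient of the solution and two small errors. *)
Lemma energy_combine (R : realType) (X A W g0 g1 d0 d1 q0 q1 J e c k0 k1 : R) :
  X <= A + W -> W <= e * c -> g0 + g1 <= A -> d0 <= e * k0 -> d1 <= e * k1 ->
  q0 <= e * 1 -> q1 <= e * 1 ->
  2 * A <= (g0 + d0 + q0) + (g1 + d1 + q1) + J -> X - J <= e * (c + (k0 + k1 + 2)).
Proof. lra. Qed.

Section H10Limits.
Context {R : realType}.
Variables (Omega : set (R * R)) (M : R).
Hypotheses (mO : measurable (Omega : set (plane R))) (OM : Omega `<=` box M).

Lemma indic_Ltwo : (\1_Omega : plane R -> R) \in Lfun leb2 2%:E.
Proof.
apply: LtwoP; first exact: measurable_indic.
have i1 : leb2.-integrable setT (EFin \o (\1_Omega : plane R -> R)).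
  have := integrable_box (@cst_continuous _ _ (1 : R)) mO OM.
  move/(integrable_mkcond _ mO); apply: eq_integrable => // x _.
  by rewrite patchE /= indicE; case: ifP.
apply: eq_integrable i1 => // x _ /=.
by rewrite indicE; case: (_ \in _); rewrite ?expr0n ?expr1n.
Qed.

Let c : R := norm2 leb2 (\1_Omega : plane R -> R).

Section Fixed.
Variables (u : R * R -> R) (g : 'I_2 -> R * R -> R).
Hypothesis ug : in_H10 Omega u g.

Let Lu : (u \_ Omega : plane R -> R) \in Lfun leb2 2%:E.
Proof. by have [[]] := ug. Qed.

Let Lg i : (g i \_ Omega : plane R -> R) \in Lfun leb2 2%:E.
Proof. by have [[_ /(_ i)[]]] := ug. Qed.

Lemma Ltwo_integrable_on (f : plane R -> R) : f \in Lfun leb2 2%:E ->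
  (forall x, ~ Omega x -> f x = 0) -> leb2.-integrable setT (EFin \o f) /\
  \int[leb2]_x `|f x| <= norm2 leb2 f * c.
Proof.
move=> Lf fO.
have e (h : plane R -> R) : (forall x, ~ Omega x -> h x = 0) -> forall x, h x * \1_Omega x = h x.
  move=> hO x; rewrite indicE; have [Ox|Ox] := pselect (Omega x).
    by rewrite mem_set ?mulr1.
  by rewrite hO ?mul0r.
split.
  have := Ltwo_mul Lf indic_Ltwo; apply: eq_integrable => // x _ /=.
  by rewrite e.
have := cauchy_schwarz (Ltwo_normr Lf) indic_Ltwo; rewrite norm2_normr.
have -> : \int[leb2]_x (`|f x| * \1_Omega x) = \int[leb2]_x `|f x|.
  by apply: eq_Rintegral => x _; apply: (e (fun x => `|f x|)) => y /fO ->; rewrite normr0.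
by rewrite ger0_norm//; apply: Rintegral_ge0 => x _.
Qed.

(** By density: both sides are continuous for the H^1-norm, as the supports
    stay in a set of finite area. *)
Lemma weak_form_H10 (k : 'I_2 -> R * R -> R) :
  (forall i, (k i \_ Omega : plane R -> R) \in Lfun leb2 2%:E) ->
  (forall phi, test_function Omega phi ->
    \int[leb2]_x (\sum_(i < 2) (k i \_ Omega) x * partial i phi x) = \int[leb2]_x phi x) ->
  \int[leb2]_x (\sum_(i < 2) (k i \_ Omega) x * (g i \_ Omega) x) =
  \int[leb2]_x (u \_ Omega) x.
Proof.
move=> Lk weak.
set I1 := \int[_]_x _; set I2 := \int[_]_x _.
pose K := c + (norm2 leb2 (k ord0 \_ Omega : plane R -> R) + norm2 leb2 (k ord_max \_ Omega : plane R -> R)).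
have K0 : 0 <= K by rewrite /K !addr_ge0// norm2_ge0.
have bound e : 0 < e -> `|I1 - I2| <= e * K.
  move=> e0; have [phi tphi [wu wg]] := H10_approx ug e0.
  have Lphi := test_Ltwo tphi; have Ldphi i := test_partial_Ltwo i tphi.
  have Lw := Ltwo_sub Lphi Lu; have Ld i := Ltwo_sub (Ldphi i) (Lg i).
  have outO (f : R * R -> R) x : ~ Omega x -> (f \_ Omega) x = 0.
    by move=> Ox; rewrite patchE memNset.
  have [iw nw] : leb2.-integrable setT (EFin \o (fun x : plane R => phi x - (u \_ Omega) x)) /\
      \int[leb2]_x `|phi x - (u \_ Omega) x| <= norm2 leb2 (fun x : plane R => phi x - (u \_ Omega) x) * c.
    by apply: Ltwo_integrable_on Lw _ => x Ox; rewrite (test_out tphi Ox) outO// subr0.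
  have [iu _] := Ltwo_integrable_on Lu (outO u).
  have ikg i := Ltwo_mul (Lk i) (Lg i); have ikd i := Ltwo_mul (Lk i) (Ld i).
  have E2 : \int[leb2]_x phi x = I2 + \int[leb2]_x (phi x - (u \_ Omega) x).
    rewrite -RintgD//; apply: eq_Rintegral => x _; ring.
  have E1 : \int[leb2]_x phi x = I1 + (\int[leb2]_x ((k ord0 \_ Omega) x * (partial ord0 phi x - (g ord0 \_ Omega) x))
      + \int[leb2]_x ((k ord_max \_ Omega) x * (partial ord_max phi x - (g ord_max \_ Omega) x))).
    rewrite -(weak _ tphi) /I1.
    under [in RHS]eq_Rintegral do rewrite sum_ord2.
    under [in LHS]eq_Rintegral do rewrite sum_ord2.
    rewrite -RintgD// -RintgD//; [|exact: intgD..].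
    by apply: eq_Rintegral => x _; ring.
  have B i := cauchy_schwarz (Lk i) (Ld i).
  have B' i : `|\int[leb2]_x ((k i \_ Omega) x * (partial i phi x - (g i \_ Omega) x))| <=
      norm2 leb2 (k i \_ Omega : plane R -> R) * e.
    by apply: le_trans (B i) _; rewrite ler_wpM2l ?norm2_ge0.
  have Bw : `|\int[leb2]_x (phi x - (u \_ Omega) x)| <= e * c.
    apply: le_trans (le_normr_Rintegral measurableT iw) _; apply: le_trans nw _.
    by rewrite ler_wpM2r ?norm2_ge0.
  by move: E1; rewrite E2 => E1; exact: norm_sub_le E1 (B' ord0) (B' ord_max) Bw.
apply/eqP; rewrite -subr_eq0 -normr_le0.
exact: le0_small K0 bound.
Qed.

End Fixed.

Lemma weak_form_restrict (g : 'I_2 -> R * R -> R) phi : test_function Omega phi ->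
  \int[leb2]_(x in Omega) (\sum_(i < 2) g i x * partial i phi x) = \int[leb2]_(x in Omega) phi x ->
  \int[leb2]_x (\sum_(i < 2) (g i \_ Omega) x * partial i phi x) = \int[leb2]_x phi x.
Proof.
move=> tphi; rewrite Rintegral_mkcond [in RHS]Rintegral_mkcond (test_restrict tphi) => <-.
apply: eq_Rintegral => x _; rewrite patchE; case: ifPn => [xO|].
  by apply: eq_bigr => i _; rewrite patchE xO.
rewrite notin_setE => /(test_partial_out _ tphi) p0.
by rewrite big1// => i _; rewrite p0 mulr0.
Qed.

Section UpperBound.
Variables (a0 a1 a2 a11 a12 a22 : R).
Local Notation U := (quad a0 a1 a2 a11 a12 a22).
Local Notation E := (positivity_set a0 a1 a2 a11 a12 a22).
Hypotheses (laplacian : 2 * a11 + 2 * a22 = -1) (M0 : 0 < M) (bE : E `<=` box M).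
Hypothesis OE : Omega `<=` E.

Lemma picone_test phi : test_function Omega phi ->
  2 * \int[leb2]_x `|phi x| <=
  (\int[leb2]_x (partial ord0 phi x ^+ 2) + \int[leb2]_x (partial ord_max phi x ^+ 2))
  + \int[leb2]_(x in E) U x.
Proof.
move=> tphi; have [_ _ k] := tphi.
apply: (picone laplacian (test_continuous tphi) (test_derivable tphi) (test_partial_continuous tphi)
  (@closed_closure _ [set x | phi x != 0])) M0 bE.
- by move=> x /k/OE.
- move=> x xS; apply/eqP/negPn/negP => x0; apply: xS; exact: subset_closure.
Qed.

(** Picone's inequality for a test function phi close to the solution u. Its
    energy is close to the pairing of grad u and grad phi, which by the weak
    equation is the integral of phi, hence at most the norm of phi; one of the
    two copies of this norm cancels. *)
Lemma torsion_norm1_le u g : in_H10 Omega u g ->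
  (forall phi, test_function Omega phi ->
    \int[leb2]_(x in Omega) (\sum_(i < 2) g i x * partial i phi x) = \int[leb2]_(x in Omega) phi x) ->
  leb2.-integrable setT (EFin \o (u \_ Omega : plane R -> R)) /\
  \int[leb2]_x `|(u \_ Omega) x| <= \int[leb2]_(x in E) U x.
Proof.
move=> ug tor.
have Lu : (u \_ Omega : plane R -> R) \in Lfun leb2 2%:E by have [[]] := ug.
have Lg i : (g i \_ Omega : plane R -> R) \in Lfun leb2 2%:E by have [[_ /(_ i)[]]] := ug.
have outO (f : R * R -> R) x : ~ Omega x -> (f \_ Omega) x = 0.
  by move=> Ox; rewrite patchE memNset.
have [iu _] := Ltwo_integrable_on Lu (outO u).
split => //; rewrite -subr_le0.
pose k i := norm2 leb2 (g i \_ Omega : plane R -> R).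
suff H e : 0 < e -> e <= 1 ->
    \int[leb2]_x `|(u \_ Omega) x| - \int[leb2]_(x in E) U x <= e * (c + (k ord0 + k ord_max + 2)).
  have K0 : 0 <= c + (k ord0 + k ord_max + 2) by rewrite !addr_ge0// ?norm2_ge0.
  apply: (@le0_small _ _ (c + (k ord0 + k ord_max + 2))) => // e e0.
  have [e1|e1] := leP e 1; first exact: H.
  by apply: le_trans (H 1 ltr01 (lexx _)) _; rewrite ler_wpM2r// ltW.
move=> e0 e1; have [phi tphi [wu wg]] := H10_approx ug e0.
have Lphi := test_Ltwo tphi; have Ldphi i := test_partial_Ltwo i tphi.
have Lw := Ltwo_sub Lphi Lu; have Ld i := Ltwo_sub (Ldphi i) (Lg i).
have [iphi _] := Ltwo_integrable_on Lphi (fun x Ox => test_out tphi Ox).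
have [iw nw] : leb2.-integrable setT (EFin \o (fun x : plane R => phi x - (u \_ Omega) x)) /\
    \int[leb2]_x `|phi x - (u \_ Omega) x| <= norm2 leb2 (fun x : plane R => phi x - (u \_ Omega) x) * c.
  by apply: Ltwo_integrable_on Lw _ => x Ox; rewrite (test_out tphi Ox) outO// subr0.
have nint (f : plane R -> R) : leb2.-integrable setT (EFin \o f) ->
    leb2.-integrable setT (EFin \o (fun x => `|f x|)).
  by move=> h; exact: (integrable_norm h).
have XA : \int[leb2]_x `|(u \_ Omega) x| <= \int[leb2]_x `|phi x| + \int[leb2]_x `|phi x - (u \_ Omega) x|.
  rewrite -RintgD; [|exact: nint..].
  apply: le_Rintegral => //; [exact: nint|apply: intgD; exact: nint|].
  move=> x _; rewrite [leLHS](_ : _ = `|phi x - (phi x - (u \_ Omega) x)|) ?ler_normB//.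
  by rewrite subKr.
have iqq i := Ltwo_mul (Lg i) (Ldphi i); have idg i := Ltwo_mul (Ld i) (Lg i); have idd i := Ltwo_mul (Ld i) (Ld i).
have SQ i : \int[leb2]_x (partial i phi x ^+ 2) =
    \int[leb2]_x ((g i \_ Omega) x * partial i phi x)
    + \int[leb2]_x ((partial i phi x - (g i \_ Omega) x) * (g i \_ Omega) x)
    + \int[leb2]_x ((partial i phi x - (g i \_ Omega) x) * (partial i phi x - (g i \_ Omega) x)).
  rewrite -RintgD// -RintgD//; [|exact: intgD].
  by apply: eq_Rintegral => x _; ring.
have B1 i : \int[leb2]_x ((partial i phi x - (g i \_ Omega) x) * (g i \_ Omega) x) <= e * k i.
  apply: le_trans (ler_norm _) _; apply: le_trans (cauchy_schwarz (Ld i) (Lg i)) _.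
  by rewrite ler_wpM2r ?norm2_ge0.
have B2 i : \int[leb2]_x ((partial i phi x - (g i \_ Omega) x) * (partial i phi x - (g i \_ Omega) x)) <= e * 1.
  apply: le_trans (ler_norm _) _; apply: le_trans (cauchy_schwarz (Ld i) (Ld i)) _.
  by rewrite ler_pM ?norm2_ge0// (le_trans (wg i)).
have W : \int[leb2]_x ((g ord0 \_ Omega) x * partial ord0 phi x)
    + \int[leb2]_x ((g ord_max \_ Omega) x * partial ord_max phi x) <= \int[leb2]_x `|phi x|.
  rewrite -RintgD//.
  under eq_Rintegral do rewrite -(sum_ord2 (fun i => (g i \_ Omega) _ * partial i phi _)).
  rewrite (weak_form_restrict tphi (tor _ tphi)).
  by apply: le_trans (ler_norm _) _; exact: le_normr_Rintegral.
have Bw : \int[leb2]_x `|phi x - (u \_ Omega) x| <= e * c.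
  by apply: le_trans nw _; rewrite ler_wpM2r ?norm2_ge0.
have := picone_test tphi; rewrite !SQ.
exact: energy_combine XA Bw W (B1 ord0) (B1 ord_max) (B2 ord0) (B2 ord_max).
Qed.

End UpperBound.

End H10Limits.

(** * Smooth cut-off functions *)
Section FlatExponential.
Context {R : realType}.
Implicit Types (s t : R).

(** The family s^-m exp (-1/s), extended by 0, is stable under derivation, and
    flat_exp 0 is a smooth function with values between 0 and 1. *)
Definition flat_exp (m : nat) s : R := if 0 < s then s ^- m * expR (- s^-1) else 0.

Lemma flat_exp_le m (k : nat) s : 0 < s -> (0 < k)%N -> flat_exp m s <= s ^- m * (k%:R * s) ^+ k.
Proof.
move=> s0 k0; rewrite /flat_exp s0 ler_pM2l ?invr_gt0 ?exprn_gt0//.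
have kR : 0 < k%:R :> R by rewrite ltr0n.
rewrite expRN -[leRHS]invrK lef_pV2 ?posrE ?expR_gt0 ?invr_gt0 ?exprn_gt0 ?mulr_gt0//.
have -> : s^-1 = k%:R * (k%:R * s)^-1 by field; rewrite !gt_eqF.
rewrite expRM_natl -exprVn lerXn2r ?nnegrE ?expR_ge0 ?invr_ge0 ?mulr_ge0 ?ltW//.
by apply: lt_le_trans (expR_ge1Dx _); rewrite ltrDr.
Qed.

Lemma flat_exp_le0 m s : s <= 0 -> flat_exp m s = 0.
Proof. by move=> s0; rewrite /flat_exp ltNge s0. Qed.

Lemma flat_exp_ge0 m s : 0 <= flat_exp m s.
Proof.
by rewrite /flat_exp; case: ifP => // s0; rewrite mulr_ge0 ?expR_ge0// invr_ge0 exprn_ge0 ?ltW.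
Qed.

Lemma flat_exp_small m s : 0 < s -> flat_exp m s <= (m.+2)%:R ^+ m.+2 * s ^+ 2.
Proof.
move=> s0; apply: le_trans (flat_exp_le m s0 (isT : (0 < m.+2)%N)) _.
rewrite exprMn mulrCA ler_wpM2l ?exprn_ge0//.
by rewrite -[in leLHS]addn2 exprD mulKf// expf_neq0// gt_eqF.
Qed.

Lemma is_derive_quadratic_bound (f : R -> R) (C : R) : 0 < C ->
  (forall s, `|f s| <= C * s ^+ 2) -> is_derive (0 : R) 1 f 0.
Proof.
move=> C0 fC; have f0 : f 0 = 0.
  by apply/eqP; rewrite -normr_le0; apply: le_trans (fC 0) _; rewrite expr0n mulr0.
have cv : h^-1 *: ((f \o shift 0) (h *: 1) - f 0) @[h --> 0^'] --> (0 : R).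
  apply/cvgrPdist_lt => e e0; near=> h.
  have h0 : h != 0 by near: h; exact: nbhs_dnbhs_neq.
  have hC : `|h| < e / C by near: h; apply: dnbhs0_lt; rewrite divr_gt0.
  rewrite sub0r normrN /= addr0 f0 subr0 [h *: 1]mulr1 normrZ normfV ltr_pdivrMl ?normr_gt0//.
  apply: le_lt_trans (fC h) _; rewrite -(real_normK (num_real h)) expr2 mulrCA ltr_pM2l ?normr_gt0//.
  by rewrite mulrC -ltr_pdivlMr.
by split; [apply/cvg_ex; exists 0|exact: cvg_lim cv].
Unshelve. all: by end_near. Qed.

Lemma is_derive_flat_exp m s :
  is_derive s 1 (flat_exp m) (- m%:R * flat_exp m.+1 s + flat_exp m.+2 s).
Proof.
have [s0|s0] := ltP s 0.
  have e : \forall t \near s, cst 0 t = flat_exp m t.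
    near=> t; rewrite flat_exp_le0//.
    by near: t; exact: lt_le_nbhsl.
  apply: near_eq_is_derive e _.
  rewrite !flat_exp_le0 ?ltW// mulr0 addr0.
  exact: is_derive_cst.
rewrite le_eqVlt in s0; move: s0 => /orP[/eqP <-|s0]; last first.
  have e : \forall t \near s, (t^-1) ^+ m * expR (- t^-1) = flat_exp m t.
    near=> t; rewrite /flat_exp ifT ?exprVn//.
    by near: t; exact: lt_nbhsr.
  apply: near_eq_is_derive e _.
  have s1 : s != 0 by rewrite gt_eqF.
  have hi := is_derive_inv s1.
  have hx := is_deriveX m hi.
  have he := @is_derive1_comp _ expR (fun t => - t^-1) s _ _ (is_derive_expR _) (is_deriveN hi).
  have h := is_deriveM hx he.
  have -> : (fun t : R => t^-1 ^+ m * expR (- t^-1)) =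
      ((fun t : R => t^-1) ^+ m * (expR \o (fun t => - t^-1)))%R.
    by apply/funext => t; rewrite /= exprfctE.
  apply: (is_derive_eq h); rewrite exprfctE /GRing.scale /= /flat_exp s0 -!exprVn !exprS.
  clear h hx; case: m => [|k]; rewrite /= ?expr0 ?exprS; ring.
rewrite !flat_exp_le0// mulr0 addr0.
apply: (@is_derive_quadratic_bound _ ((m.+2)%:R ^+ m.+2)); first by rewrite exprn_gt0.
move=> t; rewrite ger0_norm ?flat_exp_ge0//.
have [t0|t0] := ltP 0 t; first exact: flat_exp_small.
by rewrite flat_exp_le0// mulr_ge0 ?sqr_ge0 ?exprn_ge0.
Unshelve. all: by end_near. Qed.

Lemma continuous_flat_exp m : continuous (flat_exp m).
Proof.
move=> s; apply: differentiable_continuous; apply/derivable1_diffP.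
by have [] := is_derive_flat_exp m s.
Qed.

Lemma flat_exp0_le1 s : flat_exp 0 s <= 1.
Proof.
rewrite /flat_exp; case: ifP => // s0.
by rewrite expr0 invr1 mul1r -expR0 ler_expR oppr_le0 invr_ge0 ltW.
Qed.

Lemma flat_exp1_le1 s : flat_exp 1 s <= 1.
Proof.
have [s0|s0] := ltP 0 s; last by rewrite flat_exp_le0.
by apply: le_trans (flat_exp_le 1 s0 (ltn0Sn 0)) _; rewrite !expr1 mul1r mulVf// gt_eqF.
Qed.

Lemma flat_expS m s : flat_exp m.+1 s = s^-1 * flat_exp m s.
Proof.
by rewrite /flat_exp; case: ifP => s0; rewrite ?mulr0// -!exprVn exprS mulrA.
Qed.

(** The gradient of the cut-off of U is (1 + cutoff_error s) times the
    gradient of U, where s = n U - 1: the last two terms come from the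
    derivative of the cut-off factor, since
    (s + 1) flat_exp 2 s = flat_exp 1 s + flat_exp 2 s. *)
Definition cutoff_error s := flat_exp 0 s - 1 + (flat_exp 1 s + flat_exp 2 s).

Lemma flat_exp0_near1 s : 0 < s -> `|flat_exp 0 s - 1| <= s^-1.
Proof.
move=> s0; rewrite ler0_norm ?subr_le0 ?flat_exp0_le1// opprB lerBlDr.
rewrite /flat_exp s0 expr0 invr1 mul1r -lerBlDl.
by have := expR_ge1Dx (- s^-1).
Qed.

Lemma cutoff_error_near0 s : 0 < s -> `|cutoff_error s| <= 3 * s^-1.
Proof.
move=> s0; have h0 := flat_exp0_near1 s0.
have i0 : 0 <= s^-1 by rewrite invr_ge0 ltW.
have h1 : flat_exp 1 s <= s^-1 by rewrite flat_expS ler_piMr// flat_exp0_le1.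
have h2 : flat_exp 2 s <= s^-1 by rewrite flat_expS ler_piMr// flat_exp1_le1.
have p1 := flat_exp_ge0 1 s; have p2 := flat_exp_ge0 2 s.
move: h0; rewrite /cutoff_error !ler_norml => /andP[? ?]; apply/andP; split; lra.
Qed.

Lemma flat_exp0_bound s : `|flat_exp 0 s - 1| <= 1.
Proof.
have := flat_exp0_le1 s; have := flat_exp_ge0 0 s.
by rewrite ler_norml => ? ?; apply/andP; split; lra.
Qed.

Lemma cutoff_error_bound s : `|cutoff_error s| <= 6.
Proof.
have h2 : flat_exp 2 s <= 4.
  have [s0|s0] := ltP 0 s; last by rewrite flat_exp_le0.
  apply: le_trans (flat_exp_le 2 s0 (isT : (0 < 2)%N)) _.
  by rewrite exprMn mulrCA mulVf ?mulr1 ?expf_neq0 ?gt_eqF// -natrX.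
have := flat_exp0_bound s; have := flat_exp1_le1 s; have := flat_exp_ge0 1 s; have := flat_exp_ge0 2 s.
by rewrite /cutoff_error !ler_norml => ? ? ? /andP[? ?]; apply/andP; split; lra.
Qed.

Lemma continuous_flat_exp0_error : continuous (fun s => flat_exp 0 s - 1).
Proof. by move=> s; apply: cvgB; [exact: continuous_flat_exp|exact: cvg_cst]. Qed.

Lemma continuous_cutoff_error : continuous cutoff_error.
Proof.
move=> s; apply: cvgD; first exact: continuous_flat_exp0_error.
by apply: cvgD; exact: continuous_flat_exp.
Qed.

End FlatExponential.

Section SmoothClass.
Context {R : realType}.

(** A class of functions on the plane closed under partial derivatives, large
    enough to contain a smooth cut-off of a polynomial. *)
Inductive elementary (q : R * R -> R) : (R * R -> R) -> Prop :=
| elementary_cst k : elementary q (fun=> k)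
| elementary_fst : elementary q fst
| elementary_snd : elementary q snd
| elementary_add f g : elementary q f -> elementary q g -> elementary q (fun x => f x + g x)
| elementary_mul f g : elementary q f -> elementary q g -> elementary q (fun x => f x * g x)
| elementary_flat m : elementary q (fun x => flat_exp m (q x)).

Variables (q : R * R -> R) (dq : 'I_2 -> R * R -> R).
Hypothesis q_derive : forall i x, is_derive x (axis i) q (dq i x).
Hypothesis dq_elementary : forall i, elementary q (dq i).
Hypothesis cq : continuous q.

Lemma elementary_continuous f : elementary q f -> continuous f.
Proof.
elim=> [k|||{}f g _ cf _ cg|{}f g _ cf _ cg|m] x.
- exact: continuous_cstx.
- exact: fst_continuous.
- exact: snd_continuous.
- by apply: continuousDx; [exact: cf|exact: cg].
- by apply: continuousMx; [exact: cf|exact: cg].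
- by apply: continuous_comp; [exact: cq|exact: continuous_flat_exp].
Qed.

Lemma elementary_partial f i : elementary q f ->
  exists2 df, elementary q df & forall x, is_derive x (axis i) f (df x).
Proof.
elim=> [k|||{}f g _ [df edf hf] _ [dg edg hg]|{}f g ef [df edf hf] eg [dg edg hg]|m].
- by exists (fun=> 0); [exact: elementary_cst|move=> x; exact: is_derive_cst].
- by exists (fun=> (axis i).1); [exact: elementary_cst|move=> x; exact: is_derive_fst].
- by exists (fun=> (axis i).2); [exact: elementary_cst|move=> x; exact: is_derive_snd].
- exists (fun x => df x + dg x); first exact: elementary_add.
  by move=> x; exact: is_deriveDx.
- exists (fun x => df x * g x + f x * dg x).
    by apply: elementary_add; exact: elementary_mul.
  by move=> x; exact: is_deriveMx.
- exists (fun x => (- m%:R * flat_exp m.+1 (q x) + flat_exp m.+2 (q x)) * dq i x).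
    apply: elementary_mul => //; apply: elementary_add; last exact: elementary_flat.
    by apply: (elementary_mul (elementary_cst _ _)); exact: elementary_flat.
  by move=> x; apply: is_derive_compx => //; exact: is_derive_flat_exp.
Qed.

Lemma elementary_smooth f : elementary q f -> smooth f.
Proof.
move=> ef s; have e : elementary q (foldr partial f s).
  elim: s => [//|i s /(elementary_partial i)[df edf hdf]] /=.
  rewrite (_ : partial _ _ = df)//.
  by apply/funext => x; have [] := hdf x.
split; first exact: elementary_continuous.
by move=> i x; have [df _ /(_ x)[]] := elementary_partial i e.
Qed.

End SmoothClass.

(** * The torsion function of an ellipse *)
Lemma poweR_half_cvg0 (R : realType) (S : nat -> \bar R) : (forall n, 0 <= S n)%E ->
  S n @[n --> \oo] --> 0%E -> poweR (S n) 2^-1 @[n --> \oo] --> 0%E.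
Proof.
move=> S0 /fine_cvgP[fS cS].
have cq : Num.sqrt (fine (S n)) @[n --> \oo] --> (0 : R).
  rewrite -(sqrtr0 R); apply: continuous_cvg; [exact: sqrt_continuous|exact: cS].
have e : \forall n \near \oo, poweR (S n) 2^-1 = (Num.sqrt (fine (S n)))%:E.
  by apply: filterS fS => n fn; rewrite poweR12_sqrt// -[in LHS](fineK fn).
apply/fine_cvgP; split; first by apply: filterS e => n ->.
by apply: cvg_trans cq; apply: near_eq_cvg; apply: filterS e => n /= ->.
Qed.

Lemma sum3_cvg0 (R : realType) (a b c : nat -> \bar R) : a n @[n --> \oo] --> 0%E ->
  b n @[n --> \oo] --> 0%E -> c n @[n --> \oo] --> 0%E ->
  (a n + (b n + c n))%E @[n --> \oo] --> 0%E.
Proof.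
move=> ha hb hc; rewrite -[X in _ --> X]adde0; apply: cvgeD => //.
by rewrite -[X in _ --> X]adde0; exact: cvgeD.
Qed.

Lemma Lnorm2_sqr d (T : measurableType d) (R : realType) (mu : {measure set T -> \bar R}) (f : T -> R) :
  ('N[mu]_2%:E[EFin \o f] ^+ 2 = \int[mu]_x (f x ^+ 2)%:E)%E.
Proof.
have i0 : (0 <= \int[mu]_x ((f x) ^+ 2)%:E)%E by apply: integral_ge0 => x _; rewrite lee_fin sqr_ge0.
rewrite unlock.
under eq_integral do rewrite /= powR_mulrn// -normrX ger0_norm ?sqr_ge0//.
by rewrite poweR12_sqrt// sqr_sqrte.
Qed.

Section QuadraticIsTorsion.
Context {R : realType}.
Variables (a0 a1 a2 a11 a12 a22 M : R).
Local Notation U := (quad a0 a1 a2 a11 a12 a22).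
Local Notation dU := (dquad a1 a2 a11 a12 a22).
Local Notation E := (positivity_set a0 a1 a2 a11 a12 a22).
Hypotheses (laplacian : 2 * a11 + 2 * a22 = -1) (M0 : 0 < M) (bE : E `<=` box M).

Let mE : measurable (E : set (plane R)).
Proof. exact: open_measurable_plane (@open_positivity_set R a0 a1 a2 a11 a12 a22). Qed.

Lemma continuous_restrict_Ltwo (w : R * R -> R) : continuous w ->
  (w \_ E : plane R -> R) \in Lfun leb2 2%:E.
Proof.
move=> cw; apply: LtwoP.
  apply/(measurable_restrictT (w : plane R -> R) mE).
  have h := continuous_measurable_plane cw.
  exact: measurable_funTS.
have cww : continuous (fun x => w x * w x) by move=> x; apply: continuousMx; exact: cw.
have := integrable_box cww mE bE; move/(integrable_mkcond _ mE).
apply: eq_integrable => // x _; rewrite /= !patchE; case: ifP => //=.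
by rewrite expr0n.
Qed.

Let step (n : nat) (x : R * R) : R := n.+1%:R * U x - 1.

Let continuous_step n : continuous (step n).
Proof.
move=> x; apply: cvgB; last exact: cvg_cst.
by apply: cvgM; [exact: cvg_cst|exact: continuous_quad].
Qed.

(** Dominated convergence: on E the functions step n tend to infinity, where c
    tends to 0. *)
Lemma cutoff_cvg (c : R -> R) (w : R * R -> R) (B : R) : continuous c -> continuous w -> 0 <= B ->
  (forall s, `|c s| <= B) -> (forall s, 0 < s -> `|c s| <= B * s^-1) ->
  (\int[leb2]_(x in E) ((w x * c (step n x)) ^+ 2)%:E)%E @[n --> \oo] --> 0%E.
Proof.
move=> cc cw B0 cB c0.
have [C hC] := continuous_bounded_box M cw.
have mf n : measurable_fun E ((fun x : plane R => ((w x * c (step n x)) ^+ 2)%:E) : plane R -> \bar R).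
  apply/measurable_EFinP.
  have : continuous (fun x => (w x * c (step n x)) ^+ 2).
    move=> x; have h : {for x, continuous (fun x => w x * c (step n x))}.
      by apply: continuousMx; [exact: cw|apply: continuous_comp; [exact: continuous_step|exact: cc]].
    exact: (continuousMx h h).
  by move=> /continuous_measurable_plane h; exact: measurable_funTS.
rewrite -(@integral0 _ _ _ leb2 E).
apply: (@dominated_cvg _ _ _ leb2 E mE _ (cst 0%E) (cst (((C * B) ^+ 2)%:E))) => //.
- move=> x Ex; apply/fine_cvgP; split; first exact: nearW.
  have U0 : 0 < U x := Ex.
  have -> : (0 : R) = (w x * 0) ^+ 2 by rewrite mulr0 expr0n.
  suff h : c (step n x) @[n --> \oo] --> (0 : R).
    have h1 : (w x * c (step n x)) @[n --> \oo] --> w x * 0 by apply: cvgM h; exact: cvg_cst.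
    exact: (cvgM h1 h1).
  apply/cvgr0Pnorm_lt => e e0.
  have d0 : 0 < U x / ((B + 1) / e + 1).
    by rewrite divr_gt0// ltr_wpDl// divr_ge0 ?addr_ge0// ltW.
  have := near_infty_natSinv_lt (PosNum d0).
  apply: filterS => n /=; rewrite invf_plt ?posrE// invf_div ltr_pdivrMr// => hn.
  have s1 : (B + 1) / e < step n x by rewrite /step ltrBrDr.
  have s0 : 0 < step n x by apply: le_lt_trans s1; rewrite divr_ge0 ?addr_ge0// ltW.
  apply: le_lt_trans (c0 _ s0) _; rewrite ltr_pdivrMr//.
  by move: s1; rewrite ltr_pdivrMr// mulrC; apply: le_lt_trans; rewrite lerDl.
- exact: (integrable_box (@cst_continuous _ _ ((C * B) ^+ 2)) mE bE).
- move=> n x Ex /=; rewrite lee_fin normrX lerXn2r ?nnegrE//.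
    by apply: mulr_ge0 => //; apply: le_trans (hC x (bE Ex)).
  by rewrite normrM ler_pM//; exact/hC/bE.
Qed.

(** A smooth function with compact support in E, as it vanishes where
    U <= 1 / (n + 1). *)
Definition cutoff n x : R := U x * flat_exp 0 (step n x).

Let is_derive_step n i x : is_derive x (axis i) (step n) (n.+1%:R * dU i x).
Proof.
have h := is_deriveDx (is_deriveMx (is_derive_cst (n.+1%:R : R) x (axis i))
  (is_derive_quad a0 a1 a2 a11 a12 a22 i x)) (is_derive_cst (-1 : R) x (axis i)).
by apply: (is_derive_eq h); rewrite mul0r addr0 add0r.
Qed.

Lemma is_derive_cutoff n i x : is_derive x (axis i) (cutoff n)
  (dU i x * flat_exp 0 (step n x) + U x * (flat_exp 2 (step n x) * (n.+1%:R * dU i x))).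
Proof.
have h := is_deriveMx (is_derive_quad a0 a1 a2 a11 a12 a22 i x)
  (is_derive_compx (is_derive_step n i x) (is_derive_flat_exp 0 (step n x))).
by apply: (is_derive_eq h); rewrite oppr0 mul0r add0r.
Qed.

Lemma partial_cutoff n i x : partial i (cutoff n) x = dU i x + dU i x * cutoff_error (step n x).
Proof.
rewrite /partial; have [_ ->] := is_derive_cutoff n i x.
have e : n.+1%:R * U x = step n x + 1 by rewrite subrK.
have f1 : step n x * flat_exp 2 (step n x) = flat_exp 1 (step n x).
  have [s0|s0] := ltP 0 (step n x); last by rewrite !flat_exp_le0// mulr0.
  by rewrite (flat_expS 1) mulrA mulfV ?mul1r// gt_eqF.
rewrite /cutoff_error -f1; transitivity (dU i x * flat_exp 0 (step n x) + dU i x * (n.+1%:R * U x) * flat_exp 2 (step n x)).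
  by ring.
by rewrite e; ring.
Qed.

Lemma elementary_quad (q : R * R -> R) : elementary q U.
Proof.
have c := @elementary_cst R q; have e1 := @elementary_fst R q; have e2 := @elementary_snd R q.
exact: (elementary_add (elementary_add (elementary_add (elementary_add (elementary_add (c a0)
  (elementary_mul (c a1) e1)) (elementary_mul (c a2) e2)) (elementary_mul (c a11) (elementary_mul e1 e1)))
  (elementary_mul (c a12) (elementary_mul e1 e2))) (elementary_mul (c a22) (elementary_mul e2 e2))).
Qed.

Lemma elementary_dquad (q : R * R -> R) i : elementary q (dU i).
Proof.
have c := @elementary_cst R q; have e1 := @elementary_fst R q; have e2 := @elementary_snd R q.
have [->|i0] := eqVneq i ord0.
  by rewrite dquad0; exact: (elementary_add (elementary_add (c a1) (elementary_mul (c (2 * a11)) e1))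
    (elementary_mul (c a12) e2)).
by rewrite dquad1//; exact: (elementary_add (elementary_add (c a2) (elementary_mul (c a12) e1))
  (elementary_mul (c (2 * a22)) e2)).
Qed.

Lemma test_cutoff n : test_function E (cutoff n).
Proof.
pose S := [set x | n.+1%:R^-1 <= U x].
have cS : closed S.
  rewrite (_ : S = U @^-1` [set y | n.+1%:R^-1 <= y]); last by [].
  apply: preimage_closed; last exact: closed_ge.
  by move=> x _; exact: continuous_quad.
have SE : S `<=` E.
  by move=> x /=; apply: lt_le_trans; rewrite invr_gt0.
have sub : closure [set x | cutoff n x != 0] `<=` S.
  rewrite [X in _ `<=` X]((closure_id S).1 cS); apply: closureS => x; rewrite /S /=.
  have [s0|s0] := ltP 0 (step n x); last by rewrite /cutoff flat_exp_le0// mulr0 eqxx.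
  by move=> _; rewrite -[leLHS]mulr1 ler_pdivrMl// ltW// -subr_gt0.
split; last exact: subset_trans sub SE.
  apply: (@elementary_smooth _ (step n) (fun i x => n.+1%:R * dU i x)).
  - exact: is_derive_step.
  - by move=> i; apply: elementary_mul; [exact: elementary_cst|exact: elementary_dquad].
  - exact: continuous_step.
  - by apply: elementary_mul; [exact: elementary_quad|exact: elementary_flat].
apply: (subclosed_compact _ (@compact_box R M)); first exact: closed_closure.
exact: subset_trans sub (subset_trans SE bE).
Qed.

Let weak_partial_quad i : weak_partial E i U (dU i).
Proof.
move=> phi tphi.
have cp := test_continuous tphi; have cdp := test_partial_continuous tphi (i := i).
have dp x : is_derive x (axis i) phi (partial i phi x) by apply: derivableP; exact: (test_derivable tphi).
pose F x := dU i x * phi x + U x * partial i phi x.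
have hF x : is_derive x (axis i) (fun x => U x * phi x) (F x).
  exact: is_deriveMx (is_derive_quad _ _ _ _ _ _ i x) (dp x).
have eF : partial i (fun x => U x * phi x) = F.
  by apply/funext => x; rewrite /partial; have [] := hF x.
have cF : continuous F.
  move=> x; apply: continuousDx; apply: continuousMx; [exact: continuous_dquad|exact: cp|exact: continuous_quad|exact: cdp].
have vF : vanishes_off_box (fun x => U x * phi x).
  by apply: off_boxW (test_vanishes tphi) => x ->; rewrite mulr0.
have := @integral_partial0 _ (fun x => U x * phi x) i (fun x => @ex_derive _ _ _ _ _ _ _ (hF x)).
rewrite eF => /(_ cF vF) I0.
have iE (w : R * R -> R) : continuous w -> leb2.-integrable E (EFin \o (w : plane R -> R)).
  by move=> cw; exact: integrable_box cw mE bE.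
have cUd : continuous (fun x => U x * partial i phi x).
  by move=> x; apply: continuousMx; [exact: continuous_quad|exact: cdp].
have cdU : continuous (fun x => dU i x * phi x).
  by move=> x; apply: continuousMx; [exact: continuous_dquad|exact: cp].
apply/eqP; rewrite -subr_eq0 opprK addrC -RintegralD//; [|exact: iE..].
rewrite Rintegral_mkcond [X in X == _](_ : _ = \int[leb2]_x F x); first by rewrite /Rintegral I0.
apply: eq_Rintegral => x _; rewrite patchE; case: ifPn => // /negP Ex.
have {}Ex : ~ E x by move=> h; apply: Ex; rewrite inE.
by rewrite /F (test_out tphi Ex) (test_partial_out i tphi Ex) !mulr0 addr0.
Qed.

Lemma quad_in_H10 : in_H10 E U dU.
Proof.
split.
  split; first exact/continuous_restrict_Ltwo/continuous_quad.
  by move=> i; split; [exact/continuous_restrict_Ltwo/continuous_dquad|exact: weak_partial_quad].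
exists cutoff; split; first exact: test_cutoff.
apply: poweR_half_cvg0.
  move=> n; apply: adde_ge0; first by rewrite expe_ge0 ?Lnorm_ge0.
  by apply: sume_ge0 => i _; rewrite expe_ge0 ?Lnorm_ge0.
have gen (f : nat -> R * R -> R) (c : R -> R) (w : R * R -> R) (B : R) :
    continuous c -> continuous w -> 0 <= B ->
    (forall s, `|c s| <= B) -> (forall s, 0 < s -> `|c s| <= B * s^-1) ->
    (forall n x, f n x = w x * c (step n x)) ->
    ('N[leb2]_2%:E[EFin \o (f n \_ E : plane R -> R)] ^+ 2)%E @[n --> \oo] --> 0%E.
  move=> cc cw B0 h1 h2 fE; have := cutoff_cvg cc cw B0 h1 h2.
  apply: cvg_trans; apply: near_eq_cvg; apply: nearW => n.
  rewrite Lnorm2_sqr [LHS]integral_mkcond; apply: eq_integral => x _; rewrite !patchE; case: ifP => _ /=; first by rewrite fE.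
  by rewrite expr0n.
have g0 : ('N[leb2]_2%:E[EFin \o ((cutoff n \- U)%R \_ E : plane R -> R)] ^+ 2)%E @[n --> \oo] --> 0%E.
  apply: (gen _ (fun s => flat_exp 0 s - 1) U 1) => //.
  - exact: continuous_flat_exp0_error.
  - exact: continuous_quad.
  - exact: flat_exp0_bound.
  - by move=> s s0; rewrite mul1r; exact: flat_exp0_near1.
  - by move=> n x; rewrite /cutoff /= mulrBr mulr1.
have g1 i : ('N[leb2]_2%:E[EFin \o ((partial i (cutoff n) \- dU i)%R \_ E : plane R -> R)] ^+ 2)%E @[n --> \oo] --> 0%E.
  apply: (gen _ cutoff_error (dU i) 6) => //.
  - exact: continuous_cutoff_error.
  - exact: continuous_dquad.
  - exact: cutoff_error_bound.
  - by move=> s s0; apply: le_trans (cutoff_error_near0 s0) _; apply: ler_wpM2r; [rewrite invr_ge0 ltW|rewrite ler_nat].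
  - by move=> n x; rewrite /= partial_cutoff addrC addKr.
have := sum3_cvg0 g0 (g1 ord0) (g1 (lift ord0 ord0)).
apply: cvg_trans; apply: near_eq_cvg; apply: nearW => n.
by rewrite big_ord_recl big_ord1.
Qed.

(** Green's formula, the Laplacian of U being -1. *)
Lemma quad_weak_form phi : test_function E phi ->
  \int[leb2]_(x in E) (\sum_(i < 2) dU i x * partial i phi x) = \int[leb2]_(x in E) phi x.
Proof.
move=> tphi.
have cp := test_continuous tphi; have cdp := test_partial_continuous tphi.
have dp i x : is_derive x (axis i) phi (partial i phi x) by apply: derivableP; exact: (test_derivable tphi).
pose F i x := ddquad a11 a22 i * phi x + dU i x * partial i phi x.
have hF i x : is_derive x (axis i) (fun x => dU i x * phi x) (F i x).
  exact: is_deriveMx (is_derive_dquad _ _ _ _ _ i x) (dp i x).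
have eF i : partial i (fun x => dU i x * phi x) = F i.
  by apply/funext => x; rewrite /partial; have [] := hF i x.
have cF i : continuous (F i).
  move=> x; apply: continuousDx; apply: continuousMx;
    [exact: continuous_cstx|exact: cp|exact: continuous_dquad|exact: cdp].
have vF i : vanishes_off_box (fun x => dU i x * phi x).
  by apply: off_boxW (test_vanishes tphi) => x ->; rewrite mulr0.
have I0 i : \int[leb2]_x F i x = 0.
  by rewrite /Rintegral -eF (@integral_partial0 _ _ i)// eF.
have iF i : leb2.-integrable setT (EFin \o (F i : plane R -> R)).
  apply: (integrable_off_box (cF i)); have := vanishes_partial i (vF i); by rewrite eF.
have ip : leb2.-integrable setT (EFin \o (phi : plane R -> R)).
  exact: (integrable_off_box cp (test_vanishes tphi)).
rewrite [RHS]Rintegral_mkcond (test_restrict tphi).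
have -> : \int[leb2]_x phi x = \int[leb2]_x (phi x + (F ord0 x + F ord_max x)).
  by rewrite (RintgD ip (intgD (iF ord0) (iF ord_max))) (RintgD (iF ord0) (iF ord_max)) !I0 !addr0.
rewrite Rintegral_mkcond; apply: eq_Rintegral => x _; rewrite patchE; case: ifPn => Ex.
  rewrite sum_ord2 /F /ddquad eqxx /=.
  have -> : 2 * a22 = -1 - 2 * a11 by rewrite -laplacian; ring.
  by ring.
have {}Ex : ~ E x by move: Ex; rewrite notin_setE.
by rewrite /F (test_out tphi Ex) !(test_partial_out _ tphi Ex) !mulr0 !addr0.
Qed.

End QuadraticIsTorsion.

Section TorsionalRigidity.
Context {R : realType}.
Variables (a0 a1 a2 a11 a12 a22 M : R).
Local Notation U := (quad a0 a1 a2 a11 a12 a22).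
Local Notation dU := (dquad a1 a2 a11 a12 a22).
Local Notation E := (positivity_set a0 a1 a2 a11 a12 a22).
Hypotheses (laplacian : 2 * a11 + 2 * a22 = -1) (M0 : 0 < M) (bE : E `<=` box M).

Let J := \int[leb2]_(x in E) U x.

Let J0 : 0 <= J.
Proof. by apply: Rintegral_ge0 => x; exact: ltW. Qed.

Lemma Lnorm1_Rintegral (f : plane R -> R) : leb2.-integrable setT (EFin \o f) ->
  ('N[leb2]_1%:E[EFin \o f] = (\int[leb2]_x `|f x|)%:E)%E.
Proof.
move=> fi; rewrite Lnorm1 /Rintegral fineK//.
by apply: integrable_fin_num => //; exact: integrable_norm fi.
Qed.

(** If Omega had no torsion function, torsion_function would be its default
    value 0, for which the bound is clear. *)
Lemma torsional_rigidity_le (Omega : set (R * R)) : measurable (Omega : set (plane R)) ->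
  Omega `<=` E -> (torsional_rigidity Omega <= J%:E)%E.
Proof.
move=> mO OE; rewrite /torsional_rigidity.
have [[v tv]|nv] := pselect (exists v, is_torsion_function Omega v).
  have : is_torsion_function Omega (torsion_function Omega) by exact: (xgetI (cst 0) tv).
  move=> [g ug weak].
  have [iv le] := torsion_norm1_le mO (subset_trans OE bE) laplacian M0 bE OE ug weak.
  by rewrite Lnorm1_Rintegral// lee_fin.
rewrite /torsion_function xgetPN; last by move=> v tv; apply: nv; exists v.
rewrite Lnorm1 (eq_integral (cst 0%E)) ?integral0 ?lee_fin//.
by move=> x _; rewrite /= patchE; case: ifP; rewrite normr0.
Qed.

(** Whatever torsion function v the choice operator picks, pairing the weak
    equations of U and v with each other shows that they have the same
    integral. *)
Lemma torsional_rigidity_quad : torsional_rigidity E = J%:E.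
Proof.
have mE : measurable (E : set (plane R)).
  exact: open_measurable_plane (@open_positivity_set R a0 a1 a2 a11 a12 a22).
apply/eqP; rewrite eq_le torsional_rigidity_le//=.
have hU := quad_in_H10 bE.
have tU : is_torsion_function E U by exists dU => // phi tphi; exact: (quad_weak_form laplacian tphi).
have : is_torsion_function E (torsion_function E) by exact: (xgetI (cst 0) tU).
rewrite /torsional_rigidity; move: (torsion_function E) => v [g vg weak].
have [iv _] := torsion_norm1_le mE bE laplacian M0 bE (@subset_refl _ _) vg weak.
rewrite Lnorm1_Rintegral// lee_fin.
have Lg i : (g i \_ E : plane R -> R) \in Lfun leb2 2%:E by have [[_ /(_ i)[]]] := vg.
have LU i : (dU i \_ E : plane R -> R) \in Lfun leb2 2%:E by have [[_ /(_ i)[]]] := hU.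
have e1 := weak_form_H10 mE bE vg LU (fun phi t => weak_form_restrict t (quad_weak_form laplacian t)).
have e2 := weak_form_H10 mE bE hU Lg (fun phi t => weak_form_restrict t (weak phi t)).
rewrite /J Rintegral_mkcond -e2.
rewrite (_ : \int[leb2]_x _ = \int[leb2]_x (v \_ E) x).
  by apply: le_trans (ler_norm _) _; exact: le_normr_Rintegral.
by rewrite -e1; apply: eq_Rintegral => x _; apply: eq_bigr => i _; rewrite mulrC.
Qed.

End TorsionalRigidity.

(** * Triangles in open convex sets *)
Lemma pair_ext (T1 T2 : Type) (x y : T1 * T2) : x.1 = y.1 -> x.2 = y.2 -> x = y.
Proof. by case: x y => [? ?] [? ?] /= -> ->. Qed.

Section OpenConvex.
Context {R : realType}.
Variable Omega : set (R * R).
Hypotheses (oO : open Omega) (cO : convex_set (Omega : set (convex_lmodType (R * R)%type))).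

Lemma convex_combination x y (t : R) : 0 <= t <= 1 -> Omega x -> Omega y -> Omega (t *: x + (1 - t) *: y).
Proof.
move=> /andP[t0 t1] Ox Oy.
have := @cO x y (Itv01 t0 t1); rewrite !inE; exact.
Qed.

(** Replacing k by a nearby k' in Omega can be compensated by moving o a
    little, within the open set. *)
Lemma half_open_segment o k (t : R) : Omega o -> closure Omega k -> 0 < t -> t <= 1 ->
  Omega (t *: o + (1 - t) *: k).
Proof.
move=> Oo Kk t0 t1.
pose f (k' : R * R) := o + (t^-1 * (1 - t)) *: (k - k').
have cf : f k' @[k' --> k] --> o.
  rewrite -[X in _ --> X](_ : f k = o); last by rewrite /f subrr scaler0 addr0.
  apply: cvgD; first exact: cvg_cst.
  by apply: cvgZl_tmp; apply: cvgB; [exact: cvg_cst|exact: cvg_id].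
have nO : nbhs o Omega by exact: open_nbhs_nbhs.
have [k' [Ok' Of]] := Kk _ (cf _ nO).
have := convex_combination _ Of Ok'; move/(_ t).
rewrite (_ : t *: f k' + (1 - t) *: k' = t *: o + (1 - t) *: k).
  by apply; rewrite ltW.
rewrite /f scalerDr scalerA mulVKf ?gt_eqF// scalerBr -addrA; congr (_ + _).
by rewrite subrK.
Qed.

Lemma convex_combination3 x y z (a b : R) : 0 < a -> 0 < b -> a + b < 1 ->
  Omega x -> Omega y -> Omega z -> Omega ((1 - a - b) *: x + a *: y + b *: z).
Proof.
move=> a0 b0 ab Ox Oy Oz.
have h : Omega ((a / (a + b)) *: y + (1 - a / (a + b)) *: z).
  apply: convex_combination => //; rewrite divr_ge0 ?addr_ge0 ?ltW//=.
  by rewrite ltr_pdivrMr ?addr_gt0// mul1r ltrDl.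
have := @convex_combination x _ (1 - a - b) _ Ox h.
rewrite (_ : 1 - (1 - a - b) = a + b); last by ring.
rewrite scalerDr !scalerA [_ *: x + (_ + _)]addrA (_ : (a + b) * (a / (a + b)) = a); last by field; rewrite gt_eqF// addr_gt0.
rewrite (_ : (a + b) * (1 - a / (a + b)) = b); last by field; rewrite gt_eqF// addr_gt0.
by apply; apply/andP; split; lra.
Qed.

(** The vertices are moved slightly towards a point o of Omega, which brings them
    into Omega; a point of the open triangle stays inside the smaller triangle.
    The affine coordinates of o are given, as the triangle might be degenerate. *)
Lemma open_triangle x y z o (u w a b : R) : Omega o -> o = (1 - u - w) *: x + u *: y + w *: z ->
  closure Omega x -> closure Omega y -> closure Omega z ->
  0 < a -> 0 < b -> a + b < 1 -> Omega ((1 - a - b) *: x + a *: y + b *: z).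
Proof.
move=> Oo oE Kx Ky Kz a0 b0 ab.
pose m := Num.min a (Num.min b (1 - a - b)).
have m0 : 0 < m by rewrite !lt_min a0 b0/=; lra.
have [ma mb mc] : [/\ m <= a, m <= b & m <= 1 - a - b].
  by rewrite /m !ge_min !lexx !orbT.
(* Up to a positive factor, the coordinates with respect to the new vertices
   are a - e u, b - e w and (1 - a - b) - e (1 - u - w). *)
pose N := 2 + `|u| + `|w|.
have N0 : 0 < N by rewrite /N ltr_wpDr// ltr_wpDr.
pose e := m / N.
have e0 : 0 < e by rewrite divr_gt0.
have eN : e * N = m by rewrite divfK// gt_eqF.
have [nu nw] : 0 <= `|u| /\ 0 <= `|w| by [].
have eu : e * u <= e * `|u| by rewrite ler_pM2l// ler_norm.
have ew : e * w <= e * `|w| by rewrite ler_pM2l// ler_norm.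
have eu' : - (e * u) <= e * `|u| by rewrite -mulrN ler_pM2l// -normrN ler_norm.
have ew' : - (e * w) <= e * `|w| by rewrite -mulrN ler_pM2l// -normrN ler_norm.
have pu : 0 <= e * `|u| by rewrite mulr_ge0// ltW.
have pw : 0 <= e * `|w| by rewrite mulr_ge0// ltW.
have eN' : 2 * e + e * `|u| + e * `|w| = m by rewrite -eN /N; ring.
have e1 : e < 1 by lra.
have d0 : 0 < 1 - e by lra.
have seg v : closure Omega v -> Omega (e *: o + (1 - e) *: v).
  by move=> Kv; apply: half_open_segment => //; exact: ltW.
have := @convex_combination3 _ _ _ ((a - e * u) / (1 - e)) ((b - e * w) / (1 - e)) _ _ _
  (seg _ Kx) (seg _ Ky) (seg _ Kz).
rewrite -mulrDl ltr_pdivrMr// mul1r !divr_gt0//; [|lra..].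
move=> /(_ isT isT); rewrite (_ : _ < _ = true); last by apply/idP; lra.
move=> /(_ isT); congr (Omega _).
have ne : 1 - e != 0 by rewrite gt_eqF.
by rewrite oE; apply: pair_ext; rewrite /GRing.scale /= /GRing.scale /=; clear -ne; clearbody e; field.
Qed.

End OpenConvex.

Section TriangleArea.
Context {R : realType}.

(** The domain of the coordinates of an open triangle with respect to two of its
    vertices. *)
Definition half_square : set (R * R) := [set x | 0 < x.1 /\ 0 < x.2 /\ x.1 + x.2 < 1].

Lemma measurable_half_square : measurable (half_square : set (plane R)).
Proof.
apply: open_measurable_plane.
have -> : half_square = (fst @^-1` `]0, +oo[) `&` ((snd @^-1` `]0, +oo[) `&`
    ((fun x => x.1 + x.2) @^-1` `]-oo, (1 : R)[)).
  by apply/seteqP; split => x; rewrite /half_square /= !in_itv/= !andbT.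
apply: openI; first by apply: open_comp; [move=> x _; exact: fst_continuous|exact: interval_open].
apply: openI; first by apply: open_comp; [move=> x _; exact: snd_continuous|exact: interval_open].
apply: open_comp; last exact: interval_open.
by move=> x _; apply: continuousDx; [exact: fst_continuous|exact: snd_continuous].
Qed.

Let flip (x : plane R) : plane R := (1 - x.1, 1 - x.2).

Let scales_area_flip : scales_area 1 flip.
Proof.
have cs : (-1 : R) ^+ 2 + 0 ^+ 2 = 1 by rewrite sqrrN expr1n expr0n addr0.
have := scales_area_comp (scales_area_rot cs) (scales_area_box (-1) (-1) ltr01 ltr01).
rewrite !mul1r; apply: scales_area_ext => x.
by rewrite /flip /=; congr pair; rewrite !mul0r divr1; ring.
Qed.

Let antidiagonal : set (plane R) := [set x | x.2 + 1 * x.1 = 1].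

Let leb2_antidiagonal : leb2 antidiagonal = 0%E.
Proof.
have [_ h] := scales_area_shear2 (1 : R).
have m1 : measurable ([set 1] : set (measurableTypeR R)) by exact: measurable_set1.
have -> : antidiagonal = (fun x : plane R => (x.1, x.2 + 1 * x.1) : plane R) @^-1` (setT `*` [set 1]).
  by apply/seteqP; split => x; [move=> ?; split|case].
rewrite h; last by apply: measurableX.
by rewrite leb2_rect// lebesgue_measure_set1 !mule0.
Qed.

(** The unit square is covered by the triangle, its image under a half turn and
    the antidiagonal, which is negligible. *)
Lemma leb2_half_square : ((2^-1)%:E <= leb2 (half_square : set (plane R)))%E.
Proof.
have mH := measurable_half_square.
have mF : measurable (flip @^-1` half_square).
  by rewrite -[X in measurable X]setTI; apply: (proj1 scales_area_flip).
have mD : measurable antidiagonal.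
  rewrite (_ : antidiagonal = (fun x : plane R => x.2 + 1 * x.1) @^-1` [set 1]); last by [].
  rewrite -[X in measurable X]setTI.
  have h : measurable_fun setT (fun x : plane R => x.2 + 1 * x.1).
    by apply: measurable_funD => //; exact: measurable_funM.
  by apply: h => //; exact: measurable_set1.
have F : leb2 (flip @^-1` half_square) = leb2 (half_square : set (plane R)).
  by have [_ ->] := scales_area_flip; rewrite ?mul1e.
have : (1%:E <= leb2 (half_square : set (plane R)) + leb2 (half_square : set (plane R)))%E.
  pose sq : set (plane R) := `]0, 1[%classic `*` `]0, 1[%classic.
  have -> : 1%:E = leb2 sq.
    rewrite leb2_rect; [|exact: measurable_itv..].
    by rewrite !lebesgue_measure_itv /= lte_fin ltr01 -EFinD -EFinM subr0 mulr1.
  apply: (@le_trans _ _ (leb2 ((half_square : set (plane R)) `|` ((flip @^-1` half_square) `|` antidiagonal)))).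
    apply: le_measure; rewrite ?inE.
    - by apply: measurableX; exact: measurable_itv.
    - by apply: measurableU => //; exact: measurableU.
    - move=> x [] /=; rewrite !in_itv/= => /andP[? ?] /andP[? ?].
      have [h|h|h] := ltgtP (x.1 + x.2) 1.
      + by left.
      + by right; left; rewrite /flip /half_square /=; split; [lra|split; lra].
      + by right; right; rewrite /antidiagonal /= mul1r addrC.
  apply: le_trans (measureU2 _ _ _) _ => //; first exact: measurableU.
  rewrite leeD2l//; apply: le_trans (measureU2 _ _ _) _ => //.
  have f1 : (leb2 (flip @^-1` half_square) <= leb2 (half_square : set (plane R)))%E by rewrite F.
  have f2 : (leb2 antidiagonal <= 0)%E by rewrite leb2_antidiagonal.
  by apply: le_trans (leeD f1 f2) _; rewrite adde0.
case: (leb2 _) => [r| |]; rewrite ?leey// -EFinD !lee_fin; lra.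
Qed.

Variable Omega : set (R * R).
Hypotheses (oO : open Omega) (cO : convex_set (Omega : set (convex_lmodType (R * R)%type))).

Definition halfplane (c s k : R) : set (R * R) := [set x | k < c * x.2 - s * x.1].

Lemma measurable_halfplane (c s k : R) : measurable (halfplane c s k : set (plane R)).
Proof.
rewrite (_ : halfplane c s k = (fun x : plane R => c * x.2 - s * x.1) @^-1` `]k, +oo[%classic).
  rewrite -[X in measurable X]setTI.
  have h : measurable_fun setT (fun x : plane R => c * x.2 - s * x.1).
    by apply: measurable_funB => //; exact: measurable_funM.
  by apply: h => //; exact: measurable_itv.
by apply/seteqP; split => x; rewrite /halfplane /= in_itv/= andbT.
Qed.

(** The open triangle A B D lies in Omega, on one side of the line A B. With
    (c, s) the direction from A to B and h the height of D over that line, the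
    map N reads the barycentric coordinates of B and D; it multiplies areas of
    preimages by d h. *)
Lemma triangle_area_le (c s d h : R) (A B D : R * R) : Omega !=set0 ->
  c ^+ 2 + s ^+ 2 = 1 -> 0 < d ->
  closure Omega A -> closure Omega B -> closure Omega D ->
  B.1 = A.1 + d * c -> B.2 = A.2 + d * s ->
  h = (c * D.2 - s * D.1) - (c * A.2 - s * A.1) -> 0 <= h ->
  ((d * h / 2)%:E <= leb2 ((Omega `&` halfplane c s (c * A.2 - s * A.1)%R) : set (plane R)))%E.
Proof.
move=> [z0 Oz0] cs d0 KA KB KD B1 B2 hE; rewrite le_eqVlt => /orP[/eqP <-|h0].
  by rewrite mulr0 mul0r.
pose XD := c * (D.1 - A.1) + s * (D.2 - A.2).
pose p := c * A.1 + s * A.2; pose q := c * A.2 - s * A.1.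
pose N (x : plane R) : plane R :=
  ((c * x.1 + s * x.2 - p) / d + - (XD / d) * ((c * x.2 - s * x.1 - q) / h), (c * x.2 - s * x.1 - q) / h).
have sN : scales_area (d * h) N.
  have := scales_area_comp (scales_area_comp (scales_area_rot cs) (scales_area_box p q d0 h0))
    (scales_area_shear1 (- (XD / d))).
  by rewrite mul1r mulr1; exact: scales_area_ext.
have bary x : x = (1 - (N x).1 - (N x).2) *: A + (N x).1 *: B + (N x).2 *: D.
  have dn : d != 0 by rewrite gt_eqF.
  have hn : h != 0 by rewrite gt_eqF.
  have D1 : D.1 = A.1 + c * XD - s * h.
    transitivity (A.1 + (c ^+ 2 + s ^+ 2) * (D.1 - A.1)); first by rewrite cs; ring.
    by rewrite hE /XD; ring.
  have D2 : D.2 = A.2 + s * XD + c * h.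
    transitivity (A.2 + (c ^+ 2 + s ^+ 2) * (D.2 - A.2)); first by rewrite cs; ring.
    by rewrite hE /XD; ring.
  apply: pair_ext; rewrite /GRing.scale /= /GRing.scale /= /p /q.
    rewrite B1 D1; transitivity (A.1 + (c ^+ 2 + s ^+ 2) * (x.1 - A.1)); first by rewrite cs; ring.
    by field; rewrite dn hn.
  rewrite B2 D2; transitivity (A.2 + (c ^+ 2 + s ^+ 2) * (x.2 - A.2)); first by rewrite cs; ring.
  by field; rewrite dn hn.
have [mN kN] := sN.
have mT : measurable (N @^-1` half_square).
  by rewrite -[X in measurable X]setTI; apply: mN => //; exact: measurable_half_square.
apply: (@le_trans _ _ (leb2 (N @^-1` half_square))).
  rewrite kN; last exact: measurable_half_square.
  by rewrite EFinM lee_pmul2l ?lte_fin ?mulr_gt0//; exact: leb2_half_square.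
apply: le_measure; rewrite ?inE//.
  exact: measurableI (open_measurable_plane oO) (measurable_halfplane _ _ _).
move=> x [/= x1 [x2 x12]]; split.
  rewrite (bary x); exact: open_triangle Oz0 (bary z0) KA KB KD x1 x2 x12.
by move: x2; rewrite pmulr_lgt0 ?invr_gt0// subr_gt0.
Qed.

End TriangleArea.

(** * Ellipses in a frame and the unit disc *)
Section UnitDisc.
Context {R : realType}.

Definition sqnorm (x : R * R) : R := x.1 ^+ 2 + x.2 ^+ 2.

Definition unit_disc : set (R * R) := [set x | sqnorm x < 1].

Lemma disc_sqnorm (c : R * R) r : 0 < r -> disc c r = [set x | sqnorm (x - c) < r ^+ 2].
Proof.
move=> r0; apply/seteqP; split => x; rewrite /disc /edist /sqnorm /= => h.
  move: h; rewrite -(ltr_pXn2r (isT : (0 < 2)%N)) ?nnegrE ?sqrtr_ge0 ?ltW//.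
  by rewrite sqr_sqrtr ?addr_ge0 ?sqr_ge0//; apply: le_lt_trans; nra.
rewrite -(ltr_pXn2r (isT : (0 < 2)%N)) ?nnegrE ?sqrtr_ge0 ?ltW//.
rewrite sqr_sqrtr ?addr_ge0 ?sqr_ge0//; apply: le_lt_trans h; nra.
Qed.

Lemma unit_disc_box : unit_disc `<=` box 1.
Proof.
move=> x; rewrite /unit_disc /sqnorm /= => h; split; rewrite /= in_itv/=; apply/andP; split; nra.
Qed.

Lemma continuous_sqnorm : continuous sqnorm.
Proof.
move=> x; have c1 := @fst_continuous R x; have c2 := @snd_continuous R x.
exact: (continuousDx (continuousMx c1 c1) (continuousMx c2 c2)).
Qed.

Lemma open_unit_disc : open unit_disc.
Proof.
rewrite (_ : unit_disc = sqnorm @^-1` `]-oo, 1[%classic).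
  by apply: open_comp; [move=> x _; exact: continuous_sqnorm|exact: interval_open].
by apply/seteqP; split => x; rewrite /unit_disc /= in_itv.
Qed.

Lemma measurable_unit_disc : measurable (unit_disc : set (plane R)).
Proof. exact: open_measurable_plane open_unit_disc. Qed.

Definition disc_area : R := fine (leb2 (unit_disc : set (plane R))).

(** Four times the torsional rigidity of the unit disc. *)
Definition disc_moment : R := \int[leb2]_(x in unit_disc) (1 - sqnorm x).

Lemma leb2_unit_disc_le4 : (leb2 (unit_disc : set (plane R)) <= 4%:E)%E.
Proof.
apply: (@le_trans _ _ (leb2 (box 1 : set (plane R)))).
  by apply: le_measure; rewrite ?inE; [exact: measurable_unit_disc|exact: measurable_box|exact: unit_disc_box].
rewrite leb2_rect; [|exact: measurable_itv..].
rewrite !lebesgue_measure_itv /= lte_fin ifT; last by lra.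
by rewrite -!EFinD -EFinM lee_fin; lra.
Qed.

Lemma leb2_unit_discE : leb2 (unit_disc : set (plane R)) = disc_area%:E.
Proof.
by rewrite /disc_area fineK// ge0_fin_numE// (le_lt_trans leb2_unit_disc_le4)// ltry.
Qed.

Lemma disc_area_le4 : disc_area <= 4.
Proof. by rewrite -lee_fin -leb2_unit_discE leb2_unit_disc_le4. Qed.

Let sq : set (plane R) := `[0, 2^-1]%classic `*` `[0, 2^-1]%classic.

Let measurable_sq : measurable sq.
Proof. by apply: measurableX; exact: measurable_itv. Qed.

Let leb2_sq : leb2 sq = (4^-1)%:E.
Proof.
rewrite leb2_rect; [|exact: measurable_itv..].
rewrite !lebesgue_measure_itv /= lte_fin invr_gt0 ltr0n/= -EFinD -EFinM; congr EFin; lra.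
Qed.

Let sq_disc x : sq x -> sqnorm x <= 2^-1.
Proof. move=> [] /=; rewrite !in_itv/= /sqnorm => /andP[? ?] /andP[? ?]; nra. Qed.

Lemma disc_area_gt0 : 0 < disc_area.
Proof.
rewrite -lte_fin -leb2_unit_discE; apply: (@lt_le_trans _ _ (leb2 sq)).
  by rewrite leb2_sq lte_fin invr_gt0.
apply: le_measure; rewrite ?inE//; first exact: measurable_unit_disc.
by move=> x /sq_disc; rewrite /unit_disc /= => h; apply: le_lt_trans h _; lra.
Qed.

Lemma disc_moment_gt0 : 0 < disc_moment.
Proof.
have cf : continuous (fun x : R * R => 1 - sqnorm x).
  by move=> x; apply: cvgB; [exact: cvg_cst|exact: continuous_sqnorm].
have id := integrable_box cf measurable_unit_disc unit_disc_box.
rewrite -lte_fin /disc_moment /Rintegral fineK; last exact: (integrable_fin_num measurable_unit_disc id).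
apply: (@lt_le_trans _ _ (\int[leb2]_(x in sq) (2^-1)%:E)%E).
  by rewrite integral_cst// leb2_sq -EFinM lte_fin; lra.
apply: (@le_trans _ _ (\int[leb2]_(x in sq) (1 - sqnorm x)%:E)%E).
  apply: ge0_le_integral => //.
  - by apply/measurable_EFinP; have h := continuous_measurable_plane cf; exact: measurable_funTS.
  - by move=> x /sq_disc; rewrite lee_fin; lra.
apply: ge0_subset_integral => //.
- exact: measurable_unit_disc.
- by apply/measurable_EFinP; have h := continuous_measurable_plane cf; exact: measurable_funTS.
- by move=> x; rewrite /unit_disc /= lee_fin subr_ge0 => /ltW.
- by move=> x /sq_disc; rewrite /unit_disc /= => h; apply: le_lt_trans h _; lra.
Qed.

End UnitDisc.

Section FramedEllipse.
Context {R : realType}.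
Variables (c s p q b1 b2 : R).
Hypotheses (cs : c ^+ 2 + s ^+ 2 = 1) (b1_gt0 : 0 < b1) (b2_gt0 : 0 < b2).

(** Coordinates in the frame with first axis (c, s), the centre of the ellipse
    having coordinates (p, q) in the rotated, uncentred frame. *)
Definition frame (x : R * R) : R * R := (c * x.1 + s * x.2 - p, c * x.2 - s * x.1 - q).

Definition normalise (x : R * R) : R * R := ((frame x).1 / b1, (frame x).2 / b2).

Definition framed_ellipse : set (R * R) := [set x | sqnorm (normalise x) < 1].

Lemma scales_area_normalise : scales_area (b1 * b2) (normalise : plane R -> plane R).
Proof.
rewrite -[b1 * b2]mul1r.
exact: scales_area_comp (scales_area_rot cs) (scales_area_box p q b1_gt0 b2_gt0).
Qed.

(* Half the inverse of u + v below; it normalises the Laplacian of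
   k (1 - sqnorm (normalise x)) to -1. *)
Let k : R := b1 ^+ 2 * b2 ^+ 2 / (2 * (b1 ^+ 2 + b2 ^+ 2)).
Let u : R := b1 ^- 2.
Let v : R := b2 ^- 2.

Let k_gt0 : 0 < k.
Proof. by rewrite divr_gt0 ?mulr_gt0 ?addr_gt0 ?exprn_gt0. Qed.

Let kuv : k * (u + v) = 2^-1.
Proof.
rewrite /k /u /v; field; rewrite !gt_eqF//; exact: addr_gt0 (exprn_gt0 _ _) (exprn_gt0 _ _).
Qed.

Let a0 := k * (1 - p ^+ 2 * u - q ^+ 2 * v).
Let a1 := 2 * k * (p * c * u - q * s * v).
Let a2 := 2 * k * (p * s * u + q * c * v).
Let a11 := - k * (c ^+ 2 * u + s ^+ 2 * v).
Let a12 := - 2 * k * (c * s * u - c * s * v).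
Let a22 := - k * (s ^+ 2 * u + c ^+ 2 * v).

Let laplacian : 2 * a11 + 2 * a22 = -1.
Proof.
transitivity (- 2 * (c ^+ 2 + s ^+ 2) * (k * (u + v))); first by rewrite /a11 /a22; ring.
by rewrite cs kuv; lra.
Qed.

Let quadE x : quad a0 a1 a2 a11 a12 a22 x = k * (1 - sqnorm (normalise x)).
Proof.
rewrite /quad /a0 /a1 /a2 /a11 /a12 /a22 /sqnorm /normalise /= !exprMn !exprVn -/u -/v.
ring.
Qed.

Let ellipseE : framed_ellipse = positivity_set a0 a1 a2 a11 a12 a22.
Proof.
by apply/seteqP; split => x; rewrite /positivity_set /framed_ellipse /= quadE pmulr_rgt0// subr_gt0.
Qed.

Definition ellipse_radius : R := b1 + `|p| + (b2 + `|q|).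

Lemma ellipse_radius_gt0 : 0 < ellipse_radius.
Proof. by rewrite addr_gt0// ltr_pwDl. Qed.

Lemma frame_sqnorm x : sqnorm x = ((frame x).1 + p) ^+ 2 + ((frame x).2 + q) ^+ 2.
Proof.
rewrite -[LHS]mul1r -cs /sqnorm /frame /=; ring.
Qed.

Lemma frame_isometry x y : edist (frame x) (frame y) = edist x y.
Proof.
rewrite /edist /frame /=; congr (Num.sqrt _).
by rewrite -[RHS]mul1r -cs; ring.
Qed.

Lemma framed_ellipse_box : framed_ellipse `<=` box ellipse_radius.
Proof.
move=> x h0; have h : ((frame x).1 / b1) ^+ 2 + ((frame x).2 / b2) ^+ 2 < 1 := h0.
have y1 : `|(frame x).1| <= b1.
  apply: normr_le_sqr; first exact: ltW.
  rewrite -[leRHS]mul1r -ler_pdivrMr ?exprn_gt0//.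
  by rewrite -expr_div_n; have := sqr_ge0 ((frame x).2 / b2); lra.
have y2 : `|(frame x).2| <= b2.
  apply: normr_le_sqr; first exact: ltW.
  rewrite -[leRHS]mul1r -ler_pdivrMr ?exprn_gt0//.
  by rewrite -expr_div_n; have := sqr_ge0 ((frame x).1 / b1); lra.
have n1 : `|(frame x).1 + p| <= b1 + `|p| by apply: le_trans (ler_normD _ _) _; rewrite lerD2r.
have n2 : `|(frame x).2 + q| <= b2 + `|q| by apply: le_trans (ler_normD _ _) _; rewrite lerD2r.
have N : sqnorm x <= ellipse_radius ^+ 2.
  rewrite frame_sqnorm -(real_normK (num_real (_ + p))) -(real_normK (num_real (_ + q))) /ellipse_radius.
  have := normr_ge0 ((frame x).1 + p); have := normr_ge0 ((frame x).2 + q); nra.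
have r0 := ellipse_radius_gt0.
have xi z : z ^+ 2 <= ellipse_radius ^+ 2 -> `[- ellipse_radius, ellipse_radius]%classic z.
  by move=> hz; rewrite /= in_itv/= -ler_norml; apply: normr_le_sqr => //; exact: ltW.
split; apply: xi; apply: le_trans N; rewrite /sqnorm; first by rewrite lerDl sqr_ge0.
by rewrite lerDr sqr_ge0.
Qed.

Let bE : positivity_set a0 a1 a2 a11 a12 a22 `<=` box ellipse_radius.
Proof. by rewrite -ellipseE; exact: framed_ellipse_box. Qed.

Lemma measurable_framed_ellipse : measurable (framed_ellipse : set (plane R)).
Proof.
rewrite ellipseE; exact: open_measurable_plane (@open_positivity_set R a0 a1 a2 a11 a12 a22).
Qed.

Lemma framed_ellipse_area : leb2 (framed_ellipse : set (plane R)) = (b1 * b2 * disc_area)%:E.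
Proof.
have [_ h] := scales_area_normalise.
by rewrite EFinM -leb2_unit_discE -(h unit_disc)//; exact: measurable_unit_disc.
Qed.

Let moment : \int[leb2]_(x in positivity_set a0 a1 a2 a11 a12 a22) quad a0 a1 a2 a11 a12 a22 x
  = b1 * b2 * k * disc_moment.
Proof.
have cf : continuous (fun x : R * R => 1 - sqnorm x).
  by move=> x; apply: cvgB; [exact: cvg_cst|exact: continuous_sqnorm].
have mf : measurable_fun (unit_disc : set (plane R)) ((fun x => (1 - sqnorm x)%:E) : plane R -> \bar R).
  by apply/measurable_EFinP; have h := continuous_measurable_plane cf; exact: measurable_funTS.
have f0 (x : plane R) : unit_disc x -> (0 <= (1 - sqnorm x)%:E)%E.
  by rewrite /unit_disc /= lee_fin subr_ge0 => /ltW.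
have k0 : 0 <= b1 * b2 by rewrite mulr_ge0 ?ltW.
have h := integral_scales_area k0 scales_area_normalise measurable_unit_disc mf f0.
have id : leb2.-integrable unit_disc (EFin \o ((fun x => 1 - sqnorm x) : plane R -> R)).
  exact: integrable_box cf measurable_unit_disc unit_disc_box.
rewrite -ellipseE; transitivity (k * \int[leb2]_(x in framed_ellipse) (1 - sqnorm (normalise x))).
  rewrite -RintegralZl//; last first.
  - apply: (@integrable_box _ (fun x => 1 - sqnorm (normalise x)) ellipse_radius);
      [|exact: measurable_framed_ellipse|exact: framed_ellipse_box].
    have <- : quad (k^-1 * a0) (k^-1 * a1) (k^-1 * a2) (k^-1 * a11) (k^-1 * a12) (k^-1 * a22) =
        (fun x => 1 - sqnorm (normalise x)).
      apply/funext => x; transitivity (k^-1 * quad a0 a1 a2 a11 a12 a22 x); first by rewrite /quad; ring.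
      by rewrite quadE mulKf// gt_eqF.
    exact: continuous_quad.
  - exact: measurable_framed_ellipse.
  by apply: eq_Rintegral => x _; rewrite quadE.
rewrite /disc_moment mulrC mulrAC; congr (_ * _); rewrite /Rintegral.
rewrite (_ : framed_ellipse = normalise @^-1` unit_disc)// h -[X in fine (_ * X)]fineK ?fineM//.
all: exact: (integrable_fin_num measurable_unit_disc id).
Qed.

Lemma framed_ellipse_rigidity_le (Omega : set (R * R)) : measurable (Omega : set (plane R)) ->
  Omega `<=` framed_ellipse ->
  (torsional_rigidity Omega <= (b1 * b2 * k * disc_moment)%:E)%E.
Proof.
rewrite ellipseE -moment => mO OE.
exact: (torsional_rigidity_le laplacian ellipse_radius_gt0 bE mO OE).
Qed.

Lemma framed_ellipse_rigidity : torsional_rigidity framed_ellipse = (b1 * b2 * k * disc_moment)%:E.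
Proof. by rewrite ellipseE -moment; exact: (torsional_rigidity_quad laplacian ellipse_radius_gt0 bE). Qed.

Lemma closure_framed_ellipse : closure framed_ellipse `<=` [set x | sqnorm (normalise x) <= 1].
Proof.
set S := [set _ | _].
have SE : S = quad a0 a1 a2 a11 a12 a22 @^-1` [set y | 0 <= y].
  by apply/seteqP; split => x; rewrite /S /= quadE pmulr_rge0// subr_ge0.
have cS : closed S.
  by rewrite SE; apply: preimage_closed; [move=> x _; exact: continuous_quad|exact: closed_ge].
rewrite [X in _ `<=` X]((closure_id S).1 cS); apply: closureS => x.
by rewrite /framed_ellipse /S /=; exact: ltW.
Qed.

Lemma framed_ellipse_capacity_le (Omega : set (R * R)) : Omega `<=` framed_ellipse ->
  (log_capacity (closure Omega) <= ((b1 + b2) / 2)%:E)%E.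
Proof.
move=> OE; apply: (@log_capacity_ellipse_le _ _ b1 b2 frame) => //.
- have h := @closed_measurable_plane _ (closure Omega); apply: h; exact: closed_closure.
- exact: frame_isometry.
- move=> x /(closureS OE)/closure_framed_ellipse.
  by rewrite /sqnorm /normalise /= !expr_div_n.
Qed.

End FramedEllipse.

(** * The functional on ellipses and discs *)
Section FunctionalBounds.
Context {R : realType}.

(** The common value of the functional on all discs. *)
Definition disc_value : R := Num.sqrt (disc_moment / 4) / disc_area `^ (3 / 2).

Lemma H_functionalE (Omega : set (R * R)) (t a v : R) : 0 <= t -> 0 < v ->
  torsional_rigidity Omega = t%:E -> log_capacity (closure Omega) = a%:E ->
  leb2 (Omega : set (plane R)) = v%:E ->
  H_functional Omega = (Num.sqrt t * a / v `^ (3 / 2))%:E.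
Proof.
move=> t0 v0 hT hC hv; rewrite /H_functional hT hC hv poweR12_sqrt ?lee_fin//=.
by rewrite inver gt_eqF ?powR_gt0// -!EFinM.
Qed.

Lemma H_functional_le (Omega : set (R * R)) (t a v : R) : 0 <= t -> 0 <= a -> 0 < v ->
  (torsional_rigidity Omega <= t%:E)%E -> (log_capacity (closure Omega) <= a%:E)%E ->
  leb2 (Omega : set (plane R)) = v%:E ->
  (H_functional Omega <= (Num.sqrt t * a / v `^ (3 / 2))%:E)%E.
Proof.
move=> t0 a0 v0 hT hC hv.
have T0 : (0 <= torsional_rigidity Omega)%E by exact: Lnorm_ge0.
have C0 : (0 <= log_capacity (closure Omega))%E by exact: expeR_ge0.
case eT : (torsional_rigidity Omega) hT T0 => [t'| |]; rewrite ?leNye_eq ?leye_eq// !lee_fin => t't t'0.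
case eC : (log_capacity (closure Omega)) hC C0 => [a'| |]; rewrite ?leye_eq// !lee_fin => a'a a'0.
rewrite (H_functionalE t'0 v0 eT eC hv) lee_fin.
by rewrite ler_wpM2r ?invr_ge0 ?powR_ge0// ler_pM ?sqrtr_ge0// ler_wsqrtr.
Qed.

Lemma sqr_le_of_sqrt (x y : R) : 0 <= x -> x ^+ 2 <= y -> x <= Num.sqrt y.
Proof. by move=> x0 h; rewrite -[x]ger0_norm// -sqrtr_sqr ler_wsqrtr. Qed.

(** The upper bound obtained for an ellipse with semi-axes b1 and b2, as a
    fraction of the value of a disc; it comes from the bound (b1 + b2) / 2 of
    the capacity and from a torsional rigidity proportional to
    b1^3 b2^3 / (b1^2 + b2^2). *)
Definition eccentricity_factor (b1 b2 : R) : R :=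
  (b1 + b2) / (Num.sqrt 2 * Num.sqrt (b1 ^+ 2 + b2 ^+ 2)).

Lemma powR32 (x : R) : 0 <= x -> x `^ (3 / 2) = Num.sqrt x * x.
Proof.
rewrite le_eqVlt => /orP[/eqP <-|x0]; first by rewrite mulr0 powR0// gt_eqF// divr_gt0.
have -> : 3 / 2 = 2^-1 + 1 :> R by field.
by rewrite powRD ?gt_eqF ?implybT// powRr1 ?ltW// powR12_sqrt// ltW.
Qed.

Lemma ellipse_value (b1 b2 v : R) : 0 < b1 -> 0 < b2 -> 0 < v ->
  Num.sqrt (b1 * b2 * (b1 ^+ 2 * b2 ^+ 2 / (2 * (b1 ^+ 2 + b2 ^+ 2))) * disc_moment)
    * ((b1 + b2) / 2) / v `^ (3 / 2)
  = disc_value * eccentricity_factor b1 b2 * (b1 * b2 * disc_area / v) `^ (3 / 2).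
Proof.
move=> b10 b20 v0; have m0 := @disc_area_gt0 R; have J0 := @disc_moment_gt0 R.
have B0 : 0 < b1 * b2 by exact: mulr_gt0.
have N0 : 0 < b1 ^+ 2 + b2 ^+ 2 by rewrite addr_gt0 ?exprn_gt0.
rewrite /disc_value /eccentricity_factor.
have -> : (b1 * b2 * disc_area / v) `^ (3 / 2) = (b1 * b2) `^ (3 / 2) * disc_area `^ (3/2) / v `^ (3 / 2).
  rewrite powRM ?powRM ?mulr_ge0 ?invr_ge0 ?ltW//; congr (_ * _).
  by rewrite -powR_inv1 ?ltW// -powRrM mulN1r powRN.
have -> : b1 * b2 * (b1 ^+ 2 * b2 ^+ 2 / (2 * (b1 ^+ 2 + b2 ^+ 2))) * disc_moment =
   (b1 * b2) ^+ 2 * (b1 * b2 * disc_moment / (2 * (b1 ^+ 2 + b2 ^+ 2))).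
  by field; rewrite gt_eqF.
rewrite sqrtrM ?sqr_ge0// sqrtr_sqr ger0_norm ?ltW// sqrtrM ?mulr_ge0 ?ltW//.
rewrite sqrtrV ?mulr_ge0 ?ltW// !sqrtrM ?ltW// ?mulr_ge0 ?ltW// (powR32 (ltW B0)).
rewrite sqrtrM ?ltW// sqrtrV// (_ : Num.sqrt 4 = 2); last first.
  by rewrite (_ : 4 = 2 ^+ 2) ?sqrtr_sqr ?ger0_norm// -natrX.
have s2 : Num.sqrt 2 != 0 :> R by rewrite gt_eqF ?sqrtr_gt0.
have sN : Num.sqrt (b1 ^+ 2 + b2 ^+ 2) != 0 by rewrite gt_eqF ?sqrtr_gt0.
have pm : disc_area `^ (3 / 2) != 0 :> R by rewrite gt_eqF ?powR_gt0.
have pv : v `^ (3 / 2) != 0 by rewrite gt_eqF ?powR_gt0.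
by field; rewrite pm pv s2 sN.
Qed.

End FunctionalBounds.

(** * An ellipse around a convex set *)
Section CircumscribedEllipse.
Context {R : realType}.
Variable Omega : set (R * R).
Hypotheses (oO : open Omega) (cO : convex_set (Omega : set (convex_lmodType (R * R)%type))).
Hypotheses (O0 : Omega !=set0) (bO : bounded_set Omega).

(** Makes inequalities valid on the closure strict on Omega. *)
Lemma open_moves x v : Omega x -> exists2 e : R, 0 < e & Omega (x + e *: v) /\ Omega (x - e *: v).
Proof.
move=> Ox; have cf : (x + t *: v) @[t --> (0 : R)] --> x.
  rewrite -[X in _ --> X](_ : x + 0 *: v = x); last by rewrite scale0r addr0.
  by apply: cvgD; [exact: cvg_cst|apply: cvgZr_tmp; exact: cvg_id].
have nO : nbhs x Omega by exact: open_nbhs_nbhs.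
have [e /= e0 he] : exists2 e : R, 0 < e & forall t, `|0 - t| < e -> Omega (x + t *: v).
  by have /nbhs_ballP[e /= e0 he] := cf _ nO; exists e => // t; exact: he.
exists (e / 2); first by rewrite divr_gt0.
split; first by apply: he; rewrite sub0r normrN gtr0_norm ?divr_gt0//; lra.
by rewrite -scaleNr; apply: he; rewrite sub0r opprK gtr0_norm ?divr_gt0//; lra.
Qed.

Lemma bounded_in_box : exists M, Omega `<=` box M.
Proof.
have [C [_ hC]] := bO; exists (C + 1) => x Ox.
have := hC (C + 1); rewrite ltrDl ltr01 => /(_ isT x Ox) /=.
rewrite prod_normE /= ge_max !ler_norml => /andP[? ?].
by split; rewrite /= in_itv.
Qed.

Lemma compact_closure_bounded : compact (closure Omega).
Proof.
have [M OM] := bounded_in_box.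
have cB : closed (box M).
  by apply: compact_closed; [exact: norm_hausdorff|exact: compact_box].
apply: (subclosed_compact _ (@compact_box R M)); first exact: closed_closure.
by rewrite [X in _ `<=` X]((closure_id _).1 cB); exact: closureS.
Qed.

Let K := closure Omega.

Let K0 : K !=set0.
Proof. by have [x Ox] := O0; exists x; exact: subset_closure. Qed.

Let sqdist (z : (R * R) * (R * R)) : R := (z.1.1 - z.2.1) ^+ 2 + (z.1.2 - z.2.2) ^+ 2.

Let continuous_sqdist : continuous sqdist.
Proof.
move=> z; have c1 : {for z, continuous (fun z : (R * R) * (R * R) => z.1.1 - z.2.1)}.
  apply: continuousB; apply: continuous_comp; [exact: cvg_fst|exact: fst_continuous|exact: cvg_snd|exact: fst_continuous].
have c2 : {for z, continuous (fun z : (R * R) * (R * R) => z.1.2 - z.2.2)}.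
  apply: continuousB; apply: continuous_comp; [exact: cvg_fst|exact: snd_continuous|exact: cvg_snd|exact: snd_continuous].
exact: (continuousD (continuousM c1 c1) (continuousM c2 c2)).
Qed.

Lemma diameter_attained : exists A B, [/\ K A, K B &
  forall x y, K x -> K y -> sqdist (x, y) <= sqdist (A, B)].
Proof.
have cK := compact_closure_bounded.
have KK0 : K `*` K !=set0 by have [x Kx] := K0; exists (x, x).
have [[A B] + h] := @compact_EVT_max _ _ sqdist _ KK0 (compact_setX cK cK)
  (continuous_subspaceT continuous_sqdist).
rewrite inE => -[/= KA KB]; exists A, B; split => // x y Kx Ky.
by apply: h; rewrite inE.
Qed.

Lemma height_attained (c s : R) : exists C D, [/\ K C, K D &
  forall x, K x -> c * C.2 - s * C.1 <= c * x.2 - s * x.1 <= c * D.2 - s * D.1].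
Proof.
have cK := compact_closure_bounded.
have cf : continuous (fun x : R * R => c * x.2 - s * x.1).
  move=> x; have c1 := @fst_continuous R x; have c2 := @snd_continuous R x.
  exact: (continuousB (continuousMx (@continuous_cstx R c x) c2) (continuousMx (@continuous_cstx R s x) c1)).
have [C + hC] := @compact_EVT_min _ _ _ _ K0 cK (continuous_subspaceT cf).
have [D + hD] := @compact_EVT_max _ _ _ _ K0 cK (continuous_subspaceT cf).
rewrite !inE => KD KC; exists C, D; split => // x Kx.
by rewrite hC ?hD// inE.
Qed.

(** Let A B be a diameter of the closure, of length d, and h the width of Omega
    in the orthogonal direction. Omega lies in a rectangle with sides d and h,
    hence in the ellipse with semi-axes d / sqrt 2 and h / sqrt 2 through its
    vertices. On the other hand Omega contains the two triangles with base A B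
    and vertices C and D where the width is attained, so that its area is at
    least d h / 2; the area of the ellipse is disc_area d h / 2. *)
Lemma convex_in_ellipse : exists c s p q b1 b2 v : R,
  [/\ c ^+ 2 + s ^+ 2 = 1, 0 < b1, 0 < b2, Omega `<=` framed_ellipse c s p q b1 b2 &
    [/\ leb2 (Omega : set (plane R)) = v%:E, 0 < v & b1 * b2 * disc_area <= 4 * v]].
Proof.
have [A [B [KA KB maxd]]] := diameter_attained.
have [z Oz] := O0; have OK x : Omega x -> K x by exact: subset_closure.
pose d := Num.sqrt (sqdist (A, B)).
have d20 : 0 < sqdist (A, B).
  have [e e0 [Oe _]] := open_moves (1, 0) Oz.
  apply: lt_le_trans (maxd _ _ (OK _ Oe) (OK _ Oz)).
  rewrite /sqdist /= /GRing.scale /= mulr1 mulr0 addr0 subrr expr0n addr0 addrC addKr.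
  by rewrite exprn_gt0.
have d0 : 0 < d by rewrite sqrtr_gt0.
have dd : d ^+ 2 = sqdist (A, B) by rewrite sqr_sqrtr// ltW.
have dn : d != 0 by rewrite gt_eqF.
pose c := (B.1 - A.1) / d; pose s := (B.2 - A.2) / d.
have cs : c ^+ 2 + s ^+ 2 = 1.
  rewrite /c /s !expr_div_n -mulrDl (_ : _ + _ = d ^+ 2) ?divff ?expf_neq0//.
  by rewrite dd /sqdist /=; ring.
have B1 : B.1 = A.1 + d * c by rewrite /c; field.
have B2 : B.2 = A.2 + d * s by rewrite /s; field.
clearbody c s.
have [C [D [KC KD ext]]] := height_attained c s.
pose Y (x : R * R) := c * x.2 - s * x.1.
pose X (x : R * R) := c * (x.1 - A.1) + s * (x.2 - A.2).
have sqA x : sqdist (x, A) = X x ^+ 2 + (Y x - Y A) ^+ 2.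
  by rewrite -[LHS]mul1r -cs /sqdist /X /Y /=; ring.
have sqB x : sqdist (x, B) = (X x - d) ^+ 2 + (Y x - Y A) ^+ 2.
  transitivity ((X x - d * (c ^+ 2 + s ^+ 2)) ^+ 2 + (Y x - Y A) ^+ 2); last by rewrite cs mulr1.
  rewrite -[LHS]mul1r -{1}cs /sqdist /X /Y /= B1 B2; ring.
(* A point beyond A or B would be farther than d from the other end. *)
have XK x : K x -> 0 <= X x <= d.
  move=> Kx; have := maxd _ _ Kx KA; have := maxd _ _ Kx KB; rewrite -dd sqA sqB => h1 h2.
  have s0 := sqr_ge0 (Y x - Y A).
  have n1 : `|X x - d| <= d by apply: normr_le_sqr; [exact: ltW|lra].
  have n2 : `|X x| <= d by apply: normr_le_sqr; [exact: ltW|lra].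
  by move: n1 n2; rewrite !ler_norml => /andP[? ?] /andP[? ?]; apply/andP; split; lra.
have XO x : Omega x -> 0 < X x < d.
  move=> Ox; have [e e0 [h1 h2]] := open_moves (c, s) Ox.
  have := XK _ (OK _ h1); have := XK _ (OK _ h2).
  have -> : X (x - e *: (c, s)) = X x - e * (c ^+ 2 + s ^+ 2) by rewrite /X /GRing.scale /= /GRing.scale /=; ring.
  have -> : X (x + e *: (c, s)) = X x + e * (c ^+ 2 + s ^+ 2) by rewrite /X /GRing.scale /= /GRing.scale /=; ring.
  by rewrite cs mulr1 => /andP[? ?] /andP[? ?]; apply/andP; split; lra.
pose h := Y D - Y C.
have h0 : 0 < h.
  have [e e0 [h1 _]] := open_moves (- s, c) Oz.
  have /andP[_ ] := ext _ (OK _ h1); have /andP[+ _] := ext _ (OK _ Oz).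
  have : Y (z + e *: (- s, c)) = Y z + e * (c ^+ 2 + s ^+ 2) by rewrite /Y /GRing.scale /= /GRing.scale /=; ring.
  by rewrite cs mulr1 /h /Y => -> ? ?; lra.
have mO : measurable (Omega : set (plane R)) by exact: open_measurable_plane.
have area : ((d * h / 2)%:E <= leb2 (Omega : set (plane R)))%E.
  have hD : 0 <= Y D - Y A by have /andP[_ +] := ext _ KA; rewrite subr_ge0.
  have hC : 0 <= Y A - Y C by have /andP[+ _] := ext _ KA; rewrite subr_ge0.
  have t1 := triangle_area_le oO cO O0 cs d0 KA KB KD B1 B2 erefl hD.
  (* On the other side of A B, the frame is turned by a half turn and the
     chord is read from B to A. *)
  have cs' : (- c) ^+ 2 + (- s) ^+ 2 = 1 by rewrite !sqrrN.
  have A1 : A.1 = B.1 + d * - c by rewrite B1; ring.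
  have A2 : A.2 = B.2 + d * - s by rewrite B2; ring.
  have YB : - c * B.2 - - s * B.1 = - Y A by rewrite B1 B2 /Y; ring.
  have hC' : Y A - Y C = - c * C.2 - - s * C.1 - (- c * B.2 - - s * B.1) by rewrite YB /Y; ring.
  have t2 := triangle_area_le oO cO O0 cs' d0 KB KA KC A1 A2 hC' hC.
  rewrite YB in t2.
  have mH a b e : measurable ((Omega `&` halfplane a b e) : set (plane R)).
    exact: measurableI mO (measurable_halfplane _ _ _).
  have -> : d * h / 2 = d * (Y D - Y A) / 2 + d * (Y A - Y C) / 2 by rewrite /h; field.
  rewrite EFinD; apply: le_trans (leeD t1 t2) _.
  rewrite -measureU//.
    apply: le_measure; rewrite ?inE//; first exact: measurableU.
    by move=> x [[]|[]].
  apply/seteqP; split => x //= [[_ +] [_ +]]; rewrite /halfplane /= -/(Y A) => ? ?; lra.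
have [M OM] := bounded_in_box.
have fin : (leb2 (Omega : set (plane R)) < +oo)%E.
  apply: le_lt_trans (leb2_box_lty M); apply: le_measure; rewrite ?inE//; exact: measurable_box.
pose v := fine (leb2 (Omega : set (plane R))).
have vE : leb2 (Omega : set (plane R)) = v%:E by rewrite fineK// ge0_fin_numE.
have vdh : d * h / 2 <= v by rewrite -lee_fin -vE.
have dh0 : 0 < d * h / 2 by rewrite divr_gt0// mulr_gt0.
pose r2 := Num.sqrt 2 : R.
have r20 : 0 < r2 by rewrite sqrtr_gt0.
have r22 : r2 ^+ 2 = 2 by rewrite sqr_sqrtr.
exists c, s, (c * A.1 + s * A.2 + d / 2), ((Y C + Y D) / 2), (d / r2), (h / r2), v.
split => //; [by rewrite divr_gt0|by rewrite divr_gt0| |split => //].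
- move=> x Ox; rewrite /framed_ellipse /normalise /sqnorm /=.
  have /andP[X0 Xd] := XO _ Ox; have /andP[YC YD] := ext _ (OK _ Ox).
  have {}YC : Y C <= Y x := YC; have {}YD : Y x <= Y D := YD.
  have -> : c * x.1 + s * x.2 - (c * A.1 + s * A.2 + d / 2) = X x - d / 2 by rewrite /X; ring.
  rewrite -[c * x.2 - _]/(Y x).
  have sqE (a b : R) : 0 < b -> (a / (b / r2)) ^+ 2 = 2 * a ^+ 2 / b ^+ 2.
    by move=> b0; rewrite -r22; field; rewrite !gt_eqF.
  have e1 : (X x - d / 2) ^+ 2 < d ^+ 2 / 4 by nra.
  have e2 : (Y x - (Y C + Y D) / 2) ^+ 2 <= h ^+ 2 / 4 by rewrite /h; nra.
  have f1 : ((X x - d / 2) / (d / r2)) ^+ 2 < 2^-1.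
    by rewrite sqE// ltr_pdivrMr ?exprn_gt0//; lra.
  have f2 : ((Y x - (Y C + Y D) / 2) / (h / r2)) ^+ 2 <= 2^-1.
    by rewrite sqE// ler_pdivrMr ?exprn_gt0//; lra.
  lra.
- exact: lt_le_trans vdh.
- rewrite (_ : d / r2 * (h / r2) = d * h / 2); last by rewrite -r22; field; rewrite gt_eqF.
  have := @disc_area_le4 R; have := @disc_area_gt0 R; nra.
Qed.

End CircumscribedEllipse.

(** * Comparison with the disc *)
Section Eccentricity.
Context {R : realType}.
Implicit Types b : R.

Lemma eccentricity_denom b1 b2 : Num.sqrt 2 * Num.sqrt (b1 ^+ 2 + b2 ^+ 2) = Num.sqrt (2 * (b1 ^+ 2 + b2 ^+ 2)).
Proof. by rewrite sqrtrM. Qed.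

Lemma eccentricity_denom_gt0 b1 b2 : 0 < b1 -> 0 < Num.sqrt (2 * (b1 ^+ 2 + b2 ^+ 2)).
Proof. by move=> b10; rewrite sqrtr_gt0 mulr_gt0// ltr_pwDl ?exprn_gt0 ?sqr_ge0. Qed.

Lemma eccentricity_factor_ge0 b1 b2 : 0 < b1 -> 0 < b2 -> 0 <= eccentricity_factor b1 b2.
Proof. by move=> b10 b20; rewrite divr_ge0 ?mulr_ge0 ?sqrtr_ge0// addr_ge0 ?ltW. Qed.

(** The inequality between the arithmetic and the quadratic mean. *)
Lemma eccentricity_factor_lt1 b1 b2 : 0 < b1 -> 0 < b2 -> b1 != b2 -> eccentricity_factor b1 b2 < 1.
Proof.
move=> b10 b20 b12; rewrite /eccentricity_factor eccentricity_denom.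
rewrite ltr_pdivrMr ?eccentricity_denom_gt0// mul1r.
rewrite -[ltLHS]gtr0_norm ?addr_gt0// -sqrtr_sqr ltr_sqrt; last first.
  by rewrite mulr_gt0// addr_gt0 ?exprn_gt0.
have : 0 < (b1 - b2) ^+ 2 by rewrite exprn_even_gt0//= subr_eq0.
by nra.
Qed.

Lemma eccentricity_factor_diag b : 0 < b -> eccentricity_factor b b = 1.
Proof.
move=> b0; rewrite /eccentricity_factor eccentricity_denom.
rewrite (_ : 2 * (b ^+ 2 + b ^+ 2) = (b + b) ^+ 2); last by ring.
by rewrite sqrtr_sqr gtr0_norm ?addr_gt0// divff// gt_eqF// addr_gt0.
Qed.

Lemma eccentricity_factor_le1 b1 b2 : 0 < b1 -> 0 < b2 -> eccentricity_factor b1 b2 <= 1.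
Proof.
move=> b10 b20; have [->|b12] := eqVneq b1 b2; first by rewrite eccentricity_factor_diag.
exact/ltW/eccentricity_factor_lt1.
Qed.

Lemma eccentricity_factor_le b1 b2 : 0 < b1 -> 0 < b2 ->
  eccentricity_factor b1 b2 <= 2 `^ (- 2^-1) * (1 + b2 / b1).
Proof.
move=> b10 b20; rewrite powRN powR12_sqrt//.
have -> : 1 + b2 / b1 = (b1 + b2) / b1 by field; rewrite gt_eqF.
rewrite /eccentricity_factor invfM mulrCA ler_wpM2l ?invr_ge0 ?sqrtr_ge0//.
apply: ler_wpM2l; first by rewrite addr_ge0// ltW.
rewrite lef_pV2 ?posrE// ?sqrtr_gt0; last by rewrite ltr_pwDl ?exprn_gt0 ?sqr_ge0.
by apply: sqr_le_of_sqrt; [exact: ltW|rewrite lerDl sqr_ge0].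
Qed.

Lemma disc_value_gt0 : 0 < disc_value :> R.
Proof.
by rewrite divr_gt0 ?powR_gt0 ?disc_area_gt0// sqrtr_gt0 divr_gt0// disc_moment_gt0.
Qed.

End Eccentricity.

Section EllipseValues.
Context {R : realType}.
Implicit Types (Omega : set (R * R)).

(** For the ellipse itself the last factor is 1; for the convex sets of the
    second claim it measures the loss of area. *)
Lemma H_functional_inside_ellipse (c s p q b1 b2 v : R) Omega :
  c ^+ 2 + s ^+ 2 = 1 -> 0 < b1 -> 0 < b2 -> 0 < v ->
  measurable (Omega : set (plane R)) -> Omega `<=` framed_ellipse c s p q b1 b2 ->
  leb2 (Omega : set (plane R)) = v%:E ->
  (H_functional Omega <=
   (disc_value * eccentricity_factor b1 b2 * (b1 * b2 * disc_area / v) `^ (3 / 2))%:E)%E.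
Proof.
move=> cs b10 b20 v0 mO OE hv; rewrite -ellipse_value//.
apply: H_functional_le => //.
- by apply: ltW; rewrite !mulr_gt0 ?disc_moment_gt0 ?exprn_gt0 ?invr_gt0 ?mulr_gt0 ?addr_gt0 ?exprn_gt0.
- by rewrite divr_ge0// addr_ge0 ?ltW.
- exact: framed_ellipse_rigidity_le OE.
- exact: framed_ellipse_capacity_le OE.
Qed.

Lemma H_functional_ellipse_le (c s p q b1 b2 : R) :
  c ^+ 2 + s ^+ 2 = 1 -> 0 < b1 -> 0 < b2 ->
  (H_functional (framed_ellipse c s p q b1 b2) <= (disc_value * eccentricity_factor b1 b2)%:E)%E.
Proof.
move=> cs b10 b20; have m0 := @disc_area_gt0 R.
have v0 : 0 < b1 * b2 * disc_area by rewrite !mulr_gt0.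
have := H_functional_inside_ellipse cs b10 b20 v0 (measurable_framed_ellipse c s p q b10 b20)
  (@subset_refl _ _) (framed_ellipse_area p q cs b10 b20).
by rewrite divff ?powR1 ?mulr1 ?gt_eqF.
Qed.

Lemma discE (z : R * R) r : 0 < r -> disc z r = framed_ellipse 1 0 z.1 z.2 r r.
Proof.
move=> r0; rewrite disc_sqnorm//; apply/seteqP; split => x;
  rewrite /framed_ellipse /normalise /frame /sqnorm /= !mul1r !mul0r addr0 subr0 !expr_div_n -mulrDl ltr_pdivrMr ?exprn_gt0// mul1r//.
Qed.

(** A point of the circle is a limit of points of its radius. *)
Lemma circle_closure (z : R * R) r x : 0 < r -> edist z x = r -> closure (disc z r) x.
Proof.
move=> r0 zx B nB.
have sz : (z.1 - x.1) ^+ 2 + (z.2 - x.2) ^+ 2 = r ^+ 2.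
  by rewrite -zx sqr_sqrtr// addr_ge0 ?sqr_ge0.
have cf : (z + t *: (x - z)) @[t --> (1 : R)] --> x.
  rewrite -[X in _ --> X](_ : z + 1 *: (x - z) = x); last by rewrite scale1r addrC subrK.
  by apply: cvgD; [exact: cvg_cst|apply: cvgZr_tmp; exact: cvg_id].
have nt : \forall t \near (1 : R), B (z + t *: (x - z)) by exact: cf _ nB.
have [e /= e0 he] : exists2 e : R, 0 < e & forall t, `|1 - t| < e -> B (z + t *: (x - z)).
  by move: nt => /nbhs_ballP[e /= e0 he]; exists e => // t; exact: he.
pose t := 1 - Num.min (e / 2) 2^-1.
have [m0 m1 m2] : [/\ 0 < Num.min (e / 2) (2^-1 : R), Num.min (e / 2) (2^-1 : R) <= e / 2 & Num.min (e / 2) 2^-1 <= 2^-1 :> R].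
  by rewrite lt_min ge_min lexx ge_min lexx orbT divr_gt0//= invr_gt0.
exists (z + t *: (x - z)); split; last first.
  by apply: he; rewrite /t subKr gtr0_norm//; apply: le_lt_trans m1 _; lra.
rewrite disc_sqnorm// /sqnorm /=.
have t01 : 0 < t < 1 by rewrite /t; apply/andP; split; lra.
rewrite [ltLHS](_ : _ = t ^+ 2 * r ^+ 2); last by rewrite -sz /GRing.scale /=; ring.
rewrite -[ltRHS]mul1r ltr_pM2r ?exprn_gt0//; nra.
Qed.

Lemma H_functional_disc (z : R * R) r : 0 < r -> H_functional (disc z r) = disc_value%:E.
Proof.
move=> r0; have cs : (1 : R) ^+ 2 + 0 ^+ 2 = 1 by rewrite expr1n expr0n addr0.
have hT := framed_ellipse_rigidity z.1 z.2 cs r0 r0.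
have hA := framed_ellipse_area z.1 z.2 cs r0 r0.
have hC : log_capacity (closure (disc z r)) = ((r + r) / 2)%:E.
  apply/eqP; rewrite eq_le; apply/andP; split.
    by rewrite discE//; apply: (framed_ellipse_capacity_le cs r0 r0); exact: subset_refl.
  rewrite (_ : (r + r) / 2 = r); last by lra.
  apply: (@log_capacity_ge _ z r r0 _ (4 * r + 1)).
  - have h := @closed_measurable_plane _ (closure (disc z r)); apply: h; exact: closed_closure.
  - lra.
  - lra.
  - move=> x y; rewrite discE// => /(closure_framed_ellipse r0 r0) hx /(closure_framed_ellipse r0 r0) hy.
    have sq w : sqnorm (normalise 1 0 z.1 z.2 r r w) <= 1 -> (w.1 - z.1) ^+ 2 + (w.2 - z.2) ^+ 2 <= r ^+ 2.
      rewrite /normalise /frame /sqnorm /= !mul1r !mul0r addr0 subr0 !expr_div_n -mulrDl.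
      by rewrite ler_pdivrMr ?exprn_gt0// mul1r.
    have D0 : 0 <= 4 * r + 1 by lra.
    rewrite -[leRHS](ger0_norm D0) -sqrtr_sqr; apply: ler_wsqrtr.
    have := sq _ hx; have := sq _ hy.
    have := sqr_ge0 (x.1 - z.1 + (y.1 - z.1)); have := sqr_ge0 (x.2 - z.2 + (y.2 - z.2)).
    have := sqr_ge0 r; nra.
  - by move=> x; exact: circle_closure.
rewrite -discE// in hT hA.
have m0 := @disc_area_gt0 R; have v0 : 0 < r * r * disc_area by rewrite !mulr_gt0.
rewrite (H_functionalE _ v0 hT hC hA) ?ellipse_value//.
  by rewrite eccentricity_factor_diag// divff ?gt_eqF// powR1 !mulr1.
by apply: ltW; rewrite !mulr_gt0 ?disc_moment_gt0 ?exprn_gt0 ?invr_gt0 ?mulr_gt0 ?addr_gt0 ?exprn_gt0.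
Qed.

Lemma is_ellipse_framed Omega : is_ellipse Omega ->
  exists c s p q b1 b2 : R, [/\ c ^+ 2 + s ^+ 2 = 1, 0 < b1, 0 < b2,
    Omega = framed_ellipse c s p q b1 b2 & b1 = b2 -> is_disc Omega].
Proof.
move=> [z [t [b1 [b2 [b10 b20 ->]]]]].
pose c := cos t; pose s := sin t.
have cs : c ^+ 2 + s ^+ 2 = 1 by exact: cos2Dsin2.
have e : (fun x => z + rotation t x) @` std_ellipse b1 b2 =
    framed_ellipse c s (c * z.1 + s * z.2) (c * z.2 - s * z.1) b1 b2.
  apply/seteqP; split => [_ [y hy <-]|x hx].
    move: hy; rewrite /std_ellipse /framed_ellipse /sqnorm /normalise /frame /rotation /= -/c -/s !expr_div_n.
    congr (_ / _ + _ / _ < _).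
      by rewrite -[in LHS](mul1r y.1) -cs; congr (_ ^+ _); ring.
    by rewrite -[in LHS](mul1r y.2) -cs; congr (_ ^+ _); ring.
  exists (frame c s (c * z.1 + s * z.2) (c * z.2 - s * z.1) x).
    by move: hx; rewrite /std_ellipse /framed_ellipse /sqnorm /normalise /= !expr_div_n.
  rewrite /rotation /frame /= -/c -/s; case: x {hx} => x1 x2; case: z => z1 z2 /=.
  congr pair => /=.
    transitivity (z1 + (c ^+ 2 + s ^+ 2) * (x1 - z1)); first by ring.
    by rewrite cs; ring.
  transitivity (z2 + (c ^+ 2 + s ^+ 2) * (x2 - z2)); first by ring.
  by rewrite cs; ring.
exists c, s, (c * z.1 + s * z.2), (c * z.2 - s * z.1), b1, b2; split => // b12.
exists z, b1; split => //; rewrite e disc_sqnorm// -b12.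
have iso x : (c * x.1 + s * x.2 - (c * z.1 + s * z.2)) ^+ 2 + (c * x.2 - s * x.1 - (c * z.2 - s * z.1)) ^+ 2
    = (x.1 - z.1) ^+ 2 + (x.2 - z.2) ^+ 2 by rewrite -[RHS]mul1r -cs; ring.
by apply/seteqP; split => x; rewrite /framed_ellipse /sqnorm /normalise /frame /= !expr_div_n -mulrDl
  ltr_pdivrMr ?exprn_gt0// mul1r iso.
Qed.

Lemma disc_is_ellipse (z : R * R) r : 0 < r -> is_ellipse (disc z r).
Proof.
move=> r0; exists z, 0, r, r; split => //; rewrite disc_sqnorm//.
apply/seteqP; split => [x hx|_ [y hy <-]].
  exists (x - z); last first.
    by rewrite /rotation cos0 sin0 !mul1r !mul0r subr0 add0r -surjective_pairing addrC subrK.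
  by move: hx; rewrite /std_ellipse /sqnorm /= -mulrDl ltr_pdivrMr ?exprn_gt0// mul1r.
move: hy; rewrite /std_ellipse /= -mulrDl ltr_pdivrMr ?exprn_gt0// mul1r.
by rewrite /rotation cos0 sin0 !mul1r !mul0r subr0 add0r -surjective_pairing [z + _]addrC addrK.
Qed.

Lemma std_ellipseE (b1 b2 : R) : std_ellipse b1 b2 = framed_ellipse 1 0 0 0 b1 b2.
Proof.
by apply/seteqP; split => x;
  rewrite /std_ellipse /framed_ellipse /sqnorm /normalise /frame /= !expr_div_n !mul1r !mul0r addr0 !subr0.
Qed.

End EllipseValues.

(** The area is lost by a factor at most 4, and enters with the exponent 3/2. *)
Lemma H_functional_convex_le (R : realType) (Omega : set (R * R)) :
  Omega !=set0 -> open Omega -> bounded_set Omega ->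
  convex_set (Omega : set (convex_lmodType (R * R)%type)) ->
  (H_functional Omega <= (8 * disc_value)%:E)%E.
Proof.
move=> O0 oO bO cO.
have [c [s [p [q [b1 [b2 [v [cs b10 b20 OE [vE v0 vm]]]]]]]]] := convex_in_ellipse oO cO O0 bO.
apply: le_trans (H_functional_inside_ellipse cs b10 b20 v0 (open_measurable_plane oO) OE vE) _.
have m0 := @disc_area_gt0 R; have w0 : 0 < b1 * b2 * disc_area / v by rewrite divr_gt0 ?mulr_gt0.
have w4 : b1 * b2 * disc_area / v <= 4 by rewrite ler_pdivrMr.
have w8 : (b1 * b2 * disc_area / v) `^ (3 / 2) <= 8.
  rewrite (_ : 8 = (4 : R) `^ (3 / 2)).
    by apply: ge0_ler_powR => //; rewrite nnegrE ltW.
  rewrite powR32// (_ : Num.sqrt 4 = 2); last by rewrite (_ : 4 = 2 ^+ 2) ?sqrtr_sqr ?ger0_norm// -natrX.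
  by ring.
have e1 := eccentricity_factor_le1 b10 b20; have e0 := eccentricity_factor_ge0 b10 b20.
have d0 := @disc_value_gt0 R.
rewrite lee_fin [leRHS]mulrC; apply: ler_pM => //; rewrite ?powR_ge0//.
  by rewrite mulr_ge0// ltW.
by rewrite ler_piMr// ltW.
Qed.

Local Open Scope ereal_scope.

Theorem theorem4 (R : realType) :
  let B1 : set (R * R) := disc (0%R, 0%R) 1%R in
  (ereal_sup [set H_functional Omega | Omega in @is_ellipse R]
     = H_functional B1 /\
   forall Omega : set (R * R), is_ellipse Omega ->
     (H_functional Omega
        = ereal_sup [set H_functional Omega' | Omega' in @is_ellipse R]
      <-> is_disc Omega)) /\
  ereal_sup [set H_functional Omega | Omega in
      [set Omega : set (R * R) |
        [/\ Omega !=set0, open Omega, bounded_set Omega &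
            convex_set (Omega : set (convex_lmodType (R * R)%type))]]]
    <= 8%:E * H_functional B1 /\
  (forall b1 b2 : R, (0 < b2)%R -> (b2 <= b1)%R ->
     H_functional (std_ellipse b1 b2)
       <= (2 `^ (- 2^-1))%:E * H_functional B1 * (1 + b2 / b1)%:E).
Proof.
move=> B1; have hB : H_functional B1 = disc_value%:E by exact: H_functional_disc.
have d0 := @disc_value_gt0 R.
have ell_le (Omega : set (R * R)) : is_ellipse Omega -> H_functional Omega <= disc_value%:E.
  move=> /is_ellipse_framed[c [s [p [q [b1 [b2 [cs b10 b20 -> _]]]]]]].
  apply: le_trans (H_functional_ellipse_le p q cs b10 b20) _.
  by rewrite lee_fin ler_piMr ?(ltW d0)// eccentricity_factor_le1.
have sup : ereal_sup [set H_functional Omega | Omega in @is_ellipse R] = disc_value%:E.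
  apply/eqP; rewrite eq_le; apply/andP; split.
    by apply: ge_ereal_sup => _ [D /ell_le h <-].
  rewrite -hB; apply: ereal_sup_ubound; exists B1 => //.
  exact: disc_is_ellipse.
rewrite sup hB; split; first split => //.
- move=> Omega eO; split=> [|[z [r [r0 ->]]]]; last exact: H_functional_disc.
  have [c [s [p [q [b1 [b2 [cs b10 b20 OE dO]]]]]]] := is_ellipse_framed eO.
  have [/dO//|b12] := eqVneq b1 b2.
  move=> h; have := H_functional_ellipse_le p q cs b10 b20.
  rewrite -OE h lee_fin leNgt => /negP[].
  by rewrite -[ltRHS]mulr1 ltr_pM2l// eccentricity_factor_lt1.
- split.
    apply: ge_ereal_sup => _ [D [D0 oD bD cD] <-].
    by rewrite -EFinM; exact: H_functional_convex_le.
  move=> b1 b2 b20 b21; have b10 : (0 < b1)%R by exact: lt_le_trans b21.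
  have cs : ((1 : R) ^+ 2 + 0 ^+ 2 = 1)%R by rewrite expr1n expr0n addr0.
  rewrite std_ellipseE; apply: le_trans (H_functional_ellipse_le 0 0 cs b10 b20) _.
  rewrite -!EFinM lee_fin [leRHS](_ : _ = disc_value * (2 `^ (- 2^-1) * (1 + b2 / b1)))%R; last by ring.
  by rewrite ler_pM2l// eccentricity_factor_le.
Qed.
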